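(* Let $q=p^n$ with $p$ prime and $n\ge1$, and let $\sigma\in\mathrm{PGU}(3,q)$ be a nontrivial element. Then one of the following cases occurs (that is, each of the following implications holds, and $\sigma$ satisfies the hypothesis of at least one of them). \begin{enumerate} \item If $\mathrm{ord}(\sigma)=2$ and $2\mid(q+1)$, then $\sigma$ is of type (A) and $i(\sigma)=q+1$. \item If $\mathrm{ord}(\sigma)=3$, $3\mid(q+1)$ and $\sigma$ is of type (B3), then $i(\sigma)=3$. \item If $\mathrm{ord}(\sigma)\ne2$, $\mathrm{ord}(\sigma)\mid(q+1)$ and $\sigma$ is of type (A), then $i(\sigma)=q+1$. \item If $\mathrm{ord}(\sigma)\ne2$, $\mathrm{ord}(\sigma)\mid(q+1)$ and $\sigma$ is of type (B1), then $i(\sigma)=0$. \item If $\mathrm{ord}(\sigma)\mid(q^2-1)$ and $\mathrm{ord}(\sigma)\nmid(q+1)$, then $\sigma$ is of type (B2) and $i(\sigma)=2$. \item If $\mathrm{ord}(\sigma)\ne3$ and $\mathrm{ord}(\sigma)\mid(q^2-q+1)$, then $\sigma$ is of type (B3) and $i(\sigma)=3$. \item If $p=2$ and $\mathrm{ord}(\sigma)=4$, then $\sigma$ is of type (D) and $i(\sigma)=2$. \item If $\mathrm{ord}(\sigma)=p$, $p\ne2$ and $\sigma$ is of type (D), then $i(\sigma)=2$. \item If $\mathrm{ord}(\sigma)=p$ and $\sigma$ is of type (C), then $i(\sigma)=q+2$. \item If $\mathrm{ord}(\sigma)\ne p$, $p\mid\mathrm{ord}(\sigma)$ and $\mathrm{ord}(\sigma)\ne4$,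 then $\sigma$ is of type (E) and $i(\sigma)=1$. \end{enumerate}
   Context: $\mathcal H_q$ is the Hermitian curve, the non-singular plane curve $X^{q+1}+Y^{q+1}+T^{q+1}=0$, considered up to projective equivalence over $\mathbb F_{q^2}$ (another model is $Y^{q+1}=X^qT+XT^q$). $\mathrm{PGU}(3,q)\le\mathrm{PGL}(3,q^2)$ is the group of linear collineations over $\mathbb F_{q^2}$ preserving $\mathcal H_q$; it equals $\mathrm{Aut}(\mathcal H_q)$ and acts on $\mathrm{PG}(2,\overline{\mathbb F}_q)$. The set $\mathcal H_q(\mathbb F_{q^2})$ is the set of isotropic points of a unitary polarity of $\mathrm{PG}(2,q^2)$; each line of $\mathrm{PG}(2,q^2)$ meets $\mathcal H_q(\mathbb F_{q^2})$ in $1$ point (a tangent) or $q+1$ points (a chord). A triangle is self-polar if each side is the polar line of the opposite vertex. A linear collineation is a $(P,\ell)$-perspectivity if it preserves each line through the point $P$ (center) and fixes each point of the line $\ell$ (axis); it is an elation if $P\in\ell$ and a homology if $P\notin\ell$. For a nontrivial $\sigma\in\mathrm{PGU}(3,q)$, the contribution of $\sigma$ to the degree of the different divisor is $$i(\sigma)=\sum_{P} v_P(\sigma(t)-t)\ \ge 0,$$ where $P$ ranges over the points of $\mathcal H_q(\overline{\mathbb F}_q)$ fixed by $\sigma$, $t$ is a local parameter at $P$, and $v_P$ is the valuation at $P$. Types of nontrivial $\sigma\in\mathrm{PGU}(3,q)$: (A) $\mathrm{ord}(\sigma)\mid(q+1)$ and $\sigma$ is a homology whose center $P$ is off $\mathcal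 H_q$ and whose axis $\ell$ is a chord of $\mathcal H_q(\mathbb F_{q^2})$, with $(P,\ell)$ a pole-polar pair. (B) $\mathrm{ord}(\sigma)$ is coprime with $p$, $\sigma$ is not a homology, and $\sigma$ fixes the vertices $P_1,P_2,P_3$ of a non-degenerate triangle $T$; with subtypes: (B1) $P_1,P_2,P_3$ are $\mathbb F_{q^2}$-rational and off $\mathcal H_q$, $T$ is self-polar, and $\mathrm{ord}(\sigma)\mid(q+1)$; (B2) $P_1,P_2,P_3$ are $\mathbb F_{q^2}$-rational, $P_1\notin\mathcal H_q$, $P_2,P_3\in\mathcal H_q$, $\mathrm{ord}(\sigma)\mid(q^2-1)$ and $\mathrm{ord}(\sigma)\nmid(q+1)$; (B3) $P_1,P_2,P_3\in\mathrm{PG}(2,q^6)\setminus\mathrm{PG}(2,q^2)$, $P_1,P_2,P_3\in\mathcal H_q$, and $\mathrm{ord}(\sigma)\mid(q^2-q+1)$. (C) $\mathrm{ord}(\sigma)=p$ and $\sigma$ is an elation whose center $P$ is a point of $\mathcal H_q$ and whose axis $\ell$ is a tangent of $\mathcal H_q(\mathbb F_{q^2})$, with $(P,\ell)$ a pole-polar pair. (D) $\mathrm{ord}(\sigma)=p$ with $p\neq2$, or $\mathrm{ord}(\sigma)=4$ and $p=2$; $\sigma$ is not an elation and fixes an $\mathbb F_{q^2}$-rational point $P\in\mathcal H_q$ and a line $\ell$ tangent to $\mathcal H_q(\mathbb F_{q^2})$, with $(P,\ell)$ a pole-polar pair. (E) $p\mid\mathrm{ord}(\sigma)$, $p^2\nmid\mathrm{ord}(\sigma)$,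 $\mathrm{ord}(\sigma)\neq p$, and $\sigma$ fixes two $\mathbb F_{q^2}$-rational points $P\in\mathcal H_q$, $Q\notin\mathcal H_q$. *)

(* Defs.v *)
From HB Require Import structures.
From mathcomp Require Import all_boot all_order all_algebra all_fingroup all_solvable.
From mathcomp Require Import mpoly.

Set Implicit Arguments.
Unset Strict Implicit.
Unset Printing Implicit Defensive.

Import GRing.Theory.
Local Open Scope ring_scope.

(* 'GL_3[F] is the whole of {'GL_3[F]}, so every element of the quotient type
   is the class of an invertible matrix modulo the scalar ones. *)
Definition PGL3 (F : finFieldType) : finGroupType := coset_of 'Z('GL_3[F])%g.

(* The projective plane over K: points and lines are the subspaces of K^3
   (row vectors) of dimension 1 and 2; incidence is inclusion. *)
Definition point (K : fieldType) := {P : {vspace 'rV[K]_3} | (\dim P == 1)%N}.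
Definition line (K : fieldType) := {l : {vspace 'rV[K]_3} | (\dim l == 2)%N}.
Definition point_vspace K (P : point K) : {vspace 'rV[K]_3} := val P.
Coercion point_vspace : point >-> space.
Definition line_vspace K (l : line K) : {vspace 'rV[K]_3} := val l.
Coercion line_vspace : line >-> space.

Section LocalRing.

Variables (K : fieldType) (H : {mpoly K[3]}) (P : point K).
Local Notation poly3 := {mpoly K[3]}.

Definition vanishes_on (U : {vspace 'rV[K]_3}) (f : poly3) : Prop :=
  forall v : 'rV[K]_3, v \in U -> f.@[v ord0] = 0.

Definition ideal_mul (I J : poly3 -> Prop) (f : poly3) : Prop :=
  exists (r : nat) (a b : 'I_r -> poly3),
    (forall i, I (a i) /\ J (b i)) /\ f = \sum_i a i * b i.

Fixpoint ideal_exp (I : poly3 -> Prop) (k : nat) : poly3 -> Prop :=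
  if k is k'.+1 then ideal_mul I (ideal_exp I k') else fun=> True.

(* A pair (f, g) of forms of the same degree stands for the rational function
   f / g on the curve H = 0; its denominator does not vanish at P, so it lies
   in the local ring O_P of the curve at P. *)
Definition regular_at (t : poly3 * poly3) : Prop :=
  exists d : nat, [/\ t.1 \is d.-homog, t.2 \is d.-homog
                    & ~ vanishes_on P t.2].

(* f / g lies in the k-th power of the maximal ideal of O_P: in the homogeneous
   localisation at the ideal I(P) of the point, f lies in I(P)^k + (H). The
   form D clears the denominators. *)
Definition in_max_ideal_exp (k : nat) (t : poly3 * poly3) : Prop :=
  exists (D B E : poly3) (d : nat),
    [/\ D \is d.-homog, ~ vanishes_on P D,
        ideal_exp (vanishes_on P) k E & D * t.1 = E + B * H].

(* v_P(t) = k, for t in O_P *)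
Definition has_valuation (t : poly3 * poly3) (k : nat) : Prop :=
  [/\ regular_at t, in_max_ideal_exp k t & ~ in_max_ideal_exp k.+1 t].

Definition local_parameter (t : poly3 * poly3) : Prop := has_valuation t 1.

End LocalRing.

Section HermitianCurve.

Variables (F : finFieldType) (K : fieldType) (iota : {rmorphism F -> K}).
Variables (q : nat).
Implicit Types (sigma : PGL3 F) (P Q : point K) (l : line K).

Definition hermitian_poly : {mpoly K[3]} := \sum_(i < 3) 'X_i ^+ q.+1.

Definition on_curve (U : {vspace 'rV[K]_3}) : Prop := vanishes_on U hermitian_poly.

(* repr picks a matrix in the class sigma. Another choice differs by a scalar:
   it acts alike on subspaces, and sigma(f / g) below is the same fraction. *)
Definition mx_of sigma : 'M[K]_3 := map_mx iota (GLval (repr sigma)).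

Definition img sigma (U : {vspace 'rV[K]_3}) : {vspace 'rV[K]_3} :=
  (linfun (mulmxr (mx_of sigma)) @: U)%VS.

Definition fixes sigma (U : {vspace 'rV[K]_3}) : Prop := img sigma U = U.

Definition in_PGU sigma : Prop :=
  forall P, on_curve (img sigma P) <-> on_curve P.

(* U belongs to PG(2, m): it is spanned by vectors with coordinates in the
   subfield of K of order m, which consists of the roots of X^m - X. *)
Definition rational (m : nat) (U : {vspace 'rV[K]_3}) : Prop :=
  exists s : seq 'rV[K]_3,
    (forall v, v \in s -> forall i, v ord0 i ^+ m = v ord0 i) /\ U = <<s>>%VS.

Definition is_polar P (U : {vspace 'rV[K]_3}) : Prop :=
  forall w : 'rV[K]_3,
    w \in U <->
    (forall v : 'rV[K]_3, v \in (P : {vspace 'rV[K]_3}) ->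
       \sum_(i < 3) v ord0 i ^+ q * w ord0 i = 0).

(* The unitary polarity is an involution on PG(2, q^2) only. *)
Definition pole_polar P l : Prop :=
  [/\ rational (q ^ 2) P, rational (q ^ 2) l & is_polar P l].

(* l is a line of PG(2, q^2) with exactly m points in H_q(F_{q^2}). *)
Definition meets_in l (m : nat) : Prop :=
  rational (q ^ 2) l /\
  exists s : seq (point K),
    [/\ uniq s, size s = m
      & forall P, P \in s <-> [/\ rational (q ^ 2) P, on_curve P & (P <= l)%VS]].

Definition tangent l : Prop := meets_in l 1.
Definition chord l : Prop := meets_in l q.+1.

Definition perspectivity sigma P l : Prop :=
  (forall m : line K, (P <= m)%VS -> fixes sigma m) /\
  (forall Q, (Q <= l)%VS -> fixes sigma Q).

Definition elation sigma P l : Prop := perspectivity sigma P l /\ (P <= l)%VS.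
Definition homology sigma P l : Prop := perspectivity sigma P l /\ ~ (P <= l)%VS.

(* The substitution f |-> f o sigma, for row vectors acted on from the right. *)
Definition pullback sigma (f : {mpoly K[3]}) : {mpoly K[3]} :=
  f \mPo [tuple \sum_(i < 3) mx_of sigma i j *: 'X_i | j < 3].

(* sigma(f / g) - f / g, with sigma acting on functions by t |-> t o sigma.
   Letting sigma act by t o sigma^-1 instead gives the same valuations
   at the points fixed by sigma. *)
Definition displacement sigma (t : {mpoly K[3]} * {mpoly K[3]}) :
    {mpoly K[3]} * {mpoly K[3]} :=
  (pullback sigma t.1 * t.2 - t.1 * pullback sigma t.2,
   pullback sigma t.2 * t.2).

(* v_P(sigma(t) - t) = k for one, equivalently every, local parameter t *)
Definition local_contribution sigma P (k : nat) : Prop :=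
  (exists t, local_parameter hermitian_poly P t) /\
  (forall t, local_parameter hermitian_poly P t ->
     has_valuation hermitian_poly P (displacement sigma t) k).

(* i(sigma) = k *)
Definition contribution sigma (k : nat) : Prop :=
  exists (s : seq (point K)) (e : point K -> nat),
    [/\ uniq s,
        forall P, P \in s <-> on_curve P /\ fixes sigma P,
        forall P, P \in s -> local_contribution sigma P (e P)
      & k = \sum_(P <- s) e P]%N.

Definition typeA sigma : Prop :=
  (#[sigma]%g %| q + 1)%N /\
  exists P l,
    [/\ homology sigma P l, ~ on_curve P, chord l & pole_polar P l].

Definition typeB (p : nat) sigma P1 P2 P3 : Prop :=
  [/\ coprime #[sigma]%g p,
      ~ (exists P l, homology sigma P l),
      \dim (P1 + P2 + P3)%VS = 3%N
    & [/\ fixes sigma P1, fixes sigma P2 & fixes sigma P3]].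

Definition typeB1 p sigma : Prop :=
  exists P1 P2 P3,
    [/\ typeB p sigma P1 P2 P3,
        [/\ rational (q ^ 2) P1, rational (q ^ 2) P2 & rational (q ^ 2) P3],
        [/\ ~ on_curve P1, ~ on_curve P2 & ~ on_curve P3],
        [/\ is_polar P1 (P2 + P3)%VS, is_polar P2 (P1 + P3)%VS
          & is_polar P3 (P1 + P2)%VS]
      & (#[sigma]%g %| q + 1)%N].

Definition typeB2 p sigma : Prop :=
  exists P1 P2 P3,
    [/\ typeB p sigma P1 P2 P3,
        [/\ rational (q ^ 2) P1, rational (q ^ 2) P2 & rational (q ^ 2) P3],
        [/\ ~ on_curve P1, on_curve P2 & on_curve P3],
        (#[sigma]%g %| q ^ 2 - 1)%N
      & ~ (#[sigma]%g %| q + 1)%N].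

Definition typeB3 p sigma : Prop :=
  exists P1 P2 P3,
    [/\ typeB p sigma P1 P2 P3,
        [/\ rational (q ^ 6) P1, rational (q ^ 6) P2 & rational (q ^ 6) P3],
        [/\ ~ rational (q ^ 2) P1, ~ rational (q ^ 2) P2
          & ~ rational (q ^ 2) P3],
        [/\ on_curve P1, on_curve P2 & on_curve P3]
      & (#[sigma]%g %| q ^ 2 - q + 1)%N].

Definition typeC p sigma : Prop :=
  #[sigma]%g = p /\
  exists P l, [/\ elation sigma P l, on_curve P, tangent l & pole_polar P l].

Definition typeD p sigma : Prop :=
  [/\ (#[sigma]%g = p /\ p <> 2%N) \/ (#[sigma]%g = 4%N /\ p = 2%N),
      ~ (exists P l, elation sigma P l)
    & exists P l,
        [/\ rational (q ^ 2) P /\ on_curve P, tangent l, pole_polar P l,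
            fixes sigma P & fixes sigma l]].

Definition typeE p sigma : Prop :=
  [/\ (p %| #[sigma]%g)%N, ~ (p ^ 2 %| #[sigma]%g)%N, #[sigma]%g <> p
    & exists P Q,
        [/\ rational (q ^ 2) P /\ on_curve P, rational (q ^ 2) Q /\ ~ on_curve Q,
            fixes sigma P & fixes sigma Q]].

End HermitianCurve.

(* Main.v *)
Require Import Defs.
From HB Require Import structures.
From mathcomp Require Import all_boot all_order all_algebra all_fingroup all_solvable.
From mathcomp Require Import mpoly separable finfield.
From mathcomp Require Import ring zify.

(* A matrix of a collineation preserving the curve can be scaled to a unitary matrix U over
   F_(q^2), so the eigenvalue map a |-> a^(-q) permutes the eigenvalues of U. The Jordan form
   of U has one of five shapes: three distinct eigenvalues (permuted with cycle type 1+1+1,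
   1+2 or 3, giving B1, B2, B3), a homology (A), a block of size 2 beside another eigenvalue
   (E), a transvection (C), or a single block of size 3 (D); each shape determines the order
   and the fixed points. For the contribution at a fixed point v of the curve, take u on the
   tangent at v, w off it, and the formal parametrisation x(s) = v + s u + y(s) w of the
   branch: the valuation of a form is the order in s of its value at x(s). If U maps x(s) to
   c0 v + c1 u + c2 w, the contribution is the order of c1 - s c0. *)

Set Implicit Arguments.
Unset Strict Implicit.
Unset Printing Implicit Defensive.

Import GRing.Theory.
Local Open Scope ring_scope.

(** * Substitution in forms and homogenisation *)

(** [has_valuation] speaks of powers of the ideal of a point modulo [H], so passing to orders along
    the branch has two halves. Substituting the branch in a membership identity bounds the order
    from below. The converse needs an explicit membership: a polynomial branch, correct modulo
    ['X^N], is homogenised in the linear forms dual to the frame. [N] only has to exceed the order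
    being measured, so no power series occur. Over [K] the map [a |-> a ^+ q] is no involution, so
    [herm] is not symmetric up to conjugation: left and right orthogonality are obtained separately,
    from unitarity of [U] or from rationality. Rationality of a fixed point rests on one remark: the
    entries of [U] lie in F_(q^2), so the Frobenius map of F_(q^2) sends an eigenvector for [a] to
    one for [a ^+ (q ^ 2)]. The value q+2 for an elation is one more than the contact order q+1 of
    the curve with its tangent at a rational point. In the final case analysis the hypotheses that
    belong to another shape are refuted; the one arithmetical overlap, between divisors of q^2-1 and
    of q^2-q+1, is order 3. *)

Section Substitution.

Variables (n : nat) (K S : comNzRingType) (h : {rmorphism K -> S}).
Implicit Types (x y : 'I_n -> S) (f : {mpoly K[n]}).

Lemma eq_mmap x y f : x =1 y -> mmap h x f = mmap h y f.
Proof. by move=> xy; apply: eq_bigr => m _; rewrite (mmap1_eq _ xy). Qed.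

Lemma mmapZ_homog (c : S) x d f :
  f \is d.-homog -> mmap h (fun i => c * x i) f = c ^+ d * mmap h x f.
Proof.
move=> /dhomogP fd; rewrite /mmap mulr_sumr big_seq [RHS]big_seq.
apply: eq_bigr => m /fd <-; rewrite mulrCA; congr (_ * _).
rewrite /mmap1 /= mdegE -prodrXr -big_split /=.
by apply: eq_bigr => i _; rewrite exprMn.
Qed.

(** Congruence modulo [e] is compatible with sums and products. It serves below with [e] the defect
    of a homogenised parametrisation. *)
Lemma mmap_congr (e : S) x y f :
  (forall i, exists g, x i - y i = e * g) ->
  exists g, mmap h x f - mmap h y f = e * g.
Proof.
move=> xy.
pose R (a b : S) := exists g, a - b = e * g.
have RM a b a' b' : R a b -> R a' b' -> R (a * a') (b * b').
  move=> [g Eg] [g' Eg']; exists (g * a' + b * g').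
  by rewrite mulrDr mulrA -Eg (mulrCA e b) -Eg'; ring.
rewrite /mmap -sumrB; elim/big_rec: _ => [|m s _ [g ->]].
  by exists 0; rewrite mulr0.
have [g' Eg'] : R (mmap1 x m) (mmap1 y m).
  apply: (big_ind2 R) => [||i _]; [by exists 0; rewrite subrr mulr0 | exact: RM|].
  elim: (m i) => [|k IHk]; first by exists 0; rewrite !expr0 subrr mulr0.
  by rewrite !exprS; apply: RM.
by exists (h f@_m * g' + g); rewrite -mulrBr Eg'; ring.
Qed.

End Substitution.

Lemma mmap_comp_mpoly (n k : nat) (K S : comNzRingType) (h : {rmorphism K -> S})
    (x : 'I_k -> S) (T : n.-tuple {mpoly K[k]}) (f : {mpoly K[n]}) :
  mmap h x (f \mPo T) = mmap h (fun i => mmap h x (tnth T i)) f.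
Proof.
rewrite /comp_mpoly [X in mmap h x X]/mmap rmorph_sum /=; apply: eq_bigr => m _.
rewrite rmorphM /= mmapC; congr (_ * _); rewrite /mmap1 rmorph_prod /=.
by apply: eq_bigr => i _; rewrite rmorphXn.
Qed.

Lemma dhomog_mmap (n k d e : nat) (K : comNzRingType)
    (x : 'I_n -> {mpoly K[k]}) (f : {mpoly K[n]}) :
  f \is d.-homog -> (forall i, x i \is e.-homog) ->
  mmap (@mpolyC k K) x f \is (e * d)%N.-homog.
Proof.
move=> /dhomogP fd xe; rewrite /mmap big_seq; apply: rpred_sum => m /fd /= <-.
rewrite mul_mpolyC; apply: dhomogZ; rewrite /mmap1 mdegE big_distrr /=.
elim/big_rec2: _ => [|i d' g _]; first exact: dhomog1.
by move=> gd'; apply: dhomogM => //; apply: dhomogMn.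
Qed.

Section Homogenisation.

Variables (K A : comNzRingType) (h : {rmorphism K -> A}) (x z : A).
Implicit Types (a b : {poly K}).

(** This is [x ^ e * a(z / x)] without division; coefficients beyond degree [e] are dropped, hence
    the size hypotheses below. [A] is the ring of forms when memberships are built, and [{poly K}]
    when they are evaluated along a branch. *)
Definition homogenise (e : nat) a : A :=
  \sum_(j < e.+1) h a`_j * (z ^+ j * x ^+ (e - j)).

Lemma homogeniseD e a b :
  homogenise e (a + b) = homogenise e a + homogenise e b.
Proof.
by rewrite /homogenise -big_split; apply: eq_bigr => j _; rewrite coefD rmorphD mulrDl.
Qed.

Lemma homogeniseZ e c a : homogenise e (c *: a) = h c * homogenise e a.
Proof.
by rewrite /homogenise mulr_sumr; apply: eq_bigr => j _; rewrite coefZ rmorphM -!mulrA.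
Qed.

Lemma homogenise0 e : homogenise e 0 = 0.
Proof. by apply: big1 => j _; rewrite coef0 rmorph0 mul0r. Qed.

Lemma homogeniseXn e k : (k <= e)%N -> homogenise e 'X^k = z ^+ k * x ^+ (e - k).
Proof.
rewrite -ltnS => ke; rewrite /homogenise (bigD1 (Ordinal ke)) //= coefXn eqxx.
rewrite rmorph1 mul1r big1 ?addr0 // => j; rewrite -val_eqE /= coefXn => /negbTE->.
by rewrite rmorph0 mul0r.
Qed.

Lemma homogeniseC e c : homogenise e c%:P = h c * x ^+ e.
Proof. by rewrite -alg_polyC homogeniseZ -(expr0 (polyX K)) homogeniseXn // subn0 mul1r. Qed.

Lemma homogenise_sum e (I : Type) (r : seq I) (F : I -> {poly K}) :
  homogenise e (\sum_(i <- r) F i) = \sum_(i <- r) homogenise e (F i).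
Proof.
by apply: (big_morph _ (homogeniseD e) (homogenise0 e)).
Qed.

Lemma homogeniseM e e' a b : (size a <= e.+1)%N -> (size b <= e'.+1)%N ->
  homogenise (e + e') (a * b) = homogenise e a * homogenise e' b.
Proof.
move=> sa sb; have expand k (c : {poly K}) : (size c <= k.+1)%N -> c = \sum_(i < k.+1) c`_i *: 'X^i.
  by move=> sc; rewrite -poly_def; apply/polyP => i; rewrite coef_poly;
     case: ltnP => // ki; apply: nth_default; apply: leq_trans ki.
rewrite {1}(expand _ _ sa) {1}(expand _ _ sb) mulr_suml homogenise_sum.
rewrite {2}/homogenise mulr_suml; apply: eq_bigr => i _.
rewrite mulr_sumr homogenise_sum [in RHS]/homogenise mulr_sumr; apply: eq_bigr => j _.
have [ie je] := (ltn_ord i, ltn_ord j); rewrite !ltnS in ie je.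
rewrite -scalerAl -scalerAr -exprD !homogeniseZ homogeniseXn ?leq_add //.
have -> : (e + e' - (i + j) = (e - i) + (e' - j))%N by lia.
by rewrite !exprD; ring.
Qed.

Lemma homogenise_dvd e k (a : {poly K}) :
  (forall i, (i < k)%N -> a`_i = 0) -> exists g, homogenise e a = z ^+ k * g.
Proof.
move=> ak; pose g := \sum_(j < e.+1 | (k <= j)%N) h a`_j * (z ^+ (j - k) * x ^+ (e - j)).
exists g; rewrite /homogenise (bigID (fun j : 'I_e.+1 => (k <= j)%N)) /=.
rewrite [X in _ + X]big1 ?addr0 => [|j]; last first.
  by rewrite -ltnNge => /ak ->; rewrite rmorph0 mul0r.
rewrite mulr_sumr; apply: eq_bigr => j kj.
have -> : z ^+ j = z ^+ k * z ^+ (j - k) by rewrite -exprD subnKC.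
by ring.
Qed.

End Homogenisation.

Lemma rmorph_homogenise (K A B : comNzRingType) (h : {rmorphism K -> A})
    (h' : {rmorphism K -> B}) (f : {rmorphism A -> B}) (x z : A) e a :
  (forall c, f (h c) = h' c) ->
  f (homogenise h x z e a) = homogenise h' (f x) (f z) e a.
Proof.
move=> fh; rewrite rmorph_sum; apply: eq_bigr => j _ /=.
by rewrite !rmorphM !rmorphXn fh.
Qed.

Section HomogeniseSubstitution.

Variables (n : nat) (K A : comNzRingType) (h : {rmorphism K -> A}).
Variables (x z : A) (e : nat) (v : 'I_n -> {poly K}).
Hypothesis ve : forall i, (size (v i) <= e.+1)%N.

(** The degree bound is proved along with the identity because [homogeniseM] needs it at every
    multiplication. *)
Lemma mmap1_homogenise (m : 'X_{1..n}) :
  (size (mmap1 v m) <= (e * mdeg m).+1)%N /\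
  mmap1 (fun i => homogenise h x z e (v i)) m
    = homogenise h x z (e * mdeg m) (mmap1 v m).
Proof.
rewrite /mmap1 mdegE big_distrr /=.
have one : (size (1%R : {poly K}) <= 1)%N /\ 1 = homogenise h x z 0 1.
  by rewrite size_poly1 -(expr0 (polyX K)) homogeniseXn // mulr1.
have mul e1 e2 (a b : {poly K}) A1 A2 :
    (size a <= e1.+1)%N /\ A1 = homogenise h x z e1 a ->
    (size b <= e2.+1)%N /\ A2 = homogenise h x z e2 b ->
    (size (a * b)%R <= (e1 + e2).+1)%N /\ A1 * A2 = homogenise h x z (e1 + e2) (a * b).
  move=> [sa ->] [sb ->]; rewrite homogeniseM //; split => //.
  by apply: leq_trans (size_polyMleq _ _) _; lia.
elim/big_ind3: _ => // [e1 a A1 e2 b A2|i _]; first exact: mul.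
elim: (m i) => [|k IHk]; first by rewrite muln0 !expr0.
by rewrite mulnS !exprS; apply: mul.
Qed.

Lemma mmap_homogenise d (f : {mpoly K[n]}) : f \is d.-homog ->
  mmap h (fun i => homogenise h x z e (v i)) f
    = homogenise h x z (e * d) (mmap (@polyC K) v f).
Proof.
move=> /dhomogP fd; rewrite /mmap homogenise_sum big_seq [RHS]big_seq.
apply: eq_bigr => m /fd /= <-; rewrite mul_polyC homogeniseZ.
by rewrite (mmap1_homogenise m).2.
Qed.

End HomogeniseSubstitution.

Lemma size_mmap_homog (n : nat) (K : comNzRingType) e (v : 'I_n -> {poly K}) d
    (f : {mpoly K[n]}) :
  (forall i, (size (v i) <= e.+1)%N) -> f \is d.-homog -> (size (mmap (@polyC K) v f) <= (e * d).+1)%N.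
Proof.
move=> ve /dhomogP fd; rewrite /mmap big_seq.
elim/big_ind: _ => [|a b sa sb|m /fd /= <-]; first by rewrite size_poly0.
  by rewrite (leq_trans (size_polyD _ _)) // geq_max sa.
by rewrite mul_polyC (leq_trans (size_scale_leq _ _)) // (mmap1_homogenise (@idfun K) 0 0 ve m).1.
Qed.

(** * The Hermitian form *)

Section SesquilinearForm.

Variables (R : comNzRingType) (q : nat).
Hypothesis q_pchar : [pchar R].-nat q.
Implicit Types (x y : 'rV[R]_3) (a : R).

(** The Hermitian form of the unitary polarity, extended to arbitrary rings: q-semilinear in [x],
    linear in [y]. Its diagonal is the equation of the curve, and [herm q v] is the linear form of
    the tangent at a point [v] of the curve. *)
Definition herm x y : R := \sum_(i < 3) x ord0 i ^+ q * y ord0 i.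

Lemma hermDr x y y' : herm x (y + y') = herm x y + herm x y'.
Proof. by rewrite -big_split; apply: eq_bigr => i _; rewrite mxE mulrDr. Qed.

Lemma hermZr a x y : herm x (a *: y) = a * herm x y.
Proof. by rewrite /herm mulr_sumr; apply: eq_bigr => i _; rewrite mxE mulrCA. Qed.

Lemma hermDl x x' y : herm (x + x') y = herm x y + herm x' y.
Proof.
rewrite -big_split; apply: eq_bigr => i _ /=.
by rewrite mxE exprDn_pchar // mulrDl.
Qed.

Lemma hermZl a x y : herm (a *: x) y = a ^+ q * herm x y.
Proof.
by rewrite /herm mulr_sumr; apply: eq_bigr => i _; rewrite mxE exprMn mulrA.
Qed.

Lemma herm0l y : herm 0 y = 0.
Proof.
apply: big1 => i _; rewrite mxE expr0n; case: eqP => [q0|_]; last by rewrite mul0r.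
by move: q_pchar; rewrite q0.
Qed.

Lemma herm0r x : herm x 0 = 0.
Proof. by apply: big1 => i _; rewrite mxE mulr0. Qed.

End SesquilinearForm.


Section Hermitian.
Variables (K : fieldType) (S : comNzRingType) (h : {rmorphism K -> S}) (q : nat).

Lemma mmap_hermitian_poly (x : 'rV[S]_3) :
  mmap h (x ord0) (hermitian_poly K q) = herm q x x.
Proof.
rewrite rmorph_sum /=; apply: eq_bigr => i _.
by rewrite rmorphXn /= mmapX mmap1U exprSr.
Qed.

Lemma herm_map (x y : 'rV[K]_3) : herm q (map_mx h x) (map_mx h y) = h (herm q x y).
Proof. by rewrite rmorph_sum; apply: eq_bigr => i _; rewrite !mxE rmorphM rmorphXn. Qed.

Lemma pchar_nat_map : [pchar K].-nat q -> [pchar S].-nat q.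
Proof. by rewrite (eq_pnat _ (fmorph_pchar h)). Qed.
End Hermitian.

Lemma dvdp_XnP (K : fieldType) k (a : {poly K}) :
  reflect (forall i, (i < k)%N -> a`_i = 0) ('X^k %| a).
Proof.
apply: (iffP idP) => [/dvdpP [g ->] i ik | ak]; first by rewrite coefMXn ik.
rewrite -(poly_take_drop k a); rewrite (_ : take_poly k a = 0) ?add0r ?dvdp_mull //.
by apply/polyP => i; rewrite coef_take_poly coef0; case: ltnP => // /ak.
Qed.

Lemma dvdp_Xhorner (K : fieldType) (a : {poly K}) : ('X %| a) = (a.[0] == 0).
Proof. by rewrite -['X]subr0 -[0]/(0%:P) dvdp_XsubCl. Qed.

Lemma Gauss_dvdp_Xnr (K : fieldType) k (a b : {poly K}) :
  a.[0] != 0 -> ('X^k %| a * b) = ('X^k %| b).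
Proof.
move=> a0; rewrite Gauss_dvdpr // coprimep_expl //.
by rewrite coprimep_sym -['X]subr0 -[0]/(0%:P) coprimep_XsubC.
Qed.

Lemma dvdp_Xn_trans (K : fieldType) k l (a : {poly K}) :
  (k <= l)%N -> 'X^l %| a -> 'X^k %| a.
Proof. by move=> kl; apply: dvdp_trans; rewrite dvdp_exp2l. Qed.

Section Germ.

Variables (K : fieldType) (q : nat).
Hypotheses (q_pchar : [pchar K].-nat q) (q_gt1 : (1 < q)%N).
Notation H := (hermitian_poly K q).
Notation lift := (map_mx (@polyC K)).
Notation ev z := (mmap (@polyC K) (z ord0)).

Lemma pchar_nat_poly : [pchar {poly K}].-nat q.
Proof. exact: (pchar_nat_map (@polyC K)). Qed.

Lemma pchar_nat_mpoly : [pchar {mpoly K[3]}].-nat q.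
Proof. exact: (pchar_nat_map (@mpolyC 3 K)). Qed.

Lemma horner_ev (z : 'rV[{poly K}]_3) c (f : {mpoly K[3]}) :
  (ev z f).[c] = f.@[(map_mx (horner^~ c) z) ord0].
Proof.
rewrite /mmap horner_sum mevalE; apply: eq_bigr => m _.
rewrite hornerM hornerC horner_prod; congr (_ * _).
by apply: eq_bigr => i _; rewrite horner_exp mxE.
Qed.

Lemma meval_homogZ (v : 'I_3 -> K) c d (f : {mpoly K[3]}) :
  f \is d.-homog -> f.@[fun i => c * v i] = c ^+ d * f.@[v].
Proof. exact: mmapZ_homog. Qed.

Lemma vanishes_on_vline (v : 'rV[K]_3) d (f : {mpoly K[3]}) :
  f \is d.-homog -> vanishes_on <[v]>%VS f <-> f.@[v ord0] = 0.
Proof.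
move=> fd; split => [|fv _ /vlineP [c ->]]; first by apply; exact: memv_line.
rewrite -[RHS](mulr0 (c ^+ d)) -fv -meval_homogZ //.
by apply: meval_eq => i; rewrite mxE.
Qed.

Section Forward.

Variables (v : 'rV[K]_3) (z : 'rV[{poly K}]_3) (c : K) (N : nat).
Hypotheses (z0 : map_mx (horner^~ 0) z = c *: v) (c_neq0 : c != 0).
Hypothesis z_curve : 'X^N %| herm q z z.

Lemma ev_vanishes f : vanishes_on <[v]>%VS f -> 'X %| ev z f.
Proof.
move=> fv; rewrite dvdp_Xhorner horner_ev z0 fv //.
by rewrite memvZ // memv_line.
Qed.

Lemma ev_ideal_exp k f : ideal_exp (vanishes_on <[v]>%VS) k f -> 'X^k %| ev z f.
Proof.
elim: k f => [|k IHk] f /=; first by rewrite dvd1p.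
move=> [r [a [b [ab ->]]]]; rewrite rmorph_sum /=.
elim/big_ind: _ => [||i _]; [exact: dvdp0 | exact: dvdp_add|].
have [/ev_vanishes ai /IHk bi] := ab i.
by rewrite rmorphM exprS dvdp_mul.
Qed.

(** Evaluate the identity [D * t.1 = E + B * H] at [z]: [D] gets a nonzero constant term, each
    factor of [E] in the ideal of the point brings a factor ['X], and [H] vanishes to order [N],
    which is at least [k]. *)
Lemma ev_in_max_ideal_exp (P : point K) k t : point_vspace P = <[v]>%VS ->
  (k <= N)%N -> in_max_ideal_exp H P k t -> 'X^k %| ev z t.1.
Proof.
move=> Pv kN [D [B [E [d [Dd DP]]]]]; rewrite Pv in DP * => EP /(congr1 (ev z)).
rewrite rmorphM rmorphD rmorphM /= mmap_hermitian_poly => DtE.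
rewrite -(@Gauss_dvdp_Xnr _ _ (ev z D)).
  rewrite DtE dvdp_add ?ev_ideal_exp // dvdp_mull //; exact: dvdp_Xn_trans z_curve.
rewrite horner_ev z0; apply/eqP => D0; apply: DP; apply/(vanishes_on_vline _ Dd).
apply/eqP; have := D0; rewrite (@meval_eq _ _ _ (fun i => c * v ord0 i)) => [|i].
  by rewrite (meval_homogZ _ _ Dd) => /eqP; rewrite mulf_eq0 expf_eq0 (negbTE c_neq0) andbF.
by rewrite mxE.
Qed.

End Forward.

End Germ.

(** * Local parametrisations of the curve *)

Local Notation o0 := (@Ordinal 3 0 isT).
Local Notation o1 := (@Ordinal 3 1 isT).
Local Notation o2 := (@Ordinal 3 2 isT).

Lemma sum3 (V : nmodType) (f : 'I_3 -> V) : \sum_i f i = f o0 + f o1 + f o2.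
Proof.
rewrite !big_ord_recl big_ord0 addr0 addrA.
by congr (f _ + f _ + f _); apply: val_inj.
Qed.

Lemma ord3P (P : 'I_3 -> Prop) : P o0 -> P o1 -> P o2 -> forall i, P i.
Proof.
move=> P0 P1 P2 [[|[|[|//]]] i3]; [move: P0|move: P1|move: P2];
by congr P; apply: val_inj.
Qed.

Section Frames.

Variable K : fieldType.
Implicit Types (x v u w : 'rV[K]_3).

Definition frame v u w : 'M[K]_3 := \matrix_(i < 3) [:: v; u; w]`_i.

Lemma mulmx_frame x v u w :
  x *m frame v u w = x ord0 o0 *: v + x ord0 o1 *: u + x ord0 o2 *: w.
Proof. by apply/rowP => j; rewrite !mxE sum3 !mxE. Qed.

Lemma frame_unit v u w :
  (forall a b c : K, a *: v + b *: u + c *: w = 0 -> [/\ a = 0, b = 0 & c = 0]) ->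
  frame v u w \in unitmx.
Proof.
move=> free; rewrite -row_free_unit -kermx_eq0.
apply/eqP/row_matrixP => i; rewrite row0.
have: row i (kermx (frame v u w)) *m frame v u w = 0 by rewrite -row_mul mulmx_ker row0.
rewrite mulmx_frame => /free [a b c]; apply/rowP.
by apply: ord3P; rewrite [RHS]mxE.
Qed.

Lemma frame_coord v u w x : frame v u w \in unitmx ->
  exists a b c, x = a *: v + b *: u + c *: w.
Proof.
move=> B; pose y := x *m invmx (frame v u w).
exists (y ord0 o0), (y ord0 o1), (y ord0 o2).
by rewrite -mulmx_frame mulmxKV.
Qed.

Lemma frame_free v u w (a b c a' b' c' : K) : frame v u w \in unitmx ->
  a *: v + b *: u + c *: w = a' *: v + b' *: u + c' *: w ->
  [/\ a = a', b = b' & c = c'].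
Proof.
move=> B; pose y (r s t : K) : 'rV_3 := \row_i [:: r; s; t]`_i.
have E r s t : r *: v + s *: u + t *: w = y r s t *m frame v u w.
  by rewrite mulmx_frame !mxE.
rewrite !E => /(can_inj (mulmxK B)) /rowP yE.
by move: (yE o0) (yE o1) (yE o2); rewrite !mxE.
Qed.

Lemma frame_free0 v u w (a b c : K) : frame v u w \in unitmx ->
  a *: v + b *: u + c *: w = 0 -> [/\ a = 0, b = 0 & c = 0].
Proof.
by move=> B E; apply: (frame_free B); rewrite E !scale0r !addr0.
Qed.

End Frames.

Section LocalParametrisation.

Variables (K : fieldType) (q : nat).
Hypotheses (q_pchar : [pchar K].-nat q) (q_gt1 : (1 < q)%N).
Notation H := (hermitian_poly K q).
Notation lift := (map_mx (@polyC K)).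
Notation ev z := (mmap (@polyC K) (z ord0)).
Notation hermp := (@herm {poly K} q).

Variables (v u w : 'rV[K]_3).
Hypotheses (vv : herm q v v = 0) (vu : herm q v u = 0) (vw : herm q v w != 0).

(** A polynomial [y] stands for the power series of the branch; the equation of the curve is imposed
    modulo ['X^N] only. *)
Definition germ (y : {poly K}) : 'rV[{poly K}]_3 :=
  lift v + 'X *: lift u + y *: lift w.

Let qP := pchar_nat_poly q_pchar.
Let q_gt0 : (0 < q)%N. Proof. exact: ltnW. Qed.

(** Apart from [y * herm q v w], every term carries a factor ['X^q] or [y ^+ q]. Since [herm q v w]
    is nonzero, the order of [y] on the curve is read off from the other terms. *)
Lemma herm_germ y : herm q (germ y) (germ y) =
  y * (herm q v w)%:P
  + 'X^q * ((herm q u v)%:P + y * (herm q u w)%:P + 'X * (herm q u u)%:P)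
  + y ^+ q * ((herm q w v)%:P + y * (herm q w w)%:P + 'X * (herm q w u)%:P).
Proof.
rewrite /germ !hermDr !hermZr !(hermDl qP) !hermZl !herm_map vv vu rmorph0; ring.
Qed.

Lemma germ0 (y : {poly K}) : 'X %| y -> map_mx (horner^~ 0) (germ y) = v.
Proof.
rewrite dvdp_Xhorner => /eqP y0; apply/rowP => i; rewrite !mxE.
by rewrite !hornerE y0 !mul0r !addr0.
Qed.

(* Hensel's lemma, the derivative of the equation in the direction [w] being [herm q v w]. *)
Lemma germ_on_curve N : exists2 y, 'X %| y & 'X^N %| hermp (germ y) (germ y).
Proof.
case: N => [|N]; first by exists 0; rewrite ?dvdp0 ?dvd1p.
elim: N => [|N [y Xy /dvdpP [r rE]]].
  exists 0; rewrite ?dvdp0 // herm_germ mul0r add0r expr0n eqn0Ngt q_gt0 /= !mul0r !addr0 ?add0r.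
  by rewrite dvdp_mulr // dvdp_exp2l.
(* Newton correction: [c] is chosen to cancel the constant term of the quotient [r]. The terms in
   [e ^+ q] have order at least q(N+1), which is beyond N+1. *)
pose c := r.[0] / herm q v w; pose e := - (c%:P * 'X^(N.+1)); exists (y + e).
  by rewrite dvdp_add // dvdpNr dvdp_mull // exprS dvdp_mulr.
have -> : germ (y + e) = germ y + e *: lift w by rewrite /germ scalerDl addrA.
have herm_move x t : hermp (x + e *: t) (x + e *: t) = hermp x x + e ^+ q * hermp t x
    + e * (hermp x t + e ^+ q * hermp t t).
  by rewrite hermDr !(hermDl qP) !hermZr !hermZl; ring.
rewrite herm_move rE.
set d1 := hermp (lift w) _; set d2 := hermp _ _; set d3 := hermp _ _.
have -> : r * 'X^(N.+1) + e ^+ q * d1 + e * (d2 + e ^+ q * d3)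
    = 'X^(N.+1) * (r - c%:P * d2) + e ^+ q * (d1 + e * d3).
  by set eq := e ^+ q; rewrite /e; ring.
rewrite dvdp_add //; last first.
  rewrite dvdp_mulr // -dvdpNr /e exprNn -mulrN dvdp_mull // exprMn -mulrN dvdp_mull //.
  by rewrite dvdpNr -exprM dvdp_exp2l //; nia.
rewrite exprSr dvdp_mul // dvdp_Xhorner !hornerE /d2.
rewrite /germ !(hermDl qP) !hermZl !herm_map !hornerE.
move: Xy; rewrite dvdp_Xhorner => /eqP ->.
by rewrite expr0n eqn0Ngt q_gt0 /= !mul0r !addr0 divfK // subrr.
Qed.

(** Tangency of [u]: in [herm_germ] all terms except [y * herm q v w] have order at least q, hence
    at least 2. *)
Lemma germ_order y N : (1 < N)%N -> 'X %| y -> 'X^N %| hermp (germ y) (germ y) ->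
  'X^2 %| y.
Proof.
move=> N1 Xy; move/(dvdp_Xn_trans N1); rewrite herm_germ.
have q2 : ('X^2 : {poly K}) %| 'X^q by rewrite dvdp_exp2l.
have y2 : 'X^2 %| y ^+ q by apply: dvdp_trans q2 _; rewrite dvdp_exp2r.
rewrite -addrA dvdp_addl; last by rewrite dvdp_add // dvdp_mulr.
by rewrite [y * _]mulrC Gauss_dvdp_Xnr // hornerC.
Qed.

(** The coefficient of ['X^q] in [herm_germ] is [herm q u v], up to multiples of [y]. Once it
    vanishes, the next term ['X^(q+1) * herm q u u] governs [y]: the tangent has contact of order
    q+1, as at a rational point of the Hermitian curve. *)
Lemma germ_order_rational y N : (q + 2 <= N)%N -> herm q u v = 0 ->
  'X %| y -> 'X^N %| hermp (germ y) (germ y) ->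
  'X^(q + 1) %| y /\ (herm q u u != 0 -> ~~ ('X^(q + 2) %| y)).
Proof.
move=> Nq uv Xy yN; have X2y : 'X^2 %| y by apply: germ_order yN => //; lia.
move/(dvdp_Xn_trans Nq): yN; rewrite herm_germ uv polyC0 add0r.
have yq : 'X^(q + 2) %| y ^+ q.
  apply: (@dvdp_trans _ ('X^2 ^+ q)); last by rewrite dvdp_exp2r.
  by rewrite -exprM dvdp_exp2l //; lia.
rewrite dvdp_addl; last by rewrite dvdp_mulr.
rewrite mulrDr addrA addrAC dvdp_addl; last first.
  by rewrite exprD dvdp_mul // dvdp_mulr.
rewrite mulrA -exprSr => yE; split => [|uu].
  have: 'X^(q + 1) %| y * (herm q v w)%:P + 'X^(q.+1) * (herm q u u)%:P.
    by apply: dvdp_Xn_trans yE; lia.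
  rewrite dvdp_addl; last by rewrite dvdp_mulr // addn1.
  by rewrite [y * _]mulrC Gauss_dvdp_Xnr ?hornerC.
apply: contra uu => y2; move: yE; rewrite dvdp_addr ?(dvdp_mulr _ y2) // addn2 exprSr.
by rewrite dvdp_mul2l ?expf_neq0 ?polyX_eq0 // dvdp_Xhorner hornerC.
Qed.

End LocalParametrisation.

(** * Valuations *)

Lemma ideal_exp_mul (K : fieldType) (I : {mpoly K[3]} -> Prop) k z g :
  I z -> ideal_exp I k (z ^+ k * g).
Proof.
move=> Iz; elim: k => [//|k IHk].
exists 1, (fun=> z), (fun=> z ^+ k * g); split => [i|]; first by split.
by rewrite big_ord_recl big_ord0 addr0 exprS mulrA.
Qed.

Lemma homogenise_id10 (K : comNzRingType) e (a : {poly K}) :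
  homogenise (@idfun K) 1 0 e a = a.[0].
Proof.
rewrite /homogenise big_ord_recl big1 ?addr0 => [|i _].
  by rewrite expr0 expr1n !mulr1 horner_coef0.
by rewrite expr0n /= mul0r mulr0.
Qed.

(* First-order expansion along [z = s x], where the homogenisation of [a] is [x ^+ e * a(s)]. *)
Lemma homogenise_taylor (K : comNzRingType) (x z : {poly K}) e (a g : {poly K}) :
  z = 'X * g -> (size a <= e.+1)%N ->
  exists r, homogenise (@polyC K) x z e a
    = x ^+ e * a + (a`_1)%:P * x ^+ e.-1 * (z - 'X * x) + 'X * (z - 'X * x) * r.
Proof.
move=> zE sa; set d := z - 'X * x.
have -> : x ^+ e * a = homogenise (@polyC K) x ('X * x) e a.
  have {1}-> : a = \sum_(j < e.+1) a`_j *: 'X^j.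
    rewrite -poly_def; apply/polyP => i; rewrite coef_poly.
    by case: ltnP => // ei; apply: nth_default; apply: leq_trans ei.
  rewrite mulr_sumr; apply: eq_bigr => j _; rewrite exprMn -mul_polyC.
  have {1}-> : e = (j + (e - j))%N by rewrite subnKC // -ltnS.
  by rewrite exprD; ring.
have pow j : exists r, z ^+ j.+2 = ('X * x) ^+ j.+2 + 'X * d * r.
  elim: j => [|j [r rE]].
    by exists (g + x); rewrite /d zE; ring.
  exists (z * r + ('X * x) ^+ j.+1 * x).
  rewrite exprS rE (exprS ('X * x) j.+2) !(exprS ('X * x) j.+1).
  by move: (('X * x) ^+ j.+1) => t; rewrite /d; ring.
case: e sa => [|e] sa.
  exists 0; rewrite (@nth_default _ 0 a 1) // polyC0 /homogenise !big_ord_recl !big_ord0; ring.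
have pows (j : 'I_e) : exists r, z ^+ j.+2 = ('X * x) ^+ j.+2 + 'X * d * r by exact: pow.
have /(@fin_all_exists _ _ (fun (j : 'I_e) r => z ^+ j.+2 = ('X * x) ^+ j.+2 + 'X * d * r)) [r rE] := pows.
exists (\sum_(j < e) (a`_j.+2)%:P * (r j * x ^+ (e.+1 - j.+2))).
rewrite /homogenise !big_ord_recl mulr_sumr /= /bump /= !add1n subn1 /=.
rewrite (eq_bigr (fun i : 'I_e => (a`_i.+2)%:P * (('X * x) ^+ i.+2 * x ^+ (e.+1 - i.+2))
   + 'X * d * ((a`_i.+2)%:P * (r i * x ^+ (e.+1 - i.+2))))) => [|i _].
  by rewrite big_split /= -!mulr_sumr /d; ring.
by rewrite /bump /= !add1n rE; ring.
Qed.

Section LocalRing.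

Variables (K : fieldType) (q : nat).
Hypotheses (q_pchar : [pchar K].-nat q) (q_gt1 : (1 < q)%N).
Notation H := (hermitian_poly K q).
Notation lift := (map_mx (@polyC K)).
Notation ev z := (mmap (@polyC K) (z ord0)).
Notation hermp := (@herm {poly K} q).

Variables (v u w : 'rV[K]_3) (y : {poly K}) (N : nat).
Hypotheses (frameP : frame v u w \in unitmx).
Hypotheses (vv : herm q v v = 0) (vu : herm q v u = 0) (vw : herm q v w != 0).
Hypotheses (Xy : 'X %| y) (gN : 'X^N %| hermp (germ v u w y) (germ v u w y)).

Let q_gt0 : (0 < q)%N. Proof. exact: ltnW. Qed.
Let B := frame v u w.
(** A degree large enough for all coordinates of the germ, including the term in ['X] when [y] is 0,
    and equal to the degree of the forms [X0 ^+ (size y) * 'X_j] with which the homogenised germ is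
    compared. *)
Let e := (size y).+1.

Definition coord_form (i : 'I_3) : {mpoly K[3]} :=
  \sum_(j < 3) invmx (frame v u w) j i *: 'X_j.

Lemma varX_homog (i : 'I_3) : ('X_i : {mpoly K[3]}) \is 1.-homog.
Proof. by rewrite dhomogX /= mdeg1. Qed.

Lemma coord_homog i : coord_form i \is 1.-homog.
Proof. by apply: rpred_sum => j _; rewrite dhomogZ // varX_homog. Qed.

Lemma mmap_coord (S : comNzRingType) (h : {rmorphism K -> S}) (z : 'rV[S]_3) i :
  mmap h (z ord0) (coord_form i) = (z *m map_mx h (invmx (frame v u w))) ord0 i.
Proof.
rewrite rmorph_sum mxE; apply: eq_bigr => j _ /=.
by rewrite mmapZ mmapX mmap1U mxE mulrC.
Qed.

Lemma mmap_coord_frame (S : comNzRingType) (h : {rmorphism K -> S}) (a b c : S) z i :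
  z = a *: map_mx h v + b *: map_mx h u + c *: map_mx h w ->
  mmap h (z ord0) (coord_form i) = [:: a; b; c]`_i.
Proof.
pose x : 'rV[S]_3 := \row_i [:: a; b; c]`_i.
have -> : a *: map_mx h v + b *: map_mx h u + c *: map_mx h w = x *m map_mx h B.
  by apply/rowP => j; rewrite !mxE sum3 !mxE.
by move=> ->; rewrite mmap_coord -mulmxA -map_mxM mulmxV // map_mx1 mulmx1 mxE.
Qed.

Lemma meval_coord (a b c : K) z i : z = a *: v + b *: u + c *: w ->
  (coord_form i).@[z ord0] = [:: a; b; c]`_i.
Proof.
move=> zE; apply: (@mmap_coord_frame _ idfun a b c).
by rewrite !map_mx_id.
Qed.

Lemma coordK (j : 'I_3) :
  'X_j = coord_form o0 * (v ord0 j)%:MP + coord_form o1 * (u ord0 j)%:MP + coord_form o2 * (w ord0 j)%:MP.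
Proof.
have E (i : 'I_3) : coord_form o0 * (B o0 i)%:MP + coord_form o1 * (B o1 i)%:MP
    + coord_form o2 * (B o2 i)%:MP = 'X_i.
  rewrite -(@sum3 _ (fun k => coord_form k * (B k i)%:MP)).
  transitivity (\sum_k \sum_j (invmx B j k * B k i) *: 'X_j : {mpoly K[3]}).
    apply: eq_bigr => k _; rewrite mulr_suml; apply: eq_bigr => l _.
    by rewrite mulrC mul_mpolyC scalerA mulrC.
  rewrite exchange_big (bigD1 i) //= [X in _ + X]big1 ?addr0 => [|l li].
    by rewrite -scaler_suml; move/matrixP: (mulVmx frameP) => /(_ i i);
       rewrite !mxE eqxx => ->; rewrite scale1r.
  rewrite -scaler_suml; move/matrixP: (mulVmx frameP) => /(_ l i).
  by rewrite !mxE (negbTE li) => ->; rewrite scale0r.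
by rewrite -E !mxE.
Qed.

Let X0 := coord_form o0.
Let Z := coord_form o1.
Let Y := coord_form o2.
Let hom := homogenise (@mpolyC 3 K) X0 Z e.
Let g := germ v u w y.

Lemma size_germ i : (size (g ord0 i) <= e.+1)%N.
Proof.
have sC (a : {poly K}) b c : (size a <= b)%N -> (size (a * c%:P)%R <= b)%N.
  by move=> ab; rewrite mulrC mul_polyC (leq_trans (size_scale_leq _ _)).
rewrite !mxE (leq_trans (size_polyD _ _)) // geq_max sC ?andbT; last exact: leqW.
rewrite (leq_trans (size_polyD _ _)) // geq_max sC ?size_polyX // andbT.
by rewrite (leq_trans (size_polyC_leq1 _)).
Qed.

Lemma homogenise_homog k (a : {poly K}) :
  homogenise (@mpolyC 3 K) X0 Z k a \is k.-homog.
Proof.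
apply: rpred_sum => j _; rewrite mul_mpolyC dhomogZ //.
have := dhomogM (dhomogMn j (coord_homog o1)) (dhomogMn (k - j) (coord_homog o0)).
by rewrite !mul1n subnKC // -ltnS.
Qed.

(** The generic point, scaled by [X0 ^+ (size y)], and the homogenised germ agree exactly in their
    [v] and [u] coordinates, so they differ along [w] only. *)
Lemma hom_germ j : X0 ^+ (size y) * 'X_j - hom (g ord0 j)
  = (X0 ^+ (size y) * Y - hom y) * (w ord0 j)%:MP.
Proof.
rewrite [in LHS]coordK !mxE /hom !homogeniseD ![_ * _%:P]mulrC !mul_polyC !homogeniseZ.
rewrite homogeniseC -(expr1 (polyX K)) homogeniseXn // /e subn1 /= exprS.
by rewrite -/X0 -/Z -/Y; ring.
Qed.

Lemma hermitian_poly_homog : H \is q.+1.-homog.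
Proof.
apply: rpred_sum => i _; have := dhomogMn q.+1 (varX_homog i).
by rewrite mul1n.
Qed.

Lemma mmap_mpolyX (f : {mpoly K[3]}) : mmap (@mpolyC 3 K) (fun i => 'X_i) f = f.
Proof.
rewrite -[RHS]comp_mpoly_id /comp_mpoly; apply: eq_mmap => i.
by rewrite tnth_mktuple.
Qed.

(* The form [D] is the partial derivative of [H] in the direction [w], up to a multiple of
   the defect [eps] of the parametrisation; hence [eps] is small as soon as [H] vanishes. *)
Lemma local_equation : exists (D : {mpoly K[3]}) (k : nat),
  [/\ D \is k.-homog, D.@[v ord0] != 0
    & forall d f, f \is d.-homog -> exists A G : {mpoly K[3]},
        D * (X0 ^+ (size y * d) * f)
          = D * homogenise (@mpolyC 3 K) X0 Z (e * d) (ev g f) + A * H + Z ^+ N * G].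
Proof.
pose T1 : 'rV[{mpoly K[3]}]_3 := \row_j (X0 ^+ size y * 'X_j).
pose T2 : 'rV[{mpoly K[3]}]_3 := \row_j hom (g ord0 j).
pose wM := map_mx (@mpolyC 3 K) w.
pose eps := X0 ^+ size y * Y - hom y.
have T12 : T1 = T2 + eps *: wM.
  apply/rowP => j; rewrite [RHS]mxE [T1 _ _]mxE [T2 _ _]mxE [(_ *: wM) _ _]mxE [wM _ _]mxE.
  by rewrite -(hom_germ j) addrC subrK.
pose D := herm q T2 wM + eps ^+ q.-1 * herm q wM T1.
have T1E d f : f \is d.-homog ->
    mmap (@mpolyC 3 K) (T1 ord0) f = X0 ^+ (size y * d) * f.
  move=> fd; rewrite -[f in RHS]mmap_mpolyX exprM -mmapZ_homog //.
  by apply: eq_mmap => i; rewrite mxE.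
have T2E d f : f \is d.-homog -> mmap (@mpolyC 3 K) (T2 ord0) f
    = homogenise (@mpolyC 3 K) X0 Z (e * d) (ev g f).
  move=> fd; rewrite -mmap_homogenise //; last exact: size_germ.
  by apply: eq_mmap => i; rewrite mxE.
have [G0 G0E] : exists G0, homogenise (@mpolyC 3 K) X0 Z (e * q.+1) (hermp g g) = Z ^+ N * G0.
  by apply: homogenise_dvd => i; move/dvdp_XnP: gN; apply.
(* Sesquilinear expansion at [T1 = T2 + eps *: wM] shows that the values of [H] at [T1] and [T2]
   differ by [eps * D]. The value at [T1] is a multiple of [H] by homogeneity, and the one at [T2]
   is divisible by [Z ^+ N] since the germ lies on the curve modulo ['X^N]. *)
have DE : eps * D = X0 ^+ (size y * q.+1) * H - Z ^+ N * G0.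
  have := T1E _ _ hermitian_poly_homog; have := T2E _ _ hermitian_poly_homog.
  rewrite !mmap_hermitian_poly G0E => E2 <-; rewrite -E2 {1}T12.
  rewrite (hermDl (pchar_nat_mpoly q_pchar)) hermZl.
  have -> : herm q T2 T1 = herm q T2 T2 + eps * herm q T2 wM by rewrite T12 hermDr hermZr.
  have -> : eps ^+ q = eps * eps ^+ q.-1 by rewrite -exprS prednK.
  by rewrite /D; ring.
have X0_homog k : X0 ^+ k \is k.-homog.
  by have := dhomogMn k (coord_homog o0); rewrite mul1n.
have T1h i : T1 ord0 i \is e.-homog.
  by rewrite mxE; have := dhomogM (X0_homog (size y)) (varX_homog i); rewrite addn1.
have T2h i : T2 ord0 i \is e.-homog by rewrite mxE homogenise_homog.
have eps_homog : eps \is e.-homog.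
  rewrite /eps rpredB ?homogenise_homog //.
  by have := dhomogM (X0_homog (size y)) (coord_homog o2); rewrite addn1.
exists D, (e * q)%N; split.
- rewrite rpredD //.
    apply: rpred_sum => i _; rewrite mulrC mxE mul_mpolyC dhomogZ //.
    exact: dhomogMn.
  have -> : (e * q = e * q.-1 + e)%N by rewrite -mulnSr prednK.
  apply: dhomogM; first exact: dhomogMn.
  apply: rpred_sum => i _.
  by rewrite mxE -rmorphXn mul_mpolyC dhomogZ.
- have vE : v = 1 *: v + 0 *: u + 0 *: w by rewrite scale1r !scale0r !addr0.
  have X0v : X0.@[v ord0] = 1 by rewrite (meval_coord o0 vE).
  have Zv : Z.@[v ord0] = 0 by rewrite (meval_coord o1 vE).
  have Yv : Y.@[v ord0] = 0 by rewrite (meval_coord o2 vE).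
  have homv a : (hom a).@[v ord0] = a.[0].
    rewrite /hom (@rmorph_homogenise _ _ _ _ (@idfun K) (meval (v ord0))).
      by rewrite /= X0v Zv homogenise_id10.
    by move=> c; apply: mevalC.
  have epsv : eps.@[v ord0] = 0.
    by rewrite mevalB mevalM Yv mulr0 homv; move: Xy; rewrite dvdp_Xhorner => /eqP ->; rewrite subrr.
  have -> : D.@[v ord0] = herm q v w.
    rewrite mevalD mevalM rmorphXn /= epsv expr0n.
    have -> : (q.-1 == 0)%N = false by lia.
    rewrite mul0r addr0 rmorph_sum; apply: eq_bigr => i _ /=.
    rewrite [T2 _ _]mxE [wM _ _]mxE mevalM mevalC rmorphXn /= homv.
    by have /rowP/(_ i) := germ0 v u w Xy; rewrite mxE => ->.
  exact: vw.
move=> d f fd; rewrite -(T1E d) //.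
(* Between [T1] and [T2] the value of [f] changes by a multiple of [eps], and [D * eps] lies in the
   ideal of [H] and [Z ^+ N] by [DE]. *)
have [|r rE] := @mmap_congr _ _ _ (@mpolyC 3 K) eps (T1 ord0) (T2 ord0) f.
  by move=> i; exists (w ord0 i)%:MP; rewrite T12 [(T2 + _ *: _) _ _]mxE [(_ *: wM) _ _]mxE [wM _ _]mxE addrAC subrr add0r.
exists (X0 ^+ (size y * q.+1) * r), (- G0 * r).
rewrite -(T2E d) // -[mmap _ (T1 ord0) _](subrK (mmap (@mpolyC 3 K) (T2 ord0) f)) rE.
by rewrite mulrDr addrC -addrA; congr (_ + _); rewrite mulrA [D * _]mulrC DE; ring.
Qed.

(** Converse of [ev_in_max_ideal_exp]. In [local_equation] the multiplier [D * X0 ^+ (size y * d)]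
    is a unit at the point, while both the homogenised value of [t.1] and [Z ^+ N] are multiples of
    [Z ^+ k], with [Z] vanishing at the point. *)
Lemma in_max_ideal_exp_germ (P : point K) k d t : point_vspace P = <[v]>%VS ->
  (k <= N)%N -> t.1 \is d.-homog -> 'X^k %| ev g t.1 -> in_max_ideal_exp H P k t.
Proof.
move=> Pv kN td /dvdp_XnP tk; have [D [l [Dl Dv DE]]] := local_equation.
have [A [G E]] := DE d _ td.
have [r rE] := homogenise_dvd (@mpolyC 3 K) X0 Z (e * d) tk.
have vE : v = 1 *: v + 0 *: u + 0 *: w by rewrite scale1r !scale0r !addr0.
exists (D * X0 ^+ (size y * d)), A, (Z ^+ k * (D * r + Z ^+ (N - k) * G)).
exists (l + 1 * (size y * d))%N; rewrite Pv.
have Dh : D * X0 ^+ (size y * d) \is (l + 1 * (size y * d)).-homog.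
  by apply: dhomogM => //; apply: dhomogMn; apply: coord_homog.
split => //.
- move/(vanishes_on_vline v Dh)/eqP; apply/negP.
  by rewrite mevalM rmorphXn /= (meval_coord o0 vE) expr1n mulr1.
- apply: ideal_exp_mul => _ /vlineP [c ->].
  by rewrite (@meval_coord c 0 0 _ o1) // !scale0r !addr0.
- rewrite -mulrA E rE.
  have -> : Z ^+ N = Z ^+ k * Z ^+ (N - k) by rewrite -exprD subnKC.
  by ring.
Qed.


Lemma local_parameter_coeffs (P : point K) t : point_vspace P = <[v]>%VS ->
  (1 < N)%N -> local_parameter H P t ->
  exists d, [/\ t.1 \is d.-homog, t.2 \is d.-homog, t.2.@[v ord0] != 0,
    (ev g t.1)`_0 = 0 & (ev g t.1)`_1 != 0].
Proof.
move=> Pv N1 [[d [t1 t2 Pt2]] t_in t_out]; exists d; split=> //.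
- by apply/eqP => /(vanishes_on_vline v t2); rewrite -Pv.
- have z0 : map_mx (horner^~ 0) g = 1 *: v by rewrite scale1r germ0.
  have := ev_in_max_ideal_exp z0 (oner_neq0 _) gN Pv (ltnW N1) t_in.
  by move/dvdp_XnP; apply.
- apply/eqP => a1; apply: t_out; apply: (in_max_ideal_exp_germ Pv N1 t1).
  have z0 : map_mx (horner^~ 0) g = 1 *: v by rewrite scale1r germ0.
  have := ev_in_max_ideal_exp z0 (oner_neq0 _) gN Pv (ltnW N1) t_in.
  by move/dvdp_XnP => a0; apply/dvdp_XnP => [[|[|//]]] _ //; apply: a0.
Qed.

Lemma local_parameter_coord (P : point K) : point_vspace P = <[v]>%VS ->
  (1 < N)%N -> local_parameter H P (Z, X0).
Proof.
move=> Pv N1; have gE : g = 1 *: lift v + 'X *: lift u + y *: lift w by rewrite scale1r.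
have vE : v = 1 *: v + 0 *: u + 0 *: w by rewrite scale1r !scale0r !addr0.
split.
- exists 1; split; rewrite ?coord_homog // Pv => /(vanishes_on_vline v (coord_homog o0)).
  by rewrite (meval_coord o0 vE) => /eqP; rewrite oner_eq0.
- apply: (@in_max_ideal_exp_germ _ 1 1 (Z, X0) Pv (ltnW N1) (coord_homog o1)).
  by rewrite (mmap_coord_frame o1 gE).
- have z0 : map_mx (horner^~ 0) g = 1 *: v by rewrite scale1r germ0.
  move/(ev_in_max_ideal_exp z0 (oner_neq0 _) gN Pv N1).
  by rewrite (mmap_coord_frame o1 gE) /= => /dvdp_XnP/(_ 1%N isT)/eqP; rewrite coefX oner_eq0.
Qed.

(* A collineation fixing [v] moves the germ to [z], with homogeneous coordinates
   [c0, c1, c2]; it sends the parameter [s] to [c1 / c0]. *)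
Variables (z : 'rV[{poly K}]_3) (c0 c1 c2 : {poly K}) (c : K).
Hypotheses (zE : z = c0 *: lift v + c1 *: lift u + c2 *: lift w).
Hypotheses (zN : 'X^N %| hermp z z) (z0 : map_mx (horner^~ 0) z = c *: v) (c_neq0 : c != 0).

Let c00 : c0.[0] = c.
Proof.
have zE0 : c *: v + 0 *: u + 0 *: w = c0.[0] *: v + c1.[0] *: u + c2.[0] *: w.
  rewrite !scale0r !addr0 -z0 zE; apply/rowP => i; rewrite !mxE !hornerE.
  by rewrite [v _ _]lock [u _ _]lock [w _ _]lock.
by case: (frame_free frameP zE0).
Qed.

Let Xc1 : 'X %| c1.
Proof.
have zE0 : c *: v + 0 *: u + 0 *: w = c0.[0] *: v + c1.[0] *: u + c2.[0] *: w.
  rewrite !scale0r !addr0 -z0 zE; apply/rowP => i; rewrite !mxE !hornerE.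
  by rewrite [v _ _]lock [u _ _]lock [w _ _]lock.
by rewrite dvdp_Xhorner; case: (frame_free frameP zE0) => _ <- _.
Qed.

(** Modulo ['X^N] and up to powers of [c0], the values of [f] and [h] at [z] are their values along
    the germ taken at the parameter [c1 / c0]. By [homogenise_taylor] the zeroth-order terms cancel
    in [num], which leaves [c1 - 'X * c0] times a unit at 0. *)
Lemma valuation_displacement d k f h : (k < N)%N ->
  f \is d.-homog -> h \is d.-homog ->
  (ev g f)`_0 = 0 -> (ev g f)`_1 != 0 -> h.@[v ord0] != 0 ->
  'X^k %| c1 - 'X * c0 -> ~~ ('X^(k.+1) %| c1 - 'X * c0) ->
  let num := ev z f * ev g h - ev g f * ev z h in
  'X^k %| num /\ ~~ ('X^(k.+1) %| num).
Proof.
move=> kN fd hd a0 a1 hv pk pk1 num.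
have [D [l [Dl Dv DE]]] := local_equation.
set a := ev g f in a0 a1 *; set b := ev g h in num *.
set pi := c1 - 'X * c0 in pk pk1 *.
have evX0 : ev z X0 = c0 by rewrite (mmap_coord_frame o0 zE).
have evZ : ev z Z = c1 by rewrite (mmap_coord_frame o1 zE).
have evzD : (ev z D).[0] != 0.
  rewrite horner_ev z0 (@meval_eq _ _ _ (fun i => c * v ord0 i)) => [|i].
    by rewrite (meval_homogZ _ _ Dl) mulf_neq0 ?expf_neq0.
  by rewrite mxE.
have c1N : 'X^N %| c1 ^+ N by rewrite dvdp_exp2r.
have ev_eq f' : f' \is d.-homog -> 'X^N %|
    c0 ^+ (size y * d) * ev z f' - homogenise (@polyC K) c0 c1 (e * d) (ev g f').
  move=> /DE [A [G /(congr1 (ev z))]].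
  rewrite !(rmorphM, rmorphD, rmorphXn) /= mmap_hermitian_poly evX0 evZ.
  rewrite (@rmorph_homogenise _ _ _ _ (@polyC K) (mmap (@polyC K) (z ord0))) => [|r]; last exact: mmapC.
  rewrite /= evX0 evZ => E; rewrite -(@Gauss_dvdp_Xnr _ _ _ _ evzD) mulrBr E.
  by rewrite addrC -!addrA addKr; apply: dvdp_add; [apply: dvdp_mull | apply: dvdp_mulr].
have [c1' c1E] : exists c1', c1 = 'X * c1'.
  by case/dvdpP: Xc1 => r ->; exists r; rewrite mulrC.
have size_ev f' : f' \is d.-homog -> (size (ev g f') <= (e * d).+1)%N.
  by move=> fd'; exact: (size_mmap_homog size_germ fd').
have [ra raE] := homogenise_taylor c0 c1E (size_ev _ fd).
have [rb rbE] := homogenise_taylor c0 c1E (size_ev _ hd).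
rewrite -/pi -/a -/b in raE rbE.
pose S := c0 ^+ (e * d).-1 * (a`_1 *: b - b`_1 *: a) + 'X * (ra * b - a * rb).
have S0 : S.[0] != 0.
  rewrite /S hornerD !hornerM hornerX mul0r addr0 horner_exp c00 hornerD hornerN !hornerZ.
  rewrite [a.[0]]horner_coef0 a0 mulr0 subr0 !mulf_neq0 ?expf_neq0 // horner_ev.
  by rewrite germ0.
have /dvdpP [rf rfE] := ev_eq f fd; have /dvdpP [rh rhE] := ev_eq h hd.
have numE : c0 ^+ (size y * d) * num = S * pi + 'X^N * (rf * b - a * rh).
  have -> : c0 ^+ (size y * d) * num
    = (c0 ^+ (size y * d) * ev z f) * b - a * (c0 ^+ (size y * d) * ev z h) by rewrite /num; ring.
  rewrite -/a in rfE; rewrite -/b in rhE.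
  move/eqP: rfE; rewrite subr_eq => /eqP ->; move/eqP: rhE; rewrite subr_eq => /eqP ->.
  by rewrite raE rbE /S -!mul_polyC; ring.
have c0s : (c0 ^+ (size y * d)).[0] != 0 by rewrite horner_exp c00 expf_neq0.
have num_pi j : (j <= N)%N -> ('X^j %| num) = ('X^j %| pi).
  move=> jN; rewrite -(Gauss_dvdp_Xnr _ _ c0s) numE.
  rewrite dvdp_addl; first exact: Gauss_dvdp_Xnr.
  by apply: dvdp_mulr; rewrite dvdp_exp2l.
by rewrite !num_pi // ltnW.
Qed.

End LocalRing.

(** * Local contributions *)

Section LocalContribution.

Variables (F : finFieldType) (K : fieldType) (iota : {rmorphism F -> K}) (q : nat).
Variable sigma : PGL3 F.
Hypotheses (q_pchar : [pchar K].-nat q) (q_gt1 : (1 < q)%N).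
Notation M := (mx_of iota sigma).
Notation lift := (map_mx (@polyC K)).

Lemma mmap_pullback (S : comNzRingType) (h : {rmorphism K -> S}) (z : 'rV[S]_3) f :
  mmap h (z ord0) (pullback iota sigma f) = mmap h ((z *m map_mx h M) ord0) f.
Proof.
rewrite mmap_comp_mpoly; apply: eq_mmap => j; rewrite tnth_mktuple mxE rmorph_sum.
by apply: eq_bigr => i _ /=; rewrite mmapZ mmapX mmap1U [map_mx h _ _ _]mxE mulrC.
Qed.

Lemma pullback_homog d f : f \is d.-homog -> pullback iota sigma f \is d.-homog.
Proof.
move=> fd; rewrite -[d]mul1n; apply: dhomog_mmap => // j; rewrite tnth_mktuple.
by apply: rpred_sum => i _; rewrite dhomogZ // varX_homog.
Qed.

Variable c : K.
Hypothesis (herm_mx : forall z : 'rV[{poly K}]_3,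
  herm q (z *m lift M) (z *m lift M) = c%:P * herm q z z).

Variables (v u w : 'rV[K]_3) (l m r n k1 k0 : K).
Hypotheses (frameP : frame v u w \in unitmx).
Hypotheses (vv : herm q v v = 0) (vu : herm q v u = 0) (vw : herm q v w != 0).
Hypotheses (vM : v *m M = l *: v) (uM : u *m M = m *: u + r *: v).
Hypotheses (wM : w *m M = n *: w + k1 *: u + k0 *: v) (l_neq0 : l != 0).

(** The image of the germ has coordinates [c0 = l + 'X r + y k0] and [c1 = 'X m + y k1] along [v]
    and [u]; [pi] is [c1 - 'X * c0]. What remains for each kind of fixed point is to find the
    dominant term of [pi]. *)
Lemma local_contribution_germ (P : point K) y N k : point_vspace P = <[v]>%VS ->
  'X %| y -> 'X^N %| herm q (germ v u w y) (germ v u w y) -> (0 < k < N)%N ->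
  let pi := 'X * (m - l)%:P - 'X^2 * r%:P + y * (k1%:P - 'X * k0%:P) in
  'X^k %| pi -> ~~ ('X^(k.+1) %| pi) -> local_contribution iota q sigma P k.
Proof.
move=> Pv Xy yN /andP [k0' kN] pi pk pk1; have N1 : (1 < N)%N by apply: leq_trans kN.
pose z := germ v u w y *m lift M.
have zE : z = (l%:P + 'X * r%:P + y * k0%:P) *: lift v
    + ('X * m%:P + y * k1%:P) *: lift u + (y * n%:P) *: lift w.
  rewrite /z /germ !mulmxDl -!scalemxAl -!map_mxM vM uM wM.
  by apply/rowP => i; rewrite !mxE !(rmorphD, rmorphM) /=; ring.
have zN : 'X^N %| herm q z z by rewrite herm_mx dvdp_mull.
have z0 : map_mx (horner^~ 0) z = l *: v.
  rewrite -vM -[in RHS](germ0 v u w Xy); apply/rowP => i.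
  rewrite mxE /z mxE horner_sum [RHS]mxE; apply: eq_bigr => j _.
  by rewrite hornerM [lift M _ _]mxE hornerC [in RHS]mxE.
have piE : ('X * m%:P + y * k1%:P) - 'X * (l%:P + 'X * r%:P + y * k0%:P) = pi.
  by rewrite /pi polyCB; ring.
split.
  by exists (coord_form v u w o1, coord_form v u w o0); apply: (local_parameter_coord q_pchar q_gt1 frameP vw Xy yN Pv N1).
move=> t tP; have [d [t1 t2 t2v a0 a1]] := local_parameter_coeffs q_pchar q_gt1 frameP vw Xy yN Pv N1 tP.
have num_homog : (displacement iota sigma t).1 \is (d + d).-homog.
  apply: rpredB; first exact: dhomogM (pullback_homog t1) t2.
  exact: dhomogM t1 (pullback_homog t2).
have den_homog : (displacement iota sigma t).2 \is (d + d).-homog.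
  exact: dhomogM (pullback_homog t2) t2.
have evE : mmap (@polyC K) (germ v u w y ord0) (displacement iota sigma t).1
  = mmap (@polyC K) (z ord0) t.1 * mmap (@polyC K) (germ v u w y ord0) t.2
    - mmap (@polyC K) (germ v u w y ord0) t.1 * mmap (@polyC K) (z ord0) t.2.
  by rewrite rmorphB !rmorphM /= !mmap_pullback.
have := @valuation_displacement _ _ q_pchar q_gt1 _ _ _ _ _ frameP vw Xy yN
  _ _ _ _ _ zE zN z0 l_neq0 d k _ _ kN t1 t2 a0 a1 t2v.
rewrite piE => /(_ pk pk1); rewrite -evE => -[numk numk1].
split.
- exists (d + d)%N; split => //; rewrite Pv => /(vanishes_on_vline v den_homog)/eqP.
  rewrite mevalM mulf_eq0 (negbTE t2v) orbF.
  have -> : (pullback iota sigma t.2).@[v ord0] = l ^+ d * t.2.@[v ord0].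
    rewrite -(meval_homogZ _ _ t2) [LHS](@mmap_pullback _ idfun).
    by apply: eq_mmap => i; rewrite map_mx_id // vM mxE.
  by rewrite mulf_eq0 expf_eq0 (negbTE l_neq0) (negbTE t2v) andbF.
- exact: (in_max_ideal_exp_germ q_pchar q_gt1 frameP vw Xy yN Pv (ltnW kN) num_homog).
- have g0 : map_mx (horner^~ 0) (germ v u w y) = 1 *: v by rewrite scale1r germ0.
  move/(ev_in_max_ideal_exp g0 (oner_neq0 _) yN Pv kN); exact/negP.
Qed.

(** The term ['X * (m - l)] dominates, as [y] has order at least 2. *)
Lemma local_contribution_tame (P : point K) : point_vspace P = <[v]>%VS ->
  m != l -> local_contribution iota q sigma P 1.
Proof.
move=> Pv ml; have [y Xy yN] := germ_on_curve q_pchar q_gt1 vv vu vw 2.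
have X2y := germ_order q_pchar q_gt1 vv vu vw (ltnSn 1) Xy yN.
apply: (local_contribution_germ Pv Xy yN) => //.
  by rewrite expr1 dvdp_add ?(dvdp_mulr _ Xy) // dvdp_sub ?dvdp_mulr // dvdp_exp.
rewrite dvdp_addl ?(dvdp_mulr _ X2y) // dvdp_addl ?dvdpNr ?(dvdp_mulr _ (dvdpp _)) //.
rewrite mulrC Gauss_dvdp_Xnr ?hornerC ?subr_eq0 //.
by apply/dvdp_XnP => /(_ 1%N isT)/eqP; rewrite coefX oner_eq0.
Qed.

(** The linear term vanishes and ['X^2 * r] dominates, because [y] has order at least q+1, hence at
    least 3. *)
Lemma local_contribution_regular_unipotent (P : point K) : point_vspace P = <[v]>%VS ->
  herm q u v = 0 -> m = l -> r != 0 -> local_contribution iota q sigma P 2.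
Proof.
move=> Pv uv ml r0; have [y Xy yN] := germ_on_curve q_pchar q_gt1 vv vu vw (q + 2).
have [Xqy _] := germ_order_rational q_pchar q_gt1 vv vu vw (leqnn _) uv Xy yN.
have X3y : 'X^3 %| y by apply: dvdp_Xn_trans Xqy; lia.
apply: (local_contribution_germ Pv Xy yN); first by lia.
  rewrite ml subrr mulr0 sub0r dvdp_add // ?dvdpNr ?(dvdp_mulr _ (dvdpp _)) //.
  by apply: dvdp_mulr; apply: dvdp_Xn_trans X3y.
rewrite ml subrr mulr0 sub0r dvdp_addl ?(dvdp_mulr _ X3y) // dvdpNr.
rewrite mulrC Gauss_dvdp_Xnr ?hornerC //.
by apply/dvdp_XnP => /(_ 2 isT)/eqP; rewrite coefXn oner_eq0.
Qed.

(** Only [- y * 'X * k0] survives in [pi], and [y] has order exactly q+1. *)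
Lemma local_contribution_elation (P : point K) : point_vspace P = <[v]>%VS ->
  herm q u v = 0 -> herm q u u != 0 -> m = l -> r = 0 -> k1 = 0 -> k0 != 0 ->
  local_contribution iota q sigma P (q + 2).
Proof.
move=> Pv uv uu ml r0 k10 k00.
have [y Xy yN] := germ_on_curve q_pchar q_gt1 vv vu vw (q + 3).
have N3 : (q + 2 <= q + 3)%N by lia.
have [Xqy /(_ uu) yq] := germ_order_rational q_pchar q_gt1 vv vu vw N3 uv Xy yN.
apply: (local_contribution_germ Pv Xy yN); first by lia.
  rewrite ml r0 k10 subrr !mulr0 subrr add0r sub0r mulrN dvdpNr mulrCA mulrA.
  by apply: dvdp_mulr; rewrite addnS exprS addn1 -addn1 dvdp_mul.
rewrite ml r0 k10 subrr !mulr0 subrr add0r sub0r mulrN dvdpNr mulrCA.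
rewrite exprS dvdp_mul2l ?polyX_eq0 // mulrC Gauss_dvdp_Xnr ?hornerC //.
Qed.

End LocalContribution.

(** * Matrices preserving the curve *)

Lemma simple_roots (K : closedFieldType) (p : {poly K}) : p != 0 ->
  (forall x, root p x -> p^`().[x] != 0) ->
  exists s, [/\ uniq s, size s = (size p).-1 & forall x, (x \in s) = root p x].
Proof.
move=> p0 pP; have [s pE] := closed_field_poly_normal p; exists s.
have lp : lead_coef p != 0 by rewrite lead_coef_eq0.
split; last by move=> x; rewrite pE rootZ // root_prod_XsubC.
  rewrite -separable_prod_XsubC -(eqp_separable (eqp_scale _ lp)) -pE unlock.
  exact/Pdiv.ClosedField.coprimepP.
by rewrite pE size_scale // size_prod_XsubC.
Qed.

Section Unitary.

Variables (K : closedFieldType) (q : nat).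
Hypotheses (q_pchar : [pchar K].-nat q) (q_gt1 : (1 < q)%N).

Let q_gt0 : (0 < q)%N. Proof. exact: ltnW. Qed.

Lemma pchar_natr0 : q%:R = 0 :> K.
Proof.
have : q != 1 by lia.
move: q_pchar; rewrite /pnat => /andP [_ /allP all_p] q1.
have pd := pdiv_prime q_gt1; have := all_p (pdiv q).
rewrite mem_primes pd q_gt0 pdiv_dvd => /(_ isT) /andP [_ /eqP p0].
by rewrite -(divnK (pdiv_dvd q)) natrM p0 mulr0.
Qed.

(** In characteristic dividing q the derivative of ['X^(q+1) - b] is ['X^q], which is nonzero at
    every root. *)
Lemma roots_norm (b : K) : b != 0 ->
  exists s, [/\ uniq s, size s = q.+1 & forall t, (t \in s) = (t ^+ q.+1 == b)].
Proof.
move=> b0; have sp : size ('X^(q.+1) - b%:P) = q.+2 by rewrite size_XnsubC.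
have [||s [us ss sE]] := @simple_roots K ('X^(q.+1) - b%:P).
- by rewrite -size_poly_gt0 sp.
- move=> t; rewrite /root !hornerE subr_eq0 => tE.
  rewrite derivB derivXn derivC subr0 /= hornerMn hornerXn mulrS -mulr_natr pchar_natr0.
  by rewrite mulr0 addr0 expf_neq0 //; apply: contraNneq b0 => t0; rewrite -(eqP tE) t0 expr0n.
exists s; split; rewrite ?ss ?sp // => t.
by rewrite sE /root !hornerE subr_eq0.
Qed.

Variable M : 'M[K]_3.
Notation gram i j := (herm q (row i M) (row j M)).

Lemma herm_mulmx (S : comNzRingType) (h : {rmorphism K -> S}) c (x y : 'rV[S]_3) :
  (forall i j, gram i j = c *+ (i == j)) ->
  herm q (x *m map_mx h M) (y *m map_mx h M) = h c * herm q x y.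
Proof.
move=> gE; have qS := pchar_nat_map h q_pchar.
have E (z : 'rV[S]_3) : z *m map_mx h M = z ord0 o0 *: map_mx h (row o0 M)
    + z ord0 o1 *: map_mx h (row o1 M) + z ord0 o2 *: map_mx h (row o2 M).
  by apply/rowP => i; rewrite !mxE sum3 !mxE.
rewrite !E !(hermDl qS) !hermZl !hermDr !hermZr !herm_map !gE /= !mulr1n !mulr0n.
by rewrite rmorph0 /herm sum3; ring.
Qed.

(** For [t ^+ q.+1 = -1] the vector e_i + t e_k is isotropic, hence so is its image. Replacing
    t^(q+1) by -1, this says that a polynomial of degree at most q vanishes at all q+1 such [t]; its
    coefficients, the differences of diagonal Gram entries and the off-diagonal ones, are therefore
    0. *)
Lemma gram_scalar : M \in unitmx ->
  (forall x, x != 0 -> herm q x x = 0 -> herm q (x *m M) (x *m M) = 0) ->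
  exists2 c, c != 0 & forall i j, gram i j = c *+ (i == j).
Proof.
move=> Mu MP.
have key (i k : 'I_3) : i != k -> gram i i = gram k k /\ gram i k = 0.
  move=> ik; have m1 : -1 != 0 :> K by rewrite oppr_eq0 oner_eq0.
  have [s [us ss sE]] := roots_norm m1.
  pose p := (gram i i - gram k k)%:P + gram i k *: 'X + gram k i *: 'X^q.
  have p0 : p = 0.
    apply: (@roots_geq_poly_eq0 _ _ s) => //; last first.
      rewrite ss; apply/leq_sizeP => j qj; rewrite /p !coefD !coefZ coefX coefXn coefC.
      have [-> -> ->] : [/\ (j == 0) = false, (j == 1) = false & (j == q) = false]%N by split; lia.
      by rewrite !mulr0 !addr0.
    apply/allP => t; rewrite sE => /eqP tE.
    pose x : 'rV[K]_3 := delta_mx 0 i + t *: delta_mx 0 k.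
    have hd (a b : 'I_3) : herm q (delta_mx 0 a) (delta_mx 0 b) = (a == b)%:R :> K.
      rewrite /herm (bigD1 a) //= big1 ?addr0 => [|j ja].
        by rewrite !mxE !eqxx expr1n mul1r.
      by rewrite !mxE (negbTE ja) andbF expr0n eqn0Ngt q_gt0 mul0r.
    have xx : herm q x x = 0.
      rewrite /x !hermDr !hermZr !(hermDl q_pchar) !hermZl !hd !eqxx (negbTE ik).
      by rewrite eq_sym (negbTE ik) !mulr0 addr0 add0r !mulr1 -exprS tE addrN.
    have x0 : x != 0.
      apply/eqP => /rowP/(_ i); rewrite !mxE !eqxx (negbTE ik) andbF mulr0 addr0.
      by move/eqP; rewrite oner_eq0.
    have := MP _ x0 xx; rewrite /x !mulmxDl -!scalemxAl -!rowE.
    rewrite !hermDr !hermZr !(hermDl q_pchar) !hermZl => E.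
    rewrite /root /p !hornerE -E; apply/eqP.
    have -> : - gram k k = t ^+ q.+1 * gram k k by rewrite tE mulN1r.
    by rewrite exprS; ring.
  have /polyP pE := p0; split.
    have := pE 0; rewrite /p !coefD !coefZ coefX coefXn coefC coef0 /=.
    have -> : (0 == q)%N = false by lia.
    by rewrite !mulr0 !addr0 => /eqP; rewrite subr_eq0 => /eqP.
  have := pE 1; rewrite /p !coefD !coefZ coefX coefXn coefC coef0 /=.
  have -> : (1 == q)%N = false by lia.
  by rewrite mulr0 addr0 add0r mulr1.
have gE i j : gram i j = gram o0 o0 *+ (i == j).
  have [<-|/key[]//] := eqVneq i j; rewrite mulr1n.
  by have [->//|/key[]] := eqVneq i o0.
(* If the scalar were 0, the preimage of the first basis vector under [M] would give [herm] of that
   basis vector with itself equal to 0 instead of 1. *)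
exists (gram o0 o0) => //; apply/eqP => c0.
have := @herm_mulmx _ idfun _ (row 0 1%:M *m invmx M) (row 0 1%:M *m invmx M) gE.
rewrite map_mx_id // mulmxKV // c0 mul0r => /eqP.
have -> : herm q (row 0 1%:M) (row 0 1%:M) = 1 :> K.
  rewrite /herm (bigD1 0) //= big1 ?addr0 => [|j ja]; rewrite !mxE ?eqxx ?expr1n ?mul1r //.
  by rewrite eq_sym (negbTE ja) mulr0.
by rewrite oner_eq0.
Qed.

End Unitary.

(** * Unitary lifts and orders *)

Section Points.

Variable K : fieldType.

Fact vline_dim1 (v : 'rV[K]_3) : v != 0 -> (\dim <[v]>%VS == 1)%N.
Proof. by move=> v0; rewrite dim_vline v0. Qed.

Definition point_of (v : 'rV[K]_3) (v0 : v != 0) : point K := exist _ <[v]>%VS (vline_dim1 v0).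

Lemma pointP (P : point K) : exists2 v : 'rV[K]_3, v != 0 & point_vspace P = <[v]>%VS.
Proof.
case: P => V /= dV; exists (vpick V).
  by rewrite vpick0 -dimv_eq0 (eqP dV).
apply/esym/eqP; rewrite eqEdim -memvE memv_pick (eqP dV) dim_vline vpick0 -dimv_eq0.
by rewrite (eqP dV).
Qed.

Lemma vline_eq (v w : 'rV[K]_3) (c : K) : c != 0 -> w = c *: v -> <[w]>%VS = <[v]>%VS.
Proof.
move=> c0 ->; apply/eqP; rewrite eqEsubv -!memvE memvZ ?memv_line //=.
by apply/vlineP; exists c^-1; rewrite scalerA mulVf // scale1r.
Qed.

End Points.

Section OrderInPGL.

Variables (F : finFieldType) (K : fieldType) (iota : {rmorphism F -> K}).
Variable sigma : PGL3 F.

(** Commuting with the transvection 1 + e_ij amounts to commuting with the matrix unit e_ij, and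
    comparison of entries then makes [A] scalar. *)
Lemma center_GL3 (A : {'GL_3[F]}) :
  reflect (exists a, GLval A = a%:M) (A \in 'Z('GL_3[F])%g).
Proof.
apply: (iffP (centerP _ _)) => [[_ AC]|[a Aa]]; last first.
  split; first by rewrite inE.
  move=> B _; apply: val_inj; change (GLval A *m GLval B = GLval B *m GLval A).
  by rewrite Aa scalar_mxC.
have AE (i j : 'I_3) : i != j -> GLval A *m delta_mx i j = delta_mx i j *m GLval A.
  move=> ij; have Tu : 1%:M + delta_mx i j \in @unitmx F 3.
    have D2 : delta_mx i j *m delta_mx i j = 0 :> 'M[F]_3.
      by rewrite mul_delta_mx_0 // eq_sym.
    have : (1%:M + delta_mx i j) *m (1%:M - delta_mx i j) = 1%:M :> 'M[F]_3.
      by rewrite mulmxDl !mulmxBr !mul1mx mulmx1 D2 subr0 addrNK.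
    by case/mulmx1_unit.
  pose T : {'GL_3[F]} := Sub (1%:M + delta_mx i j : 'M[F]_3) Tu.
  have : commute A T by apply: AC; rewrite inE.
  move/(congr1 val); change (GLval A *m (1%:M + delta_mx i j) = (1%:M + delta_mx i j) *m GLval A -> GLval A *m delta_mx i j = delta_mx i j *m GLval A).
  by rewrite mulmxDr mulmxDl mulmx1 mul1mx => /addrI.
exists (GLval A 0 0); apply/matrixP => i j; rewrite [RHS]mxE.
have delta (k l m r : 'I_3) : k != l -> GLval A m k *+ (r == l) = GLval A l r *+ (m == k).
  move=> kl; have /matrixP/(_ m r) := AE _ _ kl.
  rewrite !mxE (bigD1 k) //= big1 ?addr0 => [|i' ik]; last by rewrite mxE (negbTE ik) mulr0.
  rewrite (bigD1 l) //= big1 ?addr0 => [|i' il]; last by rewrite mxE (negbTE il) andbF mul0r.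
  by rewrite !mxE !eqxx andbT /= mulr_natr mulr_natl.
have [<-|ij] := eqVneq i j; rewrite ?mulr1n ?mulr0n.
  have [->//|i0] := eqVneq i 0.
  by have := delta 0 i 0 i; rewrite !eqxx !mulr1n eq_sym => /(_ i0).
by have := delta j i i i; rewrite eqxx mulr1n (negbTE ij) mulr0n eq_sym => /(_ ij).
Qed.

Lemma order_dvdP n : reflect (exists a, mx_of iota sigma ^+ n = a%:M) (#[sigma]%g %| n)%N.
Proof.
have nZ (x : {'GL_3[F]}) : x \in 'N('Z('GL_3[F])%g)%g.
  by have /andP [_ /subsetP] := center_normal 'GL_3[F]%G; apply; rewrite inE.
have sigE : (sigma ^+ n = coset 'Z('GL_3[F]) (repr sigma ^+ n))%g.
  by rewrite (morphX (coset_morphism 'Z('GL_3[F])%G) n (nZ _)) /= coset_reprK.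
have powE (x : {'GL_3[F]}) m : GLval (x ^+ m)%g = GLval x ^+ m.
  by elim: m => [//|m IHm]; rewrite expgS exprS -IHm.
rewrite order_dvdn sigE /mx_of -rmorphXn -powE.
set A := (repr sigma ^+ n)%g.
apply: (iffP eqP) => [/(coset_idr (nZ A))/center_GL3 [a ->]|[a Aa]].
  by exists (iota a); apply: map_scalar_mx.
(* The scalar [a] of [K] comes from [F], being the image under [iota] of a diagonal entry. *)
apply: coset_id; apply/center_GL3; exists (GLval A 0 0); apply/matrixP => i j.
have E (k l : 'I_3) : iota (GLval A k l) = a *+ (k == l).
  by move/matrixP: Aa => /(_ k l); rewrite !mxE.
by apply: (fmorph_inj iota); rewrite E mxE rmorphMn /= E.
Qed.

Lemma mx_of_unit : mx_of iota sigma \in unitmx.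
Proof. by rewrite map_unitmx; apply: (valP (repr sigma)). Qed.

End OrderInPGL.

Section UnitaryLift.

Variables (p n : nat) (p_prime : prime p) (n_ge1 : (1 <= n)%N).
Variables (q : nat) (q_def : q = (p ^ n)%N).
Variables (F : finFieldType) (F_card : #|F| = (q ^ 2)%N).
Variables (K : closedFieldType) (iota : {rmorphism F -> K}).

Lemma prime_power_gt1 : (1 < q)%N.
Proof. by rewrite q_def (leq_trans (prime_gt1 p_prime)) // -{1}(expn1 p) leq_exp2l // prime_gt1. Qed.

Lemma p_in_pchar : p \in [pchar K].
Proof.
rewrite (fmorph_pchar iota) inE p_prime /=.
have : (1 *+ #|F| : F) = 0 by rewrite -FinRing.zmodXgE -cardsT expg_cardG ?inE.
by rewrite F_card q_def -expnM natrX => /eqP; rewrite expf_eq0 => /andP [].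
Qed.

Lemma pchar_prime_power : [pchar K].-nat q.
Proof.
rewrite q_def pnatX; apply/orP; left; rewrite (eq_pnat _ (pcharf_eq p_in_pchar)).
by rewrite pnat_id.
Qed.

Variable sigma : PGL3 F.
Notation M := (mx_of iota sigma).

Lemma img_vline (x : 'rV[K]_3) : img iota sigma <[x]>%VS = <[x *m M]>%VS.
Proof. by rewrite /img limg_line lfunE. Qed.

Lemma on_curve_vline (x : 'rV[K]_3) : on_curve q <[x]>%VS <-> herm q x x = 0.
Proof.
rewrite /on_curve (vanishes_on_vline x (hermitian_poly_homog K q)).
by rewrite /meval (mmap_hermitian_poly (@idfun K)).
Qed.

Hypothesis sigma_PGU : in_PGU iota q sigma.

Lemma PGU_gram : exists2 c, c != 0 &
  forall i j, herm q (row i M) (row j M) = c *+ (i == j).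
Proof.
apply: (gram_scalar pchar_prime_power prime_power_gt1 (mx_of_unit iota sigma)) => x x0 xx.
by have /= := sigma_PGU (point_of x0); rewrite img_vline !on_curve_vline => ->.
Qed.

Lemma iota_frobenius (x : F) : iota x ^+ (q ^ 2) = iota x.
Proof. by rewrite -rmorphXn -F_card expf_card. Qed.

(* [c ^+ q = c] because [c] is both a diagonal entry of the Hermitian matrix and of its
   conjugate, so [c] is a norm. *)
Lemma PGU_unitary : exists d U, [/\ d != 0, M = d *: U, U \in unitmx,
  forall x y, herm q (x *m U) (y *m U) = herm q x y
  & forall i j, U i j ^+ (q ^ 2) = U i j].
Proof.
have [c c0 cE] := PGU_gram; have q0 : (0 < q)%N by apply: ltnW prime_power_gt1.
have qq (x y : K) : (x + y) ^+ q = x ^+ q + y ^+ q by apply: exprDn_pchar pchar_prime_power.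
have cq : c ^+ q = c.
  have := cE 0 0; rewrite mulr1n => {1}<-; rewrite -[RHS]mulr1n -(cE 0 0).
  rewrite /herm !sum3 !qq !exprMn -!exprM mulnn.
  by rewrite ![row 0 M _ _]mxE ![map_mx _ _ _ _]mxE !iota_frobenius; ring.
have [s [_ ss sE]] := roots_norm pchar_prime_power prime_power_gt1 c0.
have sn : (0 < size s)%N by rewrite ss.
have := mem_nth 0 sn; rewrite sE; set d := nth _ _ _ => /eqP dE.
have d0 : d != 0 by apply: contraNneq c0 => d0; rewrite -dE d0 expr0n.
(* Both sides times [d ^+ q] equal [c], since d^(q(q+1)) = c^q = c = d^(q+1). Hence dividing [M] by
   [d] keeps the entries in F_(q^2). *)
have dq : d ^+ (q ^ 2) = d.
  have : d ^+ (q ^ 2) * d ^+ q = d * d ^+ q.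
    rewrite -exprS dE -exprD (_ : q ^ 2 + q = q.+1 * q)%N ?exprM ?dE //.
    by rewrite -mulnn; lia.
  by move/(mulIf (expf_neq0 q d0)).
exists d, (d^-1 *: M); split => //.
- by rewrite scalerA divff // scale1r.
- by rewrite unitmxZ ?mx_of_unit // unitfE invr_eq0.
- move=> x y; rewrite -!scalemxAr hermZr hermZl.
  have := herm_mulmx pchar_prime_power idfun x y cE; rewrite map_mx_id // => ->; rewrite -dE /= exprS.
  by rewrite !mulrA mulrC exprVn; field; rewrite d0 expf_neq0.
- by move=> i j; rewrite !mxE exprMn iota_frobenius exprVn dq.
Qed.

End UnitaryLift.

(** * Jordan forms *)

Section JordanForm.

Variable K : closedFieldType.
Implicit Types (v u w x : 'rV[K]_3) (a b c s t : K).

Lemma frame_unitI v u w : v != 0 -> (forall t, u <> t *: v) ->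
  (forall s t, w <> s *: v + t *: u) -> frame v u w \in unitmx.
Proof.
move=> v0 uv wvu; apply: frame_unit => a b c E.
have [c0|c0] := eqVneq c 0; last first.
  case: (wvu (- (c^-1 * a)) (- (c^-1 * b))).
  apply: (scalerI c0); rewrite scalerDr !scalerA !mulrN !mulrA divff // !mul1r.
  by apply/eqP; rewrite !scaleNr -subr_eq0 !opprD !opprK addrC E.
rewrite c0 scale0r addr0 in E.
have [b0|b0] := eqVneq b 0; last first.
  case: (uv (- (b^-1 * a))); apply: (scalerI b0).
  rewrite !scalerA mulrN mulrA divff // mul1r; apply/eqP.
  by rewrite scaleNr -subr_eq0 opprK addrC E.
rewrite b0 scale0r addr0 in E; split=> //.
by move/eqP: E; rewrite scaler_eq0 (negbTE v0) orbF => /eqP.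
Qed.

Lemma frame_indep v u w : frame v u w \in unitmx ->
  [/\ v != 0, u != 0, w != 0, forall t, u <> t *: v & forall s t, w <> s *: v + t *: u].
Proof.
move=> B; split.
- apply/eqP => E; have [] := @frame_free0 _ v u w 1 0 0 B; last by move/eqP; rewrite oner_eq0.
  by rewrite E !scale0r scaler0 !addr0.
- apply/eqP => E; have [] := @frame_free0 _ v u w 0 1 0 B; last by move=> _ /eqP; rewrite oner_eq0.
  by rewrite E !scale0r scaler0 !addr0.
- apply/eqP => E; have [] := @frame_free0 _ v u w 0 0 1 B; last by move=> _ _ /eqP; rewrite oner_eq0.
  by rewrite E !scale0r scaler0 !addr0.
- move=> t E; have [] := @frame_free0 _ v u w (- t) 1 0 B; last by move=> _ /eqP; rewrite oner_eq0.
  by rewrite E scale1r scaleNr scale0r addr0 addNr.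
- move=> s t E; have [] := @frame_free0 _ v u w (- s) (- t) 1 B; last by move=> _ _ /eqP; rewrite oner_eq0.
  by rewrite E scale1r !scaleNr -opprD addNr.
Qed.

Lemma exists_not_in_span v u : exists x, forall s t, x <> s *: v + t *: u.
Proof.
pose V := <<[:: v; u]>>%VS.
have : ~~ (fullv <= V)%VS.
  apply/negP => /dimvS; rewrite dimvf /dim /= => d3.
  by have := leq_trans d3 (dim_span _).
case/subvPn => x _ xV; exists x => s t xE; case/negP: xV.
by rewrite xE memvD // memvZ // memv_span // !inE eqxx ?orbT.
Qed.

Variable U : 'M[K]_3.

(** Vectors are rows, so Jordan chains run [u] to [v] (mixed), [w] to [v] (elation) and [w] to [u]
    to [v] (regular). In these three shapes [v] will be the only fixed point on the curve; in a
    homology [w] is the center. *)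
Definition shape_distinct v u w a b c :=
  [/\ v *m U = a *: v, u *m U = b *: u, w *m U = c *: w & [/\ a != b, a != c & b != c]].
Definition shape_homology v u w a b :=
  [/\ v *m U = a *: v, u *m U = a *: u, w *m U = b *: w & a != b].
Definition shape_mixed v u w a b :=
  [/\ v *m U = a *: v, u *m U = a *: u + v, w *m U = b *: w & a != b].
Definition shape_elation v u w a :=
  [/\ v *m U = a *: v, u *m U = a *: u & w *m U = a *: w + v].
Definition shape_regular v u w a :=
  [/\ v *m U = a *: v, u *m U = a *: u + v & w *m U = a *: w + u].

Lemma eigen_sub a x : x *m U = a *: x <-> x *m (U - a%:M) = 0.
Proof.
rewrite mulmxBr mul_mx_scalar; split => [->|/eqP]; first exact: subrr.
by rewrite subr_eq0 => /eqP.
Qed.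

Lemma neq0_mulmx (A : 'M[K]_3) : A != 0 -> exists x, x *m A != 0.
Proof.
move=> A0; have [i Ai] : exists i, row i A != 0.
  apply/existsP; rewrite -negb_forall; apply: contraNN A0 => /forallP A0.
  by apply/eqP/row_matrixP => i; rewrite row0; apply/eqP.
by exists (delta_mx 0 i); rewrite -rowE.
Qed.

(** Put A = U - a and B = U - b. If AB = 0, any [x] satisfies (b - a) x = xA - xB, with xA an
    eigenvector for [b] and xB one for [a] (or 0); for [x] outside the span of [va] and [vb] one of
    them is a new direction, and a homology results. If xAB is nonzero, then xB and xBA form a
    Jordan chain for [a]. *)
Lemma jordan_two a b (va vb : 'rV[K]_3) : a != b -> va != 0 -> vb != 0 ->
  va *m U = a *: va -> vb *m U = b *: vb ->
  (U - a%:M) *m (U - a%:M) *m (U - b%:M) = 0 ->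
  exists v u w, frame v u w \in unitmx /\
    ((exists a b, shape_homology v u w a b) \/ (exists a b, shape_mixed v u w a b)).
Proof.
move=> ab va0 vb0 vaU vbU AAB.
set A := U - a%:M in AAB; set B := U - b%:M in AAB.
have comAB : A *m B = B *m A.
  rewrite /A /B !mulmxBl !mulmxBr !mul_mx_scalar !mul_scalar_mx.
  by move: (U *m U) => UU; apply/matrixP => i j; rewrite !mxE; ring.
have vaA : va *m A = 0 by apply/eigen_sub.
have vbB : vb *m B = 0 by apply/eigen_sub.
have vbA : vb *m A = (b - a) *: vb by rewrite mulmxBr vbU mul_mx_scalar scalerBl.
have ba : b - a != 0 by rewrite subr_eq0 eq_sym.
have [AB0|/neq0_mulmx [x xAB]] := eqVneq (A *m B) 0.
  have [x xP] := exists_not_in_span va vb.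
  have vab t : vb <> t *: va.
    move=> E; move: vbA; rewrite {1}E -scalemxAl vaA scaler0 => /esym/eqP.
    by rewrite scaler_eq0 (negbTE ba) (negbTE vb0).
  have xE : (b - a) *: x = x *m A - x *m B.
    have AB : A - B = (b - a)%:M by rewrite /A /B opprB addrC addrA subrK raddfB.
    by rewrite -mulmxBr AB mul_mx_scalar.
  have xAU : (x *m A) *m U = b *: (x *m A) by apply/eigen_sub; rewrite -mulmxA AB0 mulmx0.
  have xBU : (x *m B) *m U = a *: (x *m B) by apply/eigen_sub; rewrite -mulmxA -comAB AB0 mulmx0.
  have decomp s t : x *m A = s *: vb -> x *m B = t *: va -> False.
    move=> Es Et; apply: (xP (- ((b - a)^-1 * t)) ((b - a)^-1 * s)); apply: (scalerI ba).
    by rewrite xE Es Et scalerDr !scalerA mulrN !mulrA divff // !mul1r scaleNr addrC.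
  have indep a' b' v' w' y : a' != b' -> v' != 0 -> w' != 0 -> v' *m U = a' *: v' ->
      w' *m U = b' *: w' -> y *m U = a' *: y -> (forall t, y <> t *: v') ->
      frame v' y w' \in unitmx.
    move=> ab' v'0 w'0 v'U w'U yU yv'; apply: frame_unitI => // s t E.
    have : b' *: w' = a' *: w'.
      by rewrite -w'U {1}E mulmxDl -!scalemxAl v'U yU !scalerA ![_ * a']mulrC -!scalerA -scalerDr -E.
    move/eqP; rewrite -subr_eq0 -scalerBl scaler_eq0 (negbTE w'0) orbF subr_eq0 eq_sym.
    by rewrite (negbTE ab').
  have [/vlineP [s Es]|/vlineP xAb] := boolP (x *m A \in <[vb]>%VS).
    have [/vlineP [t Et]|/vlineP xBa] := boolP (x *m B \in <[va]>%VS).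
      by case: (decomp s t).
    exists va, (x *m B), vb; split; last by left; exists a, b.
    by apply: (indep a b) => // t E; apply: xBa; exists t.
  exists vb, (x *m A), va; split; last by left; exists b, a; split; rewrite // eq_sym.
  by apply: (indep b a) => // [|t E]; [rewrite eq_sym | apply: xAb; exists t].
rewrite comAB mulmxA in xAB; set u := x *m B in xAB.
have uAA : (u *m A) *m A = 0.
  rewrite /u -(mulmxA x) -comAB mulmxA -(mulmxA (x *m A)) -comAB.
  by rewrite -!mulmxA (mulmxA A) AAB mulmx0.
exists (u *m A), u, vb; split; last first.
  right; exists a, b; split=> //; first by apply/eigen_sub.
  by rewrite mulmxBr mul_mx_scalar addrC subrK.
apply: frame_unitI => // [t E|s t E].
  by move: xAB; rewrite E -scalemxAl uAA scaler0 eqxx.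
have E1 : (b - a) *: vb = t *: (u *m A).
  by rewrite -vbA {1}E mulmxDl -!scalemxAl uAA scaler0 add0r.
have : (b - a) *: ((b - a) *: vb) = 0 by rewrite -vbA scalemxAl E1 -scalemxAl uAA scaler0.
by move/eqP; rewrite !scaler_eq0 (negbTE ba) (negbTE vb0).
Qed.

(** With A = U - a, a vector not killed by A^2 generates a full chain. If A^2 = 0 and v = wA is
    nonzero, a second vector of the kernel is needed: for [x] outside the span of [v] and [w],
    either xA is not a multiple of [v] and serves, or a multiple of [w] corrects [x]. *)
Lemma jordan_three a : (U - a%:M) *m (U - a%:M) *m (U - a%:M) = 0 ->
  U = a%:M \/ exists v u w, frame v u w \in unitmx /\
    (shape_elation v u w a \/ shape_regular v u w a).
Proof.
move=> A3; set A := U - a%:M in A3.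
have UE x : x *m U = a *: x + x *m A by rewrite mulmxBr mul_mx_scalar addrC subrK.
have AU : A = 0 -> U = a%:M by move=> A0; apply/eqP; rewrite -subr_eq0 -/A A0.
clearbody A; have [A0|A0] := eqVneq A 0; first by left; exact: AU.
right; have [A2|/neq0_mulmx [x xA2]] := eqVneq (A *m A) 0; last first.
  have xA3 : x *m (A *m A) *m A = 0 by rewrite -mulmxA A3 mulmx0.
  exists (x *m (A *m A)), (x *m A), x; split; last first.
    right; split; rewrite UE ?xA3 ?addr0 //.
    by rewrite -(mulmxA x).
  apply: frame_unitI => // [t E|s t E].
    by move: xA2; rewrite mulmxA E -scalemxAl xA3 scaler0 eqxx.
  have /(congr1 (mulmxr (A *m A))) := E; rewrite /= mulmxDl -!scalemxAl.
  rewrite (mulmxA (x *m _)) xA3 mul0mx -(mulmxA x) (mulmxA A) A3 mulmx0 !scaler0 addr0.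
  by move/eqP; rewrite (negbTE xA2).
have [w wA] := neq0_mulmx A0; set v := w *m A in wA.
have vA : v *m A = 0 by rewrite /v -mulmxA A2 mulmx0.
have [x xP] := exists_not_in_span v w.
suff [u [uA uv]] : exists u, u *m A = 0 /\ forall t, u <> t *: v.
  exists v, u, w; split; last by left; split; rewrite UE ?vA ?uA ?addr0.
  apply: frame_unitI => // s t E.
  by move: wA; rewrite /v E mulmxDl -!scalemxAl vA uA !scaler0 addr0 eqxx.
have [/vlineP [t xA]|/vlineP xA] := boolP (x *m A \in <[v]>%VS); last first.
  by exists (x *m A); rewrite -mulmxA A2 mulmx0; split => // t E; apply: xA; exists t.
exists (x - t *: w); split.
  by rewrite mulmxBl xA -scalemxAl subrr.
by move=> s E; apply: (xP s t); rewrite -E subrK.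
Qed.

Lemma jordan_shape : (exists a, U = a%:M) \/ exists v u w, frame v u w \in unitmx /\
  [\/ exists a b c, shape_distinct v u w a b c, exists a b, shape_homology v u w a b,
      exists a b, shape_mixed v u w a b
    | exists a, shape_elation v u w a \/ shape_regular v u w a].
Proof.
have [r cE] := closed_field_poly_normal (char_poly U).
rewrite (monicP (char_poly_monic U)) scale1r in cE.
have : size r = 3 by have := size_char_poly U; rewrite cE size_prod_XsubC => -[].
case: r cE => [|a [|b [|c [|//]]]] // cE _.
rewrite !big_cons big_nil mulr1 in cE.
have eig z : root (char_poly U) z -> exists2 v : 'rV[K]_3, v != 0 & v *m U = z *: v.
  by rewrite -eigenvalue_root_char => /eigenvalueP [v vU v0]; exists v.
have CH : horner_mx U (char_poly U) = 0 by apply: Cayley_Hamilton.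
have CHE (x y z : K) : char_poly U = ('X - x%:P) * ('X - y%:P) * ('X - z%:P) ->
    (U - x%:M) *m (U - y%:M) *m (U - z%:M) = 0.
  by move=> E; move: CH; rewrite E !rmorphM !rmorphB /= !horner_mx_X !horner_mx_C.
have [va va0 vaU] : exists2 v : 'rV[K]_3, v != 0 & v *m U = a *: v.
  by apply: eig; rewrite cE !rootM !root_XsubC eqxx.
have [vb vb0 vbU] : exists2 v : 'rV[K]_3, v != 0 & v *m U = b *: v.
  by apply: eig; rewrite cE !rootM !root_XsubC eqxx ?orbT.
have [vc vc0 vcU] : exists2 v : 'rV[K]_3, v != 0 & v *m U = c *: v.
  by apply: eig; rewrite cE !rootM !root_XsubC eqxx ?orbT.
have two (x y : K) (vx vy : 'rV[K]_3) : x != y -> vx != 0 -> vy != 0 -> vx *m U = x *: vx -> vy *m U = y *: vy ->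
    char_poly U = ('X - x%:P) * ('X - x%:P) * ('X - y%:P) ->
    (exists a, U = a%:M) \/ exists v u w, frame v u w \in unitmx /\
  [\/ exists a b c, shape_distinct v u w a b c, exists a b, shape_homology v u w a b,
      exists a b, shape_mixed v u w a b
    | exists a, shape_elation v u w a \/ shape_regular v u w a].
  move=> xy vx0 vy0 vxU vyU /CHE /(jordan_two xy vx0 vy0 vxU vyU) [v [u [w [B S]]]].
  by right; exists v, u, w; split => //; case: S => S; [apply: Or42 | apply: Or43].
have [Eab|ab] := eqVneq a b.
  have [Eac|ac] := eqVneq a c; last first.
    by apply: (two a c va vc) => //; rewrite cE -Eab; ring.
  have /CHE/jordan_three : char_poly U = ('X - a%:P) * ('X - a%:P) * ('X - a%:P).
    by rewrite cE -Eab -Eac; ring.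
  case=> [UE|[v [u [w [B S]]]]]; first by left; exists a.
  by right; exists v, u, w; split => //; apply: Or44; exists a.
have [Eac|ac] := eqVneq a c.
  by apply: (two a b va vb) => //; rewrite cE -Eac; ring.
have [Ebc|bc] := eqVneq b c.
  by apply: (two b a vb va) => //; [rewrite eq_sym | rewrite cE -Ebc; ring].
right; exists va, vb, vc; split; last by apply: Or41; exists a, b, c.
apply: frame_unitI => // [t E|s t E].
  have : (b - a) *: vb = 0.
    by rewrite scalerBl -vbU {1}E -scalemxAl vaU scalerA mulrC -scalerA -E subrr.
  by move/eqP; rewrite scaler_eq0 (negbTE vb0) subr_eq0 eq_sym (negbTE ab).
have shift y z (v : 'rV[K]_3) : v *m U = y *: v -> v *m (U - z%:M) = (y - z) *: v.
  by move=> vU; rewrite mulmxBr vU mul_mx_scalar scalerBl.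
have : vc *m (U - a%:M) *m (U - b%:M) = 0.
  rewrite E mulmxDl -!scalemxAl (shift _ _ _ vaU) (shift _ _ _ vbU).
  by rewrite subrr scale0r scaler0 add0r -!scalemxAl (shift _ _ _ vbU) subrr scale0r !scaler0.
rewrite (shift _ _ _ vcU) -scalemxAl (shift _ _ _ vcU) scalerA => /eqP.
by rewrite scaler_eq0 (negbTE vc0) orbF mulf_eq0 !subr_eq0 !(eq_sym c) (negbTE ac) (negbTE bc).
Qed.

End JordanForm.

(** * Unitary Jordan forms *)

Section FramePermutations.

Variables (K : fieldType) (v u w : 'rV[K]_3).
Hypothesis frameP : frame v u w \in unitmx.

Lemma frame_swap : frame v w u \in unitmx.
Proof.
apply: frame_unit => a b c; rewrite addrAC => /(frame_free0 frameP).
by case=> -> -> ->.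
Qed.

Lemma frame_rot : frame u w v \in unitmx.
Proof.
apply: frame_unit => a b c; rewrite -addrA addrC addrAC => E.
have : c *: v + a *: u + b *: w = 0 by rewrite -E addrAC -addrA addrC addrAC [X in X + _]addrC.
by case/(frame_free0 frameP) => -> -> ->.
Qed.

End FramePermutations.

Section UnitaryShapes.

Variables (K : closedFieldType) (q : nat).
Hypotheses (q_pchar : [pchar K].-nat q) (q_gt1 : (1 < q)%N).
Variable U : 'M[K]_3.
Hypothesis Uherm : forall x y, herm q (x *m U) (y *m U) = herm q x y.
Implicit Types (v u w x y : 'rV[K]_3) (a b c : K).
Notation h := (herm q).

Let q_gt0 : (0 < q)%N. Proof. exact: ltnW. Qed.

Lemma expq_eq0 (a : K) : a ^+ q = 0 -> a = 0.
Proof. by move/eqP; rewrite expf_eq0 q_gt0 => /eqP. Qed.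

Lemma frob_inj : injective (fun a : K => a ^+ q).
Proof.
move=> a b /= ab; apply/eqP; rewrite -subr_eq0; apply/eqP/expq_eq0.
have := exprDn_pchar (a - b) b q_pchar; rewrite subrK ab => /eqP.
by rewrite -subr_eq0 opprD addrCA subrr addr0 oppr_eq0 => /eqP.
Qed.

Lemma herm_nondegl v u w x : frame v u w \in unitmx ->
  h x v = 0 -> h x u = 0 -> h x w = 0 -> x = 0.
Proof.
move=> B xv xu xw; apply/rowP => i; rewrite [RHS]mxE; apply: expq_eq0.
have [a [b [c E]]] := frame_coord (delta_mx 0 i) B.
have : h x (delta_mx 0 i) = 0 by rewrite E !hermDr !hermZr xv xu xw !mulr0 !addr0.
rewrite /herm (bigD1 i) //= big1 ?addr0 => [|j ji]; last by rewrite mxE (negbTE ji) andbF mulr0.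
by rewrite mxE !eqxx mulr1 => ->.
Qed.

Lemma herm_nondegr v u w x : frame v u w \in unitmx ->
  h v x = 0 -> h u x = 0 -> h w x = 0 -> x = 0.
Proof.
move=> B xv xu xw; apply/rowP => i; rewrite [RHS]mxE.
have [a [b [c E]]] := frame_coord (delta_mx 0 i) B.
have : h (delta_mx 0 i) x = 0.
  by rewrite E !(hermDl q_pchar) !hermZl xv xu xw !mulr0 !addr0.
rewrite /herm (bigD1 i) //= big1 ?addr0 => [|j ji].
  by rewrite mxE !eqxx expr1n mul1r.
by rewrite mxE (negbTE ji) andbF expr0n eqn0Ngt q_gt0 mul0r.
Qed.

(** The combination of [v] and [u] with coefficients [h w u] and [- h w v] is orthogonal to the
    whole frame, hence 0. So [h w v = 0], and then [v] itself is orthogonal to the frame. *)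
Lemma no_isotropic_plane v u w : frame v u w \in unitmx ->
  h v v = 0 -> h v u = 0 -> h u v = 0 -> h u u = 0 -> False.
Proof.
move=> B vv vu uv uu; have [v0 _ _ _ _] := frame_indep B.
have E : h w u *: v + (- h w v) *: u + 0 *: w = 0.
  by apply: (herm_nondegr B); rewrite !hermDr !hermZr ?vv ?vu ?uv ?uu; ring.
have [_ /eqP wv _] := frame_free0 B E; rewrite oppr_eq0 in wv.
by case/eqP: v0; apply: (herm_nondegr B) => //; apply/eqP.
Qed.

Lemma herm_eigen a b x y : x *m U = a *: x -> y *m U = b *: y ->
  a ^+ q * b != 1 -> h x y = 0.
Proof.
move=> xU yU ab; have := Uherm x y; rewrite xU yU hermZr hermZl mulrA (mulrC b) => /eqP.
by rewrite -subr_eq0 -[X in _ - X]mul1r -mulrBl mulf_eq0 subr_eq0 (negbTE ab) => /eqP.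
Qed.

Lemma norm1_neq a b : a ^+ q * a = 1 -> a != b -> a ^+ q * b != 1 /\ b ^+ q * a != 1.
Proof.
move=> aa ab; have a0 : a != 0 by apply: contra_eqN aa => /eqP ->; rewrite mulr0 eq_sym oner_eq0.
split; apply/eqP; rewrite -aa => E; case/eqP: ab.
  exact/esym/(mulfI (expf_neq0 q a0) E).
exact/esym/frob_inj/(mulIf a0 E).
Qed.

(** If a^(q+1) were not 1, the plane of [v] and [u] would be totally isotropic. Hence [w] is
    orthogonal to that plane, so it cannot be isotropic, and this forces b^(q+1) = 1. *)
Lemma homology_form v u w a b : frame v u w \in unitmx -> shape_homology U v u w a b ->
  [/\ a ^+ q * a = 1, b ^+ q * b = 1, h w v = 0 /\ h w u = 0, h v w = 0 /\ h u w = 0 & h w w != 0].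
Proof.
move=> B [vU uU wU ab]; have [_ _ w0 _ _] := frame_indep B.
have aa : a ^+ q * a = 1.
  apply/eqP/negPn/negP => aa.
  by apply: (no_isotropic_plane B); apply: (herm_eigen _ _ aa).
have [ab1 ba1] := norm1_neq aa ab.
have wv : h w v = 0 by apply: herm_eigen ba1.
have wu : h w u = 0 by apply: herm_eigen ba1.
have ww : h w w != 0.
  by apply: contraNneq w0 => ww; apply/eqP; apply: (herm_nondegl B).
split => //; last by split; apply: herm_eigen ab1.
apply/eqP; apply: contraNT ww => bb; apply/eqP; exact: herm_eigen bb.
Qed.


(** Counterpart of [herm_eigen] along Jordan chains. When c^q d is not 1 it determines [h x y]; when
    it is 1 the left side drops out and a relation between the products with [s] and [t] is left. *)
Lemma herm_shift x y c d s t : x *m U = c *: x + s -> y *m U = d *: y + t ->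
  (1 - c ^+ q * d) * h x y = c ^+ q * h x t + d * h s y + h s t.
Proof.
move=> xU yU; rewrite mulrBl mul1r -{1}Uherm xU yU.
by rewrite !hermDr !hermZr !(hermDl q_pchar) !hermZl; ring.
Qed.

Lemma mixed_form v u w a b : frame v u w \in unitmx -> shape_mixed U v u w a b ->
  [/\ a ^+ q * a = 1, b ^+ q * b = 1, h v v = 0 /\ h v u != 0,
    h v w = 0 /\ h w v = 0 & h w w != 0].
Proof.
move=> B [vU uU wU ab]; have [v0 _ w0 _ _] := frame_indep B.
have vU0 : v *m U = a *: v + 0 by rewrite addr0.
have wU0 : w *m U = b *: w + 0 by rewrite addr0.
have cancel c d z : c ^+ q * d != 1 -> (1 - c ^+ q * d) * z = 0 -> z = 0.
  by move=> cd /eqP; rewrite mulf_eq0 subr_eq0 eq_sym (negbTE cd) => /eqP.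
have aa : a ^+ q * a = 1.
  apply/eqP/negPn/negP => aa; have vv : h v v = 0 by apply: herm_eigen aa.
  have vu : h v u = 0.
    by apply: (cancel _ _ _ aa); rewrite (herm_shift vU0 uU) vv !herm0l //; ring.
  have uv : h u v = 0.
    by apply: (cancel _ _ _ aa); rewrite (herm_shift uU vU0) vv !herm0r //; ring.
  have uu : h u u = 0.
    by apply: (cancel _ _ _ aa); rewrite (herm_shift uU uU) vv vu uv; ring.
  exact: (no_isotropic_plane B).
have a0 : a != 0 by apply: contra_eqN aa => /eqP ->; rewrite mulr0 eq_sym oner_eq0.
have [ab1 ba1] := norm1_neq aa ab.
have vw : h v w = 0 by apply: herm_eigen ab1.
have wv : h w v = 0 by apply: herm_eigen ba1.
have wu : h w u = 0.
  by apply: (cancel _ _ _ ba1); rewrite (herm_shift wU0 uU) wv !herm0l //; ring.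
have vv : h v v = 0.
  have := herm_shift vU0 uU; rewrite aa subrr mul0r !herm0l // mulr0 !addr0 => /esym/eqP.
  by rewrite mulf_eq0 expf_eq0 (negbTE a0) andbF => /eqP.
have vu : h v u != 0.
  by apply: contraNneq v0 => vu; apply/eqP; apply: (herm_nondegl B).
have ww : h w w != 0.
  by apply: contraNneq w0 => ww; apply/eqP; apply: (herm_nondegl B).
split => //; apply/eqP; apply: contraNT ww => bb; apply/eqP; exact: herm_eigen bb.
Qed.

Lemma elation_form v u w a : frame v u w \in unitmx -> shape_elation U v u w a ->
  [/\ a ^+ q * a = 1, h v v = 0, h v u = 0 /\ h u v = 0, h v w != 0 & h u u != 0].
Proof.
move=> B [vU uU wU]; have [v0 _ _ _ _] := frame_indep B.
have vU0 : v *m U = a *: v + 0 by rewrite addr0.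
have uU0 : u *m U = a *: u + 0 by rewrite addr0.
have aa : a ^+ q * a = 1.
  apply/eqP/negPn/negP => aa.
  by apply: (no_isotropic_plane B); apply: (herm_eigen _ _ aa).
have a0 : a != 0 by apply: contra_eqN aa => /eqP ->; rewrite mulr0 eq_sym oner_eq0.
have vv : h v v = 0.
  have := herm_shift vU0 wU; rewrite aa subrr mul0r !herm0l // mulr0 !addr0 => /esym/eqP.
  by rewrite mulf_eq0 expf_eq0 (negbTE a0) andbF => /eqP.
have uv : h u v = 0.
  have := herm_shift uU0 wU; rewrite aa subrr mul0r !herm0l // mulr0 !addr0 => /esym/eqP.
  by rewrite mulf_eq0 expf_eq0 (negbTE a0) andbF => /eqP.
have vu : h v u = 0.
  have := herm_shift wU uU0; rewrite aa subrr mul0r !herm0r mulr0 add0r addr0 => /esym/eqP.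
  by rewrite mulf_eq0 (negbTE a0) => /eqP.
split => //.
  by apply: contraNneq v0 => vw; apply/eqP; apply: (herm_nondegl B).
by apply/eqP => uu; apply: (no_isotropic_plane B).
Qed.

(** If a^(q+1) were not 1, [herm_shift] would kill [h v v], [h v u] and [h v w] in turn, against
    nondegeneracy. Otherwise each of its instances for (v, u), (v, w) and (w, v) leaves a single
    product, which must vanish. *)
Lemma regular_form v u w a : frame v u w \in unitmx -> shape_regular U v u w a ->
  [/\ a ^+ q * a = 1, h v v = 0, h v u = 0 /\ h u v = 0 & h v w != 0].
Proof.
move=> B [vU uU wU]; have [v0 _ _ _ _] := frame_indep B.
have vU0 : v *m U = a *: v + 0 by rewrite addr0.
have cancel z : a ^+ q * a != 1 -> (1 - a ^+ q * a) * z = 0 -> z = 0.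
  by move=> cd /eqP; rewrite mulf_eq0 subr_eq0 eq_sym (negbTE cd) => /eqP.
have aa : a ^+ q * a = 1.
  apply/eqP/negPn/negP => aa; have vv : h v v = 0 by apply: herm_eigen aa.
  have vu : h v u = 0.
    by apply: (cancel _ aa); rewrite (herm_shift vU0 uU) vv !herm0l //; ring.
  have vw : h v w = 0.
    by apply: (cancel _ aa); rewrite (herm_shift vU0 wU) vu !herm0l //; ring.
  by case/eqP: v0; apply: (herm_nondegl B).
have a0 : a != 0 by apply: contra_eqN aa => /eqP ->; rewrite mulr0 eq_sym oner_eq0.
have vv : h v v = 0.
  have := herm_shift vU0 uU; rewrite aa subrr mul0r !herm0l // mulr0 !addr0 => /esym/eqP.
  by rewrite mulf_eq0 expf_eq0 (negbTE a0) andbF => /eqP.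
have vu : h v u = 0.
  have := herm_shift vU0 wU; rewrite aa subrr mul0r !herm0l // mulr0 !addr0 => /esym/eqP.
  by rewrite mulf_eq0 expf_eq0 (negbTE a0) andbF => /eqP.
have uv : h u v = 0.
  have := herm_shift wU vU0; rewrite aa subrr mul0r !herm0r mulr0 add0r addr0 => /esym/eqP.
  by rewrite mulf_eq0 (negbTE a0) => /eqP.
split => //.
by apply: contraNneq v0 => vw; apply/eqP; apply: (herm_nondegl B).
Qed.

(* The map [a |-> a ^- q] permutes the eigenvalues. *)
Lemma distinct_form v u w a b c : frame v u w \in unitmx -> shape_distinct U v u w a b c ->
  exists v u w a b c, [/\ frame v u w \in unitmx, shape_distinct U v u w a b c
    & [\/ [/\ a ^+ q * a = 1, b ^+ q * b = 1 & c ^+ q * c = 1],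
          [/\ a ^+ q * a = 1, b ^+ q * c = 1 & c ^+ q * b = 1]
        | [/\ a ^+ q * b = 1, b ^+ q * c = 1 & c ^+ q * a = 1]]].
Proof.
move=> B S; have [v0 u0 w0 _ _] := frame_indep B.
have [vU uU wU [ab ac bc]] := S.
have tau x d : x != 0 -> x *m U = d *: x ->
    [\/ d ^+ q * a = 1, d ^+ q * b = 1 | d ^+ q * c = 1].
  move=> x0 xU; have [/eqP|da] := boolP (d ^+ q * a == 1); first exact: Or31.
  have [/eqP|db] := boolP (d ^+ q * b == 1); first exact: Or32.
  have [/eqP|dc] := boolP (d ^+ q * c == 1); first exact: Or33.
  by case/eqP: x0; apply: (herm_nondegl B); [apply: herm_eigen da | apply: herm_eigen db | apply: herm_eigen dc].
have inj (d e z : K) : d != e -> d ^+ q * z = 1 -> e ^+ q * z = 1 -> False.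
  move=> de dz ez; have z0 : z != 0 by apply: contra_eqN dz => /eqP ->; rewrite mulr0 eq_sym oner_eq0.
  by case/eqP: de; apply: frob_inj; apply: (mulIf z0); rewrite dz ez.
have Bs := frame_swap B; have Br := frame_rot B; have Brr := frame_rot Br.
have [ba [ca cb]] : b != a /\ (c != a /\ c != b) by rewrite !(eq_sym _ a) (eq_sym c).
(* Of the 27 combinations, injectivity leaves the six permutations. They are relabelled so that a
   2-cycle fixes [a], and a 3-cycle sends [a] to [b] to [c]. *)
case: (tau _ _ v0 vU) => ta; case: (tau _ _ u0 uU) => tb; case: (tau _ _ w0 wU) => tc;
  try by [case: (inj _ _ _ ab ta tb) | case: (inj _ _ _ ac ta tc) | case: (inj _ _ _ bc tb tc)].
- by exists v, u, w, a, b, c; split => //; apply: Or31.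
- by exists v, u, w, a, b, c; split => //; apply: Or32.
- by exists w, v, u, c, a, b; split => //; apply: Or32.
- by exists v, u, w, a, b, c; split => //; apply: Or33.
- by exists v, w, u, a, c, b; split => //; apply: Or33.
- by exists u, w, v, b, c, a; split => //; apply: Or32.
Qed.

End UnitaryShapes.

(** * Polar lines, tangents and chords *)

Section RationalGeometry.

Variables (K : closedFieldType) (q : nat).
Hypotheses (q_pchar : [pchar K].-nat q) (q_gt1 : (1 < q)%N).
Implicit Types (v u w x y : 'rV[K]_3) (a b c t : K).
Notation h := (herm q).

Let q_gt0 : (0 < q)%N. Proof. exact: ltnW. Qed.

Definition rational_vector m x := forall i, x ord0 i ^+ m = x ord0 i.

Lemma rational_vline m v : rational_vector m v -> rational m <[v]>%VS.
Proof. by move=> vm; exists [:: v]; rewrite span_seq1; split => // x; rewrite inE => /eqP ->. Qed.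

Lemma rational_vlineP m v : v != 0 -> rational m <[v]>%VS ->
  exists2 t, t != 0 & rational_vector m (t *: v).
Proof.
move=> v0 [s [sm sE]].
have [x xs x0] : exists2 x, x \in s & x != 0.
  apply/hasP; apply: contraNT v0 => /hasPn s0.
  suff : (<<s>> <= 0)%VS by rewrite -sE -memvE memv0.
  by apply/span_subvP => x /s0; rewrite negbK => /eqP ->; rewrite mem0v.
have /vlineP [t xE] : x \in <[v]>%VS by rewrite sE memv_span.
exists t; first by apply: contraNneq x0 => t0; rewrite xE t0 scale0r.
by rewrite -xE; apply: sm.
Qed.

(** Dividing [v] by a nonzero coordinate cancels the factor [t] and gives a vector fixed by the m-th
    power map. *)
Lemma rational_frobenius m v t : v != 0 ->
  (forall i, v ord0 i ^+ m = t * v ord0 i) -> rational m <[v]>%VS.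
Proof.
move=> v0 vt; have [i vi] : exists i, v ord0 i != 0.
  apply/existsP; rewrite -negb_forall; apply: contraNN v0 => /forallP v0.
  by apply/eqP/rowP => i; rewrite mxE; apply/eqP.
have c0 : (v ord0 i)^-1 != 0 by rewrite invr_eq0.
rewrite -(vline_eq c0 (erefl _)); apply: rational_vline => j.
have m0 : (v ord0 i) ^+ m != 0 by rewrite expf_neq0.
have t0 : t != 0 by move: m0; rewrite vt mulf_eq0 => /norP [].
rewrite mxE exprMn exprVn !vt; field.
by rewrite t0 vi.
Qed.

(** Hermitian symmetry survives over [K] as soon as one argument has coordinates in F_(q^2). *)
Lemma herm_conj v x : rational_vector (q ^ 2) v -> h x v = h v x ^+ q.
Proof.
move=> vq; rewrite /herm !sum3 !(exprDn_pchar _ _ q_pchar) !exprMn -!exprM mulnn !vq.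
by rewrite ![_ * v _ _]mulrC.
Qed.

(** Geometrically, the tangent at a point of the curve passes through the Frobenius image of that
    point. *)
Lemma herm_frobenius x : h x x ^+ q = h x (\row_i x ord0 i ^+ (q ^ 2)).
Proof.
rewrite /herm !sum3 !(exprDn_pchar _ _ q_pchar) !exprMn -!exprM mulnn !mxE.
by rewrite ![_ ^+ (q ^ 2) * _]mulrC.
Qed.

Definition polar_functional v : 'cV[K]_3 := \col_i v ord0 i ^+ q.
Definition polar_map v : 'Hom('rV[K]_3, 'rV[K]_1) := linfun (mulmxr (polar_functional v)).
Definition polar v : {vspace 'rV[K]_3} := lker (polar_map v).

Lemma mem_polar v x : (x \in polar v) = (h v x == 0).
Proof.
rewrite memv_ker lfunE /=.
have E : x *m polar_functional v = (h v x)%:M.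
  apply/matrixP => i j; rewrite !ord1 !mxE eqxx mulr1n.
  by apply: eq_bigr => k _; rewrite !mxE mulrC.
rewrite E; apply/eqP/eqP => [/matrixP/(_ 0 0)|->]; last by rewrite raddf0.
by rewrite !mxE eqxx mulr1n.
Qed.

Lemma dim_polar v : v != 0 -> (\dim (polar v) == 2)%N.
Proof.
move=> v0; pose f := polar_map v.
have dE : (\dim (polar v) + \dim (f @: fullv) = 3)%N.
  by rewrite -[RHS]/(dim 'rV[K]_3) -dimvf -(limg_ker_dim f fullv) (capv_idPr (subvf _)).
have d1 : (\dim (f @: fullv) <= 1)%N by rewrite (leq_trans (dimvS (subvf _))) // dimvf.
have d0 : \dim (f @: fullv)%VS != 0%N.
  rewrite dimv_eq0; apply: contraNneq v0 => f0; apply/eqP/rowP => i; rewrite mxE.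
  have : f (delta_mx 0 i) \in (f @: fullv)%VS by rewrite memv_img // memvf.
  rewrite f0 memv0 lfunE /= -rowE => /eqP/matrixP/(_ 0 0); rewrite !mxE.
  by apply: expq_eq0.
by move: dE d1 d0; clear; lia.
Qed.

Definition polar_line v (v0 : v != 0) : line K := exist _ (polar v) (dim_polar v0).

Lemma polar_isP (P : point K) v (U : {vspace 'rV[K]_3}) : point_vspace P = <[v]>%VS ->
  (forall x, (x \in U) = (h v x == 0)) -> is_polar q P U.
Proof.
move=> Pv UE w; rewrite Pv UE; split => [/eqP vw _ /vlineP [c ->]|E]; last first.
  by apply/eqP; apply: E; apply: memv_line.
by have := hermZl q c v w; rewrite vw mulr0.
Qed.

Lemma rational_polar v : v != 0 -> rational_vector (q ^ 2) v -> rational (q ^ 2) (polar v).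
Proof.
move=> v0 vq; pose a i := v ord0 i ^+ q.
have aq i : a i ^+ (q ^ 2) = a i by rewrite /a exprAC vq.
pose r (b c d : K) : 'rV[K]_3 := \row_i [:: b; c; d]`_i.
(* Up to sign, the cross products of the coefficient vector [a] of the line with the standard basis:
   they lie on the line, and where [a i] is nonzero two of them span it. *)
pose s := [:: r 0 (a o2) (- a o1); r (- a o2) 0 (a o0); r (a o1) (- a o0) 0].
have Nq (b : K) : (- b) ^+ (q ^ 2) = - (b ^+ (q ^ 2)).
  have q2 : [pchar K].-nat (q ^ 2)%N by rewrite pnatX q_pchar.
  have := exprDn_pchar (- b) b q2; rewrite addNr expr0n expn_eq0 eqn0Ngt q_gt0 /= => /esym/eqP.
  by rewrite addr_eq0 => /eqP.
have zq : 0 ^+ (q ^ 2) = 0 :> K by rewrite expr0n expn_eq0 eqn0Ngt q_gt0.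
exists s; split => [x xs i|].
  move: xs i; rewrite !inE => /or3P [] /eqP ->; apply: ord3P; rewrite !mxE /= ?Nq ?aq ?zq //.
have hE x : h v x = a o0 * x ord0 o0 + a o1 * x ord0 o1 + a o2 * x ord0 o2.
  by rewrite /herm sum3.
apply/eqP; rewrite eqEsubv; apply/andP; split; last first.
  apply/span_subvP => x; rewrite !inE mem_polar hE => /or3P [] /eqP ->; rewrite !mxE /=; apply/eqP; ring.
apply/subvP => x; rewrite mem_polar hE => /eqP xE.
have ms y : y \in s -> y \in <<s>>%VS by apply: memv_span.
have [m0 m1 m2] : [/\ r 0 (a o2) (- a o1) \in <<s>>%VS, r (- a o2) 0 (a o0) \in <<s>>%VS
    & r (a o1) (- a o0) 0 \in <<s>>%VS] by split; apply: ms; rewrite !inE eqxx ?orbT.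
have [i ai] : exists i, a i != 0.
  apply/existsP; rewrite -negb_forall; apply: contraNN v0 => /forallP v0.
  by apply/eqP/rowP => i; rewrite mxE; apply: (expq_eq0 q_gt1); apply/eqP; apply: v0.
suff [b [c [d ->]]] : exists b c d, x = b *: r 0 (a o2) (- a o1)
    + c *: r (- a o2) 0 (a o0) + d *: r (a o1) (- a o0) 0.
  by rewrite !memvD // memvZ.
move: i ai; apply: ord3P => ai.
- exists 0, (x ord0 o2 / a o0), (- (x ord0 o1 / a o0)); apply/rowP; apply: ord3P; rewrite !mxE /=.
  + have -> : x ord0 o0 = (0 - (a o1 * x ord0 o1 + a o2 * x ord0 o2)) / a o0.
      by rewrite -xE; field.
    by field.
  + by field.
  + by field.
- exists (- (x ord0 o2 / a o1)), 0, (x ord0 o0 / a o1); apply/rowP; apply: ord3P; rewrite !mxE /=.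
  + by field.
  + have -> : x ord0 o1 = (0 - (a o0 * x ord0 o0 + a o2 * x ord0 o2)) / a o1.
      by rewrite -xE; field.
    by field.
  + by field.
- exists (x ord0 o1 / a o2), (- (x ord0 o0 / a o2)), 0; apply/rowP; apply: ord3P; rewrite !mxE /=.
  + by field.
  + by field.
  + have -> : x ord0 o2 = (0 - (a o0 * x ord0 o0 + a o1 * x ord0 o1)) / a o2.
      by rewrite -xE; field.
    by field.
Qed.

(** A second isotropic direction in the polar line of [v] would span a totally isotropic plane with
    [v]; [herm_conj] supplies the missing product [h x v = 0]. *)
Lemma tangent_point v x : v != 0 -> rational_vector (q ^ 2) v ->
  h v v = 0 -> h v x = 0 -> h x x = 0 -> exists t, x = t *: v.
Proof.
move=> v0 vq vv vx xx.
have [/vlineP//|/vlineP xv] := boolP (x \in <[v]>%VS).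
have [w wP] := exists_not_in_span v x.
have B : frame v x w \in unitmx by apply: frame_unitI => // t E; apply: xv; exists t.
case: (no_isotropic_plane q_pchar q_gt1 B vv vx _ xx).
by rewrite (herm_conj _ vq) vx expr0n eqn0Ngt q_gt0.
Qed.

Lemma tangent_polar v (v0 : v != 0) : rational_vector (q ^ 2) v -> h v v = 0 ->
  tangent q (polar_line v0).
Proof.
move=> vq vv; split; first exact: rational_polar.
exists [:: point_of v0]; split => // P; rewrite inE.
have Pq : rational (q ^ 2) <[v]>%VS by apply: rational_vline.
split => [/eqP ->|[_ Pc Pl]].
  split => //; first exact/on_curve_vline.
  by rewrite -memvE mem_polar vv.
have [x x0 Px] := pointP P; rewrite Px in Pc Pl.
move/on_curve_vline: Pc => xx; rewrite -memvE mem_polar in Pl.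
have [t xE] := tangent_point v0 vq vv (eqP Pl) xx.
apply/eqP; apply: val_inj; rewrite [LHS]Px.
by apply: (vline_eq _ xE); apply: contraNneq x0 => t0; rewrite xE t0 scale0r.
Qed.

(** The Frobenius image of [x] is orthogonal to [x] and lies on the polar line of [v]. Were it
    independent of [x], then [x] would be orthogonal to the frame made of [x], its image and [v]. *)
Lemma chord_point_rational v x : h v v != 0 -> rational_vector (q ^ 2) v ->
  x != 0 -> h v x = 0 -> h x x = 0 -> rational (q ^ 2) <[x]>%VS.
Proof.
move=> vv vq x0 vx xx; pose x' := \row_i x ord0 i ^+ (q ^ 2).
have xx' : h x x' = 0 by rewrite -herm_frobenius xx expr0n eqn0Ngt q_gt0.
have vx' : h v x' = 0.
  have <- : h v x ^+ (q ^ 2) = h v x'.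
    have q2 : [pchar K].-nat (q ^ 2)%N by rewrite pnatX q_pchar.
    rewrite /herm !sum3 !(exprDn_pchar _ _ q2) !exprMn !(exprAC _ q) !vq.
    by rewrite /x' !mxE.
  by rewrite vx expr0n expn_eq0 eqn0Ngt q_gt0.
have [/vlineP [t xE]|/vlineP xv] := boolP (x' \in <[x]>%VS).
  apply: (rational_frobenius (t := t)) => // i.
  by move/rowP: xE => /(_ i); rewrite !mxE.
have B : frame x x' v \in unitmx.
  apply: frame_unitI => // [t E|s t E]; first by apply: xv; exists t.
  by move: vv; rewrite {2}E hermDr !hermZr vx vx' !mulr0 addr0 eqxx.
case/eqP: x0; apply: (herm_nondegl q_gt1 B) => //.
by rewrite (herm_conj _ vq) vx expr0n eqn0Ngt q_gt0.
Qed.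

Lemma nonroot (p : {poly K}) : (1 < size p)%N -> exists t, p.[t] != 0.
Proof.
move=> p1; have /closed_rootP [t] : size (p - 1) != 1%N.
  by rewrite size_polyDl ?size_polyN ?size_poly1 // gtn_eqF.
by rewrite /root !hornerE subr_eq0 => /eqP pt; exists t; rewrite pt oner_eq0.
Qed.

(** As [g2] is off the curve, the points sought are g1 + t g2 for the roots [t] of a polynomial of
    degree q+1. Its derivative at [t] is [h (g1 + t *: g2) g2], so a multiple root would give a
    nonzero vector orthogonal to the frame. *)
Lemma chord_points_aux v g1 g2 : frame v g1 g2 \in unitmx ->
  h v g1 = 0 -> h v g2 = 0 -> h g1 v = 0 -> h g2 v = 0 -> h g2 g2 != 0 ->
  h v v != 0 ->
  exists s : seq (point K), [/\ uniq s, size s = q.+1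
    & forall P : point K, P \in s <-> on_curve q P /\ (P <= polar v)%VS].
Proof.
move=> B v1 v2 g1v g2v g22 vv.
have g0 t : g1 + t *: g2 != 0.
  apply/eqP => E; have : 0 *: v + 1 *: g1 + t *: g2 = 0 by rewrite scale0r add0r scale1r.
  by case/(frame_free0 B) => _ /eqP; rewrite oner_eq0.
pose p := (h g1 g1)%:P + h g1 g2 *: 'X + h g2 g1 *: 'X^q + h g2 g2 *: 'X^(q.+1).
have pE t : p.[t] = h (g1 + t *: g2) (g1 + t *: g2).
  by rewrite /p !hornerE !hermDr !hermZr !(hermDl q_pchar) !hermZl exprS; ring.
have sp : size p = q.+2.
  have s1 : size (h g2 g2 *: 'X^(q.+1)) = q.+2 by rewrite size_scale // size_polyXn.
  rewrite /p addrC size_polyDl s1 // ltnS; apply/leq_sizeP => j qj.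
  rewrite !coefD !coefZ coefX coefXn coefC.
  have [-> -> ->] : [/\ (j == 0) = false, (j == 1) = false & (j == q) = false]%N by split; lia.
  by rewrite !mulr0 !addr0.
have [||r [ur sr rE]] := @simple_roots K p.
- by rewrite -size_poly_gt0 sp.
- move=> t; rewrite /root pE => /eqP xx.
  have pd : p^`().[t] = h (g1 + t *: g2) g2.
    have Mq (r : {poly K}) : r *+ q = 0.
      by rewrite -mulr_natr -polyC_natr (pchar_natr0 q_pchar q_gt1) mulr0.
    rewrite /p !(derivD, derivZ, derivC, derivX, derivXn) /= mulrSr !Mq scaler0 !add0r addr0.
    by rewrite !hornerE (hermDl q_pchar) hermZl mulrC.
  rewrite pd; apply/eqP => x2; case/eqP: (g0 t).
  apply: (herm_nondegl q_gt1 B) => //.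
    by rewrite (hermDl q_pchar) hermZl g1v g2v mulr0 addr0.
  by move: xx; rewrite hermDr hermZr x2 mulr0 addr0.
exists [seq point_of (g0 t) | t <- r]; split.
- rewrite map_inj_uniq // => t t' /(congr1 val) /= E.
  have /vlineP [c] : g1 + t *: g2 \in <[g1 + t' *: g2]>%VS by rewrite -E memv_line.
  rewrite scalerDr scalerA => E'.
  have : 0 *: v + 1 *: g1 + t *: g2 = 0 *: v + c *: g1 + (c * t') *: g2.
    by rewrite scale0r !add0r scale1r.
  by case/(frame_free B) => _ <- ->; rewrite mul1r.
- by rewrite size_map sr sp.
move=> P; split.
  move/mapP => [t tr ->]; split.
    by apply/on_curve_vline; rewrite -pE; apply/eqP; move: tr; rewrite rE.
  by rewrite -memvE mem_polar hermDr hermZr v1 v2 mulr0 addr0.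
have [x x0 Px] := pointP P; rewrite Px => -[/on_curve_vline xx].
rewrite -memvE mem_polar => /eqP vx.
have [a [b [c xE]]] := frame_coord x B.
have a0 : a = 0.
  by move: vx; rewrite xE !hermDr !hermZr v1 v2 !mulr0 !addr0 => /eqP; rewrite mulf_eq0 (negbTE vv) orbF => /eqP.
rewrite a0 scale0r add0r in xE.
have b0 : b != 0.
  apply/eqP => b0; move: xx; rewrite xE b0 scale0r add0r hermZr hermZl => /eqP.
  rewrite !mulf_eq0 expf_eq0 (negbTE g22) q_gt0 orbF orbb => /eqP c0.
  by move: x0; rewrite xE b0 c0 !scale0r addr0 eqxx.
have xE' : x = b *: (g1 + (c / b) *: g2) by rewrite xE scalerDr scalerA mulrC divfK.
apply/mapP; exists (c / b); last by apply: val_inj; rewrite [LHS]Px; apply: vline_eq xE'.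
rewrite rE /root pE; move: xx; rewrite xE' hermZr hermZl => /eqP.
by rewrite !mulf_eq0 expf_eq0 (negbTE b0) andbF.
Qed.

(** If both [g1] and [g2] are isotropic, some g1 + t g2 is not, for otherwise the plane would be
    totally isotropic; so one basis vector may be taken off the curve. *)
Lemma chord_points v g1 g2 : frame v g1 g2 \in unitmx ->
  h v g1 = 0 -> h v g2 = 0 -> h g1 v = 0 -> h g2 v = 0 -> h v v != 0 ->
  exists s : seq (point K), [/\ uniq s, size s = q.+1
    & forall P : point K, P \in s <-> on_curve q P /\ (P <= polar v)%VS].
Proof.
move=> B v1 v2 g1v g2v vv.
have [g22|g22] := eqVneq (h g2 g2) 0; last exact: chord_points_aux B v1 v2 g1v g2v g22 vv.
have [g11|g11] := eqVneq (h g1 g1) 0; last exact: chord_points_aux (frame_swap B) v2 v1 g2v g1v g11 vv.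
pose p := h g1 g2 *: 'X + h g2 g1 *: 'X^q.
have p1 : (1 < size p)%N.
  rewrite ltnNge; apply/negP => /leq_sizeP p1.
  have := p1 1%N isT; have := p1 q q_gt0; rewrite /p !coefD !coefZ !coefX !coefXn !eqxx.
  have [-> ->] : (q == 1)%N = false /\ (1 == q)%N = false by split; lia.
  rewrite !mulr1 !mulr0 addr0 add0r => g21 g12.
  exact: (no_isotropic_plane q_pchar q_gt1 (frame_rot B) g11 g12 g21 g22).
have [t pt] := nonroot p1.
apply: (@chord_points_aux v g1 (g1 + t *: g2)) => //.
- apply: frame_unit => a b c.
  have -> : a *: v + b *: g1 + c *: (g1 + t *: g2) = a *: v + (b + c) *: g1 + (c * t) *: g2.
    by rewrite scalerDr scalerDl scalerA !addrA.
  have t0 : t != 0.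
    by apply: contraNneq pt => ->; rewrite /p !hornerE expr0n eqn0Ngt q_gt0 /= ?mulr0 ?addr0.
  case/(frame_free0 B) => -> bc /eqP; rewrite mulf_eq0 (negbTE t0) orbF => /eqP c0.
  by move: bc; rewrite c0 addr0.
- by rewrite hermDr hermZr v1 v2 mulr0 addr0.
- by rewrite (hermDl q_pchar) hermZl g1v g2v mulr0 addr0.
- rewrite !hermDr !hermZr !(hermDl q_pchar) !hermZl g11 g22.
  by move: pt; rewrite /p !hornerE; congr (_ != 0); ring.
Qed.

Lemma chord_polar v (v0 : v != 0) g1 g2 : frame v g1 g2 \in unitmx ->
  rational_vector (q ^ 2) v ->
  h v g1 = 0 -> h v g2 = 0 -> h g1 v = 0 -> h g2 v = 0 -> h v v != 0 ->
  chord q (polar_line v0).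
Proof.
move=> B vq v1 v2 g1v g2v vv; split; first exact: rational_polar.
have [s [us ss sE]] := chord_points B v1 v2 g1v g2v vv; exists s; split => // P.
rewrite sE; split => [[Pc Pl]|[]//]; split => //.
have [x x0 Px] := pointP P; rewrite Px in Pc Pl *.
move/on_curve_vline: Pc => xx; rewrite -memvE mem_polar in Pl.
exact: (chord_point_rational vv vq x0 (eqP Pl) xx).
Qed.

End RationalGeometry.

(** * Eigenvectors *)

Section Eigenvectors.

Variables (K : closedFieldType) (U : 'M[K]_3) (v u w : 'rV[K]_3).
Hypothesis B : frame v u w \in unitmx.
Implicit Types (x y : 'rV[K]_3) (a b c l t : K).

Let E l z e : z * e = l * z -> l = e \/ z = 0.
Proof.
move/eqP; rewrite mulrC -subr_eq0 -mulrBl mulf_eq0 subr_eq0 => /orP [] /eqP; first by left.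
by right.
Qed.

Lemma eigen_distinct a b c l x : shape_distinct U v u w a b c -> x *m U = l *: x ->
  [\/ x = 0, l = a /\ (exists t, x = t *: v), l = b /\ (exists t, x = t *: u)
    | l = c /\ exists t, x = t *: w].
Proof.
move=> [vU uU wU [ab ac bc]] xU; have [x1 [x2 [x3 xE]]] := frame_coord x B.
have : (x1 * a) *: v + (x2 * b) *: u + (x3 * c) *: w = (l * x1) *: v + (l * x2) *: u + (l * x3) *: w.
  by rewrite -!scalerA -!scalerDr -xE -xU -vU -uU -wU !scalemxAl -!mulmxDl -xE.
case/(frame_free B) => E1 E2 E3.
have [la|x10] := E E1.
  apply: Or42; split => //; exists x1.
  have [lb|x20] := E E2; first by rewrite -la -lb eqxx in ab.
  have [lc|x30] := E E3; first by rewrite -la -lc eqxx in ac.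
  by rewrite xE x20 x30 !scale0r !addr0.
have [lb|x20] := E E2.
  apply: Or43; split => //; exists x2.
  have [lc|x30] := E E3; first by rewrite -lb -lc eqxx in bc.
  by rewrite xE x10 x30 !scale0r add0r addr0.
have [lc|x30] := E E3.
  by apply: Or44; split => //; exists x3; rewrite xE x10 x20 !scale0r !add0r.
by apply: Or41; rewrite xE x10 x20 x30 !scale0r !addr0.
Qed.

Lemma eigen_homology a b l x : shape_homology U v u w a b -> x *m U = l *: x ->
  [\/ x = 0, l = a /\ (exists s t, x = s *: v + t *: u) | l = b /\ exists t, x = t *: w].
Proof.
move=> [vU uU wU ab] xU; have [x1 [x2 [x3 xE]]] := frame_coord x B.
have : (x1 * a) *: v + (x2 * a) *: u + (x3 * b) *: w = (l * x1) *: v + (l * x2) *: u + (l * x3) *: w.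
  by rewrite -!scalerA -!scalerDr -xE -xU -vU -uU -wU !scalemxAl -!mulmxDl -xE.
case/(frame_free B) => E1 E2 E3.
have [lb|x30] := E E3.
  apply: Or33; split => //; exists x3.
  have [la|x10] := E E1; first by rewrite -la -lb eqxx in ab.
  have [la|x20] := E E2; first by rewrite -la -lb eqxx in ab.
  by rewrite xE x10 x20 !scale0r !add0r.
rewrite x30 scale0r addr0 in xE.
have [la|x10] := E E1; first by apply: Or32; split => //; exists x1, x2.
have [la|x20] := E E2; first by apply: Or32; split => //; exists x1, x2.
by apply: Or31; rewrite xE x10 x20 !scale0r !addr0.
Qed.

Lemma eigen_mixed a b l x : shape_mixed U v u w a b -> x *m U = l *: x ->
  [\/ x = 0, l = a /\ (exists t, x = t *: v) | l = b /\ exists t, x = t *: w].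
Proof.
move=> [vU uU wU ab] xU; have [x1 [x2 [x3 xE]]] := frame_coord x B.
have : (x1 * a + x2) *: v + (x2 * a) *: u + (x3 * b) *: w
    = (l * x1) *: v + (l * x2) *: u + (l * x3) *: w.
  rewrite -[in RHS](scalerA l x1) -[in RHS](scalerA l x2) -[in RHS](scalerA l x3) -!scalerDr -xE -xU xE.
  rewrite !mulmxDl -!scalemxAl vU uU wU scalerDr !scalerA scalerDl -!addrA; congr (_ + _).
  by rewrite addrCA.
case/(frame_free B) => E1 E2 E3.
have x20 : x2 = 0.
  have [la|//] := E E2; move: E1; rewrite la mulrC => /eqP.
  by rewrite -subr_eq0 addrAC subrr add0r => /eqP.
rewrite x20 addr0 in E1; rewrite x20 scale0r addr0 in xE.
have [la|x10] := E E1.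
  apply: Or32; split => //; exists x1.
  have [lb|x30] := E E3; first by rewrite -la -lb eqxx in ab.
  by rewrite xE x30 scale0r addr0.
have [lb|x30] := E E3.
  by apply: Or33; split => //; exists x3; rewrite xE x10 scale0r add0r.
by apply: Or31; rewrite xE x10 x30 !scale0r !addr0.
Qed.

Lemma eigen_elation a l x : shape_elation U v u w a -> x *m U = l *: x ->
  x = 0 \/ l = a /\ exists s t, x = s *: v + t *: u.
Proof.
move=> [vU uU wU] xU; have [x1 [x2 [x3 xE]]] := frame_coord x B.
have : (x1 * a + x3) *: v + (x2 * a) *: u + (x3 * a) *: w
    = (l * x1) *: v + (l * x2) *: u + (l * x3) *: w.
  rewrite -[in RHS](scalerA l x1) -[in RHS](scalerA l x2) -[in RHS](scalerA l x3) -!scalerDr -xE -xU xE.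
  rewrite !mulmxDl -!scalemxAl vU uU wU scalerDr !scalerA scalerDl -!addrA; congr (_ + _).
  by rewrite addrCA [X in _ + X]addrC.
case/(frame_free B) => E1 E2 E3.
have x30 : x3 = 0.
  have [la|//] := E E3; move: E1; rewrite la mulrC => /eqP.
  by rewrite -subr_eq0 addrAC subrr add0r => /eqP.
rewrite x30 addr0 in E1; rewrite x30 scale0r addr0 in xE.
have [la|x10] := E E1; first by right; split => //; exists x1, x2.
have [la|x20] := E E2; first by right; split => //; exists x1, x2.
by left; rewrite xE x10 x20 !scale0r addr0.
Qed.

Lemma eigen_regular a l x : shape_regular U v u w a -> x *m U = l *: x ->
  x = 0 \/ l = a /\ exists t, x = t *: v.
Proof.
move=> [vU uU wU] xU; have [x1 [x2 [x3 xE]]] := frame_coord x B.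
have : (x1 * a + x2) *: v + (x2 * a + x3) *: u + (x3 * a) *: w
    = (l * x1) *: v + (l * x2) *: u + (l * x3) *: w.
  rewrite -[in RHS](scalerA l x1) -[in RHS](scalerA l x2) -[in RHS](scalerA l x3) -!scalerDr -xE -xU xE.
  rewrite !mulmxDl -!scalemxAl vU uU wU !scalerDr !scalerA !scalerDl -!addrA; congr (_ + _).
  by rewrite addrCA; congr (_ + _); congr (_ + _); rewrite addrC.
case/(frame_free B) => E1 E2 E3.
have la_out (z z' : K) : l = a -> z * a + z' = l * z -> z' = 0.
  by move=> ->; rewrite mulrC => /eqP; rewrite -subr_eq0 addrAC subrr add0r => /eqP.
have x30 : x3 = 0 by have [la|//] := E E3; apply: la_out la E2.
rewrite x30 addr0 in E2; rewrite x30 scale0r addr0 in xE.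
have x20 : x2 = 0 by have [la|//] := E E2; apply: la_out la E1.
rewrite x20 addr0 in E1; rewrite x20 scale0r addr0 in xE.
have [la|x10] := E E1; first by right; split => //; exists x1.
by left; rewrite xE x10 scale0r.
Qed.

End Eigenvectors.

(** * Collineations in a Jordan frame *)

Section Collineation.

Variables (F : finFieldType) (K : closedFieldType) (iota : {rmorphism F -> K}).
Variable sigma : PGL3 F.
Variables (d : K) (U : 'M[K]_3).
Hypotheses (d_neq0 : d != 0) (ME : mx_of iota sigma = d *: U).
Hypothesis Uunit : U \in unitmx.
Implicit Types (v u w x y : 'rV[K]_3) (a b c l t : K).

Lemma eigen_neq0 x l : x != 0 -> x *m U = l *: x -> l != 0.
Proof.
move=> x0 xU; apply: contraNneq x0 => l0; rewrite -(mulmxK Uunit x) xU l0.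
by rewrite scale0r mul0mx.
Qed.

Lemma fixes_vline x : x != 0 -> fixes iota sigma <[x]>%VS <-> exists l, x *m U = l *: x.
Proof.
move=> x0; rewrite /fixes img_vline ME -scalemxAr; split => [E|[l xU]].
  have /vlineP [l xl] : d *: (x *m U) \in <[x]>%VS by rewrite -E memv_line.
  by exists (d^-1 * l); rewrite -scalerA -xl scalerA mulVf // scale1r.
rewrite xU scalerA; apply: vline_eq (erefl _); rewrite mulf_neq0 //.
exact: eigen_neq0 xU.
Qed.

Lemma fixes_stable (V : {vspace 'rV[K]_3}) :
  (forall y, y \in V -> y *m U \in V) -> fixes iota sigma V.
Proof.
move=> VU; rewrite /fixes /img ME; set f := linfun _.
have f0 : lker f == 0%VS.
  rewrite -subv0; apply/subvP => y; rewrite memv_ker lfunE /= memv0.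
  rewrite -scalemxAr scaler_eq0 (negbTE d_neq0) /= => /eqP yU.
  by rewrite -(mulmxK Uunit y) yU mul0mx.
apply/eqP; rewrite eqEdim limg_dim_eq ?(eqP f0) ?capv0 // leqnn andbT.
apply/subvP => _ /memv_imgP [y yV ->]; rewrite lfunE /= -scalemxAr memvZ //.
exact: VU.
Qed.

Lemma perspectivityI (P : point K) (l : line K) a v : point_vspace P = <[v]>%VS ->
  (forall y, exists s, y *m U = a *: y + s *: v) ->
  (forall y, y \in (l : {vspace _}) -> y *m U = a *: y) ->
  perspectivity iota sigma P l.
Proof.
move=> Pv yU lU; split => [m|Q].
  rewrite Pv -memvE => vm; apply: fixes_stable => y ym.
  by have [s ->] := yU y; rewrite memvD // memvZ.
have [x x0 Qx] := pointP Q; rewrite Qx -memvE => /lU xU.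
by apply/(fixes_vline x0); exists a.
Qed.

(** Two independent vectors of the axis and their sum are all eigenvectors, so the eigenvalues
    coincide. Thus no perspectivity exists when every eigenspace is a line. *)
Lemma perspectivity_axis (P : point K) (l : line K) : perspectivity iota sigma P l ->
  exists a x y, [/\ x != 0, forall t, y <> t *: x, x *m U = a *: x & y *m U = a *: y].
Proof.
case: l => l /= dl [_ lP].
have eig x : x != 0 -> x \in l -> exists a, x *m U = a *: x.
  by move=> x0 xl; apply/(fixes_vline x0); apply: (lP (point_of x0)); rewrite /= -memvE.
have x0 : vpick l != 0 by rewrite vpick0 -dimv_eq0 (eqP dl).
have [y yl yx] : exists2 y, y \in l & y \notin <[vpick l]>%VS.
  apply/subvPn; apply/negP => /dimvS; rewrite (eqP dl) dim_vline; by case: (_ != _).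
have yx' t : y <> t *: vpick l by move=> E; move/vlineP: yx; apply; exists t.
have [a xU] := eig _ x0 (memv_pick l).
have y0 : y != 0 by apply/eqP => y0; apply: (yx' 0); rewrite scale0r.
have [b yU] := eig _ y0 yl.
have xy0 : vpick l + y != 0.
  by apply/eqP => /eqP; rewrite addrC addr_eq0 -scaleN1r => /eqP; apply: yx'.
have [c xyU] := eig _ xy0 (memvD (memv_pick l) yl).
exists a, (vpick l), y; split => //; rewrite yU; congr (_ *: _).
have E : (b - c) *: y = (c - a) *: vpick l.
  have := xyU; rewrite mulmxDl xU yU => /rowP E; apply/rowP => i.
  move: (E i); rewrite !mxE => Ei; apply/eqP; rewrite -subr_eq0.
  have -> : (b - c) * y ord0 i - (c - a) * vpick l ord0 i
    = (a * vpick l ord0 i + b * y ord0 i) - c * (vpick l ord0 i + y ord0 i) by ring.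
  by rewrite Ei subrr.
have bc : b - c = 0.
  apply/eqP; apply: contra_notT (yx' ((b - c)^-1 * (c - a))) => bc.
  by rewrite -scalerA -E scalerA mulVf // scale1r.
move: E; rewrite bc scale0r => /esym/eqP; rewrite scaler_eq0 (negbTE x0) orbF subr_eq0.
by move/eqP <-; apply/eqP; rewrite -subr_eq0 bc.
Qed.

Lemma no_perspectivity_distinct v u w a b c : frame v u w \in unitmx ->
  shape_distinct U v u w a b c -> forall P (m : line K), ~ perspectivity iota sigma P m.
Proof.
move=> B S P l /perspectivity_axis [e [x [y [x0 yx xU yU]]]].
have [_ _ _ [ab ac bc]] := S.
have y0 : y <> 0 by move=> y0; apply: (yx 0); rewrite scale0r.
have prop t s z : x = t *: z -> y = s *: z -> False.
  move=> xE yE; have t0 : t != 0 by apply: contraNneq x0 => t0; rewrite xE t0 scale0r.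
  by apply: (yx (s / t)); rewrite xE scalerA divfK.
case: (eigen_distinct B S xU) => [/eqP|[ea [t xE]]|[ea [t xE]]|[ea [t xE]]];
  first by rewrite (negbTE x0).
all: case: (eigen_distinct B S yU) => [//|[eb [s yE]]|[eb [s yE]]|[eb [s yE]]];
  try exact: prop xE yE.
all: by move: ab ac bc; rewrite -?ea -?eb ?eqxx.
Qed.

Lemma no_perspectivity_regular v u w a : frame v u w \in unitmx ->
  shape_regular U v u w a -> forall P (m : line K), ~ perspectivity iota sigma P m.
Proof.
move=> B S P l /perspectivity_axis [e [x [y [x0 yx xU yU]]]].
case: (eigen_regular B S xU) => [/eqP|[_ [t xE]]]; first by rewrite (negbTE x0).
case: (eigen_regular B S yU) => [y0|[_ [s yE]]].
  by apply: (yx 0); rewrite scale0r.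
have t0 : t != 0 by apply: contraNneq x0 => t0; rewrite xE t0 scale0r.
by apply: (yx (s / t)); rewrite xE scalerA divfK.
Qed.

Lemma order_dvdU m : reflect (exists a, U ^+ m = a%:M) (#[sigma]%g %| m)%N.
Proof.
have E : mx_of iota sigma ^+ m = d ^+ m *: U ^+ m by rewrite ME exprZn.
apply: (iffP (order_dvdP iota sigma m)); rewrite E => -[a aE].
  exists (d ^- m * a); rewrite -[LHS]scale1r -(mulVf (expf_neq0 m d_neq0)) -scalerA aE.
  by rewrite scale_scalar_mx.
by exists (d ^+ m * a); rewrite aE scale_scalar_mx.
Qed.

Lemma eigen_pow v a m : v *m U = a *: v -> v *m U ^+ m = a ^+ m *: v.
Proof.
move=> vU; elim: m => [|m IHm]; first by rewrite !expr0 mulmx1 scale1r.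
by rewrite exprSr -mulmxE mulmxA IHm -scalemxAl vU scalerA exprSr.
Qed.

Lemma scalar_frame v u w a (A : 'M[K]_3) : frame v u w \in unitmx ->
  v *m A = a *: v -> u *m A = a *: u -> w *m A = a *: w -> A = a%:M.
Proof.
move=> B vA uA wA; apply/row_matrixP => i; rewrite !rowE mul_mx_scalar.
have [x1 [x2 [x3 ->]]] := frame_coord (delta_mx 0 i) B.
by rewrite !mulmxDl -!scalemxAl vA uA wA !scalerDr !scalerA ![_ * a]mulrC.
Qed.

Lemma scale_inj x a b : x != 0 -> a *: x = b *: x -> a = b.
Proof.
by move=> x0 /eqP; rewrite -subr_eq0 -scalerBl scaler_eq0 (negbTE x0) orbF subr_eq0 => /eqP.
Qed.

Lemma order_distinct v u w a b c m : frame v u w \in unitmx ->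
  shape_distinct U v u w a b c ->
  (#[sigma]%g %| m)%N <-> a ^+ m = b ^+ m /\ b ^+ m = c ^+ m.
Proof.
move=> B [vU uU wU _]; have [v0 u0 w0 _ _] := frame_indep B.
split => [/order_dvdU [e eE]|[ab bc]].
  have E x l : x != 0 -> x *m U = l *: x -> l ^+ m = e.
    by move=> x0 xU; apply: (scale_inj x0); rewrite -(eigen_pow m xU) eE mul_mx_scalar.
  by rewrite (E v a) // (E u b) // (E w c).
apply/order_dvdU; exists (a ^+ m); apply: (scalar_frame B).
- exact: eigen_pow.
- by rewrite ab; apply: eigen_pow.
- by rewrite ab bc; apply: eigen_pow.
Qed.

Lemma order_homology v u w a b m : frame v u w \in unitmx ->
  shape_homology U v u w a b -> (#[sigma]%g %| m)%N <-> a ^+ m = b ^+ m.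
Proof.
move=> B [vU uU wU _]; have [v0 u0 w0 _ _] := frame_indep B.
split => [/order_dvdU [e eE]|ab].
  have E x l : x != 0 -> x *m U = l *: x -> l ^+ m = e.
    by move=> x0 xU; apply: (scale_inj x0); rewrite -(eigen_pow m xU) eE mul_mx_scalar.
  by rewrite (E v a) // (E w b).
apply/order_dvdU; exists (a ^+ m); apply: (scalar_frame B).
- exact: eigen_pow.
- exact: eigen_pow.
- by rewrite ab; apply: eigen_pow.
Qed.

Lemma jordan_pow v u a m : a != 0 -> v *m U = a *: v -> u *m U = a *: u + v ->
  u *m U ^+ m = a ^+ m *: (u + (m%:R / a) *: v).
Proof.
move=> a0 vU uU; elim: m => [|m IHm].
  by rewrite !expr0 mulmx1 mul0r scale0r addr0 scale1r.
rewrite exprSr -mulmxE mulmxA IHm -scalemxAl mulmxDl -scalemxAl uU vU exprSr -scalerA.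
congr (_ *: _); rewrite scalerDr -addrA; congr (_ + _).
rewrite !scalerA -{1}[v]scale1r -scalerDl; congr (_ *: _).
by rewrite -natr1; field.
Qed.

Lemma order_mixed v u w a b m : frame v u w \in unitmx ->
  shape_mixed U v u w a b ->
  (#[sigma]%g %| m)%N <-> a ^+ m = b ^+ m /\ m%:R = 0 :> K.
Proof.
move=> B [vU uU wU _]; have [v0 u0 w0 _ _] := frame_indep B.
have a0 := eigen_neq0 v0 vU; have am := expf_neq0 m a0.
split => [/order_dvdU [e eE]|[ab m0]].
  have E x l : x != 0 -> x *m U = l *: x -> l ^+ m = e.
    by move=> x0 xU; apply: (scale_inj x0); rewrite -(eigen_pow m xU) eE mul_mx_scalar.
  split; first by rewrite (E v a) // (E w b).
  have := jordan_pow m a0 vU uU; rewrite eE mul_mx_scalar -(E v a) // => /(scalerI am) Eu.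
  have : 0 *: v + 1 *: u + 0 *: w = (m%:R / a) *: v + 1 *: u + 0 *: w.
    by rewrite !scale0r add0r !addr0 scale1r {1}Eu addrC.
  by case/(frame_free B) => /esym/eqP; rewrite mulf_eq0 invr_eq0 (negbTE a0) orbF => /eqP.
apply/order_dvdU; exists (a ^+ m); apply: (scalar_frame B).
- exact: eigen_pow.
- by rewrite (jordan_pow m a0 vU uU) m0 mul0r scale0r addr0.
- by rewrite ab; apply: eigen_pow.
Qed.

Lemma order_elation v u w a m : frame v u w \in unitmx ->
  shape_elation U v u w a -> (#[sigma]%g %| m)%N <-> m%:R = 0 :> K.
Proof.
move=> B [vU uU wU]; have [v0 u0 w0 _ _] := frame_indep B.
have a0 := eigen_neq0 v0 vU; have am := expf_neq0 m a0.
split => [/order_dvdU [e eE]|m0].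
  have E x l : x != 0 -> x *m U = l *: x -> l ^+ m = e.
    by move=> x0 xU; apply: (scale_inj x0); rewrite -(eigen_pow m xU) eE mul_mx_scalar.
  have := jordan_pow m a0 vU wU; rewrite eE mul_mx_scalar -(E v a) // => /(scalerI am) Ew.
  have : 0 *: v + 0 *: u + 1 *: w = (m%:R / a) *: v + 0 *: u + 1 *: w.
    by rewrite !scale0r !add0r !addr0 scale1r {1}Ew addrC.
  by case/(frame_free B) => /esym/eqP; rewrite mulf_eq0 invr_eq0 (negbTE a0) orbF => /eqP.
apply/order_dvdU; exists (a ^+ m); apply: (scalar_frame B).
- exact: eigen_pow.
- exact: eigen_pow.
- by rewrite (jordan_pow m a0 vU wU) m0 mul0r scale0r addr0.
Qed.

(** The binomial coefficient counts the two steps from [w] to [v] along the chain; it is what makes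
    the order 4 instead of 2 in characteristic 2. *)
Lemma jordan_pow2 v u w a m : a != 0 -> shape_regular U v u w a ->
  w *m U ^+ m = a ^+ m *: (w + (m%:R / a) *: u + ('C(m, 2)%:R / a ^+ 2) *: v).
Proof.
move=> a0 [vU uU wU]; elim: m => [|m IHm].
  by rewrite !expr0 mulmx1 bin0n !mul0r !scale0r !addr0 scale1r.
rewrite exprSr -mulmxE mulmxA IHm -scalemxAl !mulmxDl -!scalemxAl wU uU vU.
rewrite (exprSr a m) -(scalerA (a ^+ m) a); congr (_ *: _).
rewrite (binS m 1) bin1 natrD -natr1; apply/rowP => i; rewrite !mxE.
by field.
Qed.

Lemma order_regular v u w a m : frame v u w \in unitmx ->
  shape_regular U v u w a ->
  (#[sigma]%g %| m)%N <-> m%:R = 0 :> K /\ 'C(m, 2)%:R = 0 :> K.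
Proof.
move=> B S; have [vU uU wU] := S; have [v0 u0 w0 _ _] := frame_indep B.
have a0 := eigen_neq0 v0 vU; have am := expf_neq0 m a0.
split => [/order_dvdU [e eE]|[m0 m2]].
  have E x l : x != 0 -> x *m U = l *: x -> l ^+ m = e.
    by move=> x0 xU; apply: (scale_inj x0); rewrite -(eigen_pow m xU) eE mul_mx_scalar.
  have := jordan_pow2 m a0 S; rewrite eE mul_mx_scalar -(E v a) // => /(scalerI am) Ew.
  have : 0 *: v + 0 *: u + 1 *: w = ('C(m, 2)%:R / a ^+ 2) *: v + (m%:R / a) *: u + 1 *: w.
    by rewrite !scale0r !add0r scale1r {1}Ew addrC [w + _]addrC addrA.
  case/(frame_free B) => /esym/eqP; rewrite mulf_eq0 invr_eq0 expf_eq0 (negbTE a0) orbF => /eqP m2.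
  by move=> /esym/eqP; rewrite mulf_eq0 invr_eq0 (negbTE a0) orbF => /eqP.
apply/order_dvdU; exists (a ^+ m); apply: (scalar_frame B).
- exact: eigen_pow.
- by rewrite (jordan_pow m a0 vU uU) m0 mul0r scale0r addr0.
- by rewrite (jordan_pow2 m a0 S) m0 m2 !mul0r !scale0r !addr0.
Qed.

End Collineation.

(** * Types and contributions *)

Section ShapeSummaries.

Variables (p n : nat) (p_prime : prime p) (n_ge1 : (1 <= n)%N).
Variables (q : nat) (q_def : q = (p ^ n)%N).
Variables (F : finFieldType) (F_card : #|F| = (q ^ 2)%N).
Variables (K : closedFieldType) (iota : {rmorphism F -> K}).
Variables (sigma : PGL3 F) (sigma_PGU : in_PGU iota q sigma).
Variables (d : K) (U : 'M[K]_3).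
Hypotheses (d_neq0 : d != 0) (ME : mx_of iota sigma = d *: U) (Uunit : U \in unitmx).
Hypothesis Uherm : forall x y, herm q (x *m U) (y *m U) = herm q x y.
Hypothesis Uq : forall i j, U i j ^+ (q ^ 2) = U i j.
Implicit Types (v u w x y : 'rV[K]_3) (a b c l t : K).
Notation h := (herm q).
Notation ord := #[sigma]%g.

Let qP : [pchar K].-nat q := pchar_prime_power p_prime q_def F_card iota.
Let q1 : (1 < q)%N := prime_power_gt1 p_prime n_ge1 q_def.
Let q0 : (0 < q)%N := ltnW q1.
Let pK : p \in [pchar K] := p_in_pchar p_prime q_def F_card iota.
Let fixesP := fixes_vline d_neq0 ME Uunit.

Lemma dvdn_pq : (p %| q)%N.
Proof. by rewrite q_def dvdn_exp. Qed.

Lemma norm1_rational a : a ^+ q * a = 1 -> a ^+ (q ^ 2) = a.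
Proof.
move=> aa; have a0 : a != 0 by apply: contra_eqN aa => /eqP ->; rewrite mulr0 eq_sym oner_eq0.
apply: (mulIf (expf_neq0 q a0)); rewrite [RHS]mulrC aa.
by rewrite -mulnn exprM -exprMn aa expr1n.
Qed.

Lemma norm1_expS a : a ^+ q * a = 1 -> a ^+ (q + 1) = 1.
Proof. by rewrite addn1 exprSr. Qed.

(** The Q-th power map applied to the coordinates of [v] gives another eigenvector for [a], which is
    proportional to [v] because the eigenspace is a line. *)
Lemma rational_eigen v a Q : [pchar K].-nat Q -> (forall i j, U i j ^+ Q = U i j) ->
  v != 0 -> v *m U = a *: v -> a ^+ Q = a ->
  (forall x, x *m U = a *: x -> exists t, x = t *: v) -> rational Q <[v]>%VS.
Proof.
move=> QP UQ v0 vU aQ eig; pose x : 'rV[K]_3 := \row_i v ord0 i ^+ Q.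
have [t /rowP xE] : exists t, x = t *: v.
  apply: eig; apply/rowP => j; move/rowP: vU => /(_ j); rewrite !mxE !sum3.
  move/(congr1 (fun z => z ^+ Q)); rewrite !(exprDn_pchar _ _ QP) !exprMn !UQ aQ.
  by rewrite !mxE.
by apply: (rational_frobenius (t := t)) => // i; have := xE i; rewrite !mxE.
Qed.

Lemma local_tame v u w a b r k k' m (P : point K) : frame v u w \in unitmx ->
  h v v = 0 -> h v u = 0 -> h v w != 0 ->
  v *m U = a *: v -> u *m U = b *: u + r *: v -> w *m U = m *: w + k *: u + k' *: v ->
  b != a -> point_vspace P = <[v]>%VS -> local_contribution iota q sigma P 1.
Proof.
move=> B vv vu vw vU uU wU ba Pv; have [v0 _ _ _ _] := frame_indep B.
have [c _ cE] := PGU_gram p_prime n_ge1 q_def F_card sigma_PGU.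
have hM (z : 'rV[{poly K}]_3) := herm_mulmx qP (@polyC K) z z cE.
apply: (@local_contribution_tame _ _ _ _ _ qP q1 _ hM _ _ _ (d * a) (d * b) (d * r) (d * m) (d * k)
  (d * k') B vv vu vw _ _ _ _ _ Pv).
- by rewrite ME -scalemxAr vU scalerA.
- by rewrite ME -scalemxAr uU scalerDr !scalerA.
- by rewrite ME -scalemxAr wU !scalerDr !scalerA.
- by rewrite mulf_neq0 // (eigen_neq0 Uunit v0 vU).
- by apply: contraNneq ba => /(mulfI d_neq0) ->.
Qed.

Lemma contribution_const (s : seq (point K)) (k N : nat) : uniq s ->
  (forall P : point K, P \in s <-> on_curve q P /\ fixes iota sigma P) ->
  (forall P : point K, P \in s -> local_contribution iota q sigma P k) ->
  N = (size s * k)%N -> contribution iota q sigma N.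
Proof.
move=> us sE lc ->; exists s, (fun=> k); split => //.
by elim: (s) => [|P s' IHs]; rewrite ?big_nil // big_cons -IHs /= mulSn.
Qed.

Lemma fixed_pointP (P : point K) : fixes iota sigma P ->
  exists v l, [/\ v != 0, point_vspace P = <[v]>%VS & v *m U = l *: v].
Proof.
have [v v0 Pv] := pointP P; rewrite Pv => /(fixesP v0) [l vU].
by exists v, l.
Qed.

Lemma point_of_eq (P : point K) v x t (v0 : v != 0) : x != 0 ->
  point_vspace P = <[x]>%VS -> x = t *: v -> P = point_of v0.
Proof.
move=> x0 Px xE; apply: val_inj; rewrite [LHS]Px; apply: (vline_eq _ xE).
by apply: contraNneq x0 => t0; rewrite xE t0 scale0r.
Qed.

Lemma frame_fullv v u w : frame v u w \in unitmx ->
  \dim (<[v]> + <[u]> + <[w]>)%VS = 3%N.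
Proof.
move=> B; have -> : (<[v]> + <[u]> + <[w]>)%VS = fullv.
  apply/eqP; rewrite eqEsubv subvf /=; apply/subvP => x _.
  have [x1 [x2 [x3 ->]]] := frame_coord x B.
  by rewrite !memv_add // memvZ // memv_line.
by rewrite dimvf.
Qed.

Lemma mem_addv_polar v u w x : frame v u w \in unitmx ->
  h v u = 0 -> h v w = 0 -> h v v != 0 -> (x \in (<[u]> + <[w]>)%VS) = (h v x == 0).
Proof.
move=> B vu vw vv; apply/idP/eqP => [/memv_addP [_ /vlineP [s ->] [_ /vlineP [t ->] ->]]|].
  by rewrite hermDr !hermZr vu vw !mulr0 addr0.
have [x1 [x2 [x3 ->]]] := frame_coord x B.
rewrite !hermDr !hermZr vu vw !mulr0 !addr0 => /eqP; rewrite mulf_eq0 (negbTE vv) orbF => /eqP ->.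
by rewrite scale0r add0r memv_add // memvZ // memv_line.
Qed.

Section Distinct.

Variables (v u w : 'rV[K]_3) (a b c : K).
Hypotheses (B : frame v u w \in unitmx) (S : shape_distinct U v u w a b c).

Variables (v0 : v != 0) (u0 : u != 0) (w0 : w != 0).

Lemma distinct_fixed_points (P : point K) : fixes iota sigma P <->
  [\/ P = point_of v0, P = point_of u0 | P = point_of w0].
Proof.
have [vU uU wU _] := S; split.
  move=> /fixed_pointP [x [l [x0 Px xU]]].
  case: (eigen_distinct B S xU) => [/eqP|[_ [t xE]]|[_ [t xE]]|[_ [t xE]]].
  - by rewrite (negbTE x0).
  - by apply: Or31; apply: point_of_eq xE.
  - by apply: Or32; apply: point_of_eq xE.
  - by apply: Or33; apply: point_of_eq xE.
by case=> ->; apply/fixesP => //; [exists a | exists b | exists c].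
Qed.

Lemma distinct_order_ndvd2 : ~ (ord %| 2)%N.
Proof.
have [_ _ _ [ab ac bc]] := S.
move/(order_distinct d_neq0 ME 2 B S) => [/eqP a2 /eqP b2].
move: a2 b2; rewrite !eqf_sqr (negbTE ab) (negbTE bc) /= => /eqP aE /eqP bE.
by move: ac; rewrite aE bE opprK eqxx.
Qed.

Lemma distinct_rational Q x l : [pchar K].-nat Q -> (forall i j, U i j ^+ Q = U i j) ->
  x != 0 -> x *m U = l *: x -> l ^+ Q = l -> rational Q <[x]>%VS.
Proof.
move=> QP UQ x0 xU lQ; apply: (rational_eigen QP UQ x0 xU lQ) => y yU.
have [_ _ _ [ab ac bc]] := S.
have prop t s z : x = t *: z -> y = s *: z -> exists r, y = r *: x.
  move=> xE yE; have t0 : t != 0 by apply: contraNneq x0 => t0; rewrite xE t0 scale0r.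
  by exists (s / t); rewrite xE scalerA divfK.
case: (eigen_distinct B S yU) => [->|[eb [s yE]]|[eb [s yE]]|[eb [s yE]]];
  first by exists 0; rewrite scale0r.
all: case: (eigen_distinct B S xU) => [/eqP|[ea [t xE]]|[ea [t xE]]|[ea [t xE]]];
  rewrite ?(negbTE x0) //; try exact: prop xE yE.
all: by move: ab ac bc; rewrite -?ea -?eb ?eqxx.
Qed.

Lemma distinct_not_rational Q x l : [pchar K].-nat Q -> (forall i j, U i j ^+ Q = U i j) ->
  x != 0 -> x *m U = l *: x -> rational Q <[x]>%VS -> l ^+ Q = l.
Proof.
move=> QP UQ x0 xU /(rational_vlineP x0) [t t0 tx].
have tx0 : t *: x != 0 by rewrite scaler_eq0 (negbTE t0).
have txU : (t *: x) *m U = l *: (t *: x) by rewrite -scalemxAl xU !scalerA mulrC.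
move: tx0 txU tx; move: (t *: x) => y y0 yU yQ.
have [i yi] : exists i, y ord0 i != 0.
  apply/existsP; rewrite -negb_forall; apply: contraNN y0 => /forallP y0.
  by apply/eqP/rowP => i; rewrite mxE; apply/eqP; apply: y0.
apply: (mulIf yi); move/rowP: yU => /(_ i); rewrite !mxE sum3 => E.
by rewrite -{1}(yQ i) -exprMn -E !(exprDn_pchar _ _ QP) !exprMn !UQ !yQ.
Qed.

Lemma distinct_typeB : coprime ord p -> typeB iota p sigma (point_of v0) (point_of u0) (point_of w0).
Proof.
move=> cop; split => //; last by split; apply/distinct_fixed_points; [apply: Or31 | apply: Or32 | apply: Or33].
  by case=> P [l [/(no_perspectivity_distinct d_neq0 ME Uunit B S)]].
exact: frame_fullv.
Qed.

End Distinct.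

Lemma coprime_dvd_p m : (ord %| m)%N -> ~~ (p %| m)%N -> coprime ord p.
Proof. by move=> om pm; apply: coprime_dvdl om _; rewrite coprime_sym prime_coprime. Qed.

Lemma p_ndvd_qS : ~~ (p %| q + 1)%N.
Proof. by rewrite dvdn_addr ?dvdn_pq // dvdn1; case: (p) p_prime => [|[]]. Qed.

Lemma p_dvd_q2 : (p %| q ^ 2)%N.
Proof. by rewrite -mulnn dvdn_mull // dvdn_pq. Qed.

Lemma p_ndvd_q2B1 : ~~ (p %| q ^ 2 - 1)%N.
Proof.
apply/negP => pq; have := p_dvd_q2; rewrite -(subnK (_ : 1 <= q ^ 2)%N) ?expn_gt0 ?q0 //.
by rewrite dvdn_addr // dvdn1; case: (p) p_prime => [|[]].
Qed.

Lemma p_ndvd_q2Bq1 : ~~ (p %| q ^ 2 - q + 1)%N.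
Proof.
rewrite dvdn_addr; first by rewrite dvdn1; case: (p) p_prime => [|[]].
by rewrite dvdn_sub ?p_dvd_q2 ?dvdn_pq.
Qed.

Lemma off_curve v (v0 : v != 0) : h v v != 0 -> ~ on_curve q (point_of v0).
Proof. by move=> vv /on_curve_vline /eqP; rewrite (negbTE vv). Qed.

(** The eigenvectors are pairwise orthogonal, so none is isotropic and no fixed point lies on the
    curve. The last conclusion serves to exclude type (B3) later. *)
Lemma typeB1_of_orthogonal_eigenvectors v u w a b c : frame v u w \in unitmx ->
  shape_distinct U v u w a b c -> a ^+ q * a = 1 -> b ^+ q * b = 1 -> c ^+ q * c = 1 ->
  [/\ (ord %| q + 1)%N, typeB1 iota q p sigma, contribution iota q sigma 0
    & forall P : point K, fixes iota sigma P -> rational (q ^ 2) P].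
Proof.
move=> B S aa bb cc; have [v0 u0 w0 _ _] := frame_indep B.
have [vU uU wU [ab ac bc]] := S.
have ordq : (ord %| q + 1)%N.
  by apply/(order_distinct d_neq0 ME _ B S); rewrite !norm1_expS.
have [ab1 ba1] := norm1_neq qP q1 aa ab; have [ac1 ca1] := norm1_neq qP q1 aa ac.
have [bc1 cb1] := norm1_neq qP q1 bb bc.
have vu := herm_eigen Uherm vU uU ab1; have uv := herm_eigen Uherm uU vU ba1.
have vw := herm_eigen Uherm vU wU ac1; have wv := herm_eigen Uherm wU vU ca1.
have uw := herm_eigen Uherm uU wU bc1; have wu := herm_eigen Uherm wU uU cb1.
have vv : h v v != 0.
  by apply/eqP => vv; case/eqP: v0; apply: (herm_nondegl q1 B).
have uu : h u u != 0.
  by apply/eqP => uu; case/eqP: u0; apply: (herm_nondegl q1 B).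
have ww : h w w != 0.
  by apply/eqP => ww; case/eqP: w0; apply: (herm_nondegl q1 B).
have off (P : point K) : fixes iota sigma P -> ~ on_curve q P.
  by case/(distinct_fixed_points B S v0 u0 w0) => ->; apply: off_curve.
have q2P : [pchar K].-nat (q ^ 2)%N by rewrite pnatX qP.
have rat (P : point K) : fixes iota sigma P -> rational (q ^ 2) P.
  case/(distinct_fixed_points B S v0 u0 w0) => ->.
  - by apply: (distinct_rational B S q2P Uq _ vU (norm1_rational aa)).
  - by apply: (distinct_rational B S q2P Uq _ uU (norm1_rational bb)).
  - by apply: (distinct_rational B S q2P Uq _ wU (norm1_rational cc)).
have TB := distinct_typeB B S v0 u0 w0 (coprime_dvd_p ordq p_ndvd_qS).
have [_ _ _ [f1 f2 f3]] := TB.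
split => //; last first.
  apply: (@contribution_const [::] 0) => // P; rewrite in_nil.
  by split => // -[Pc /off].
do 3!eexists; split; [exact: TB| split; exact: rat | split; exact: off | | exact: ordq].
split; [apply: (@polar_isP _ _ _ v) | apply: (@polar_isP _ _ _ u) | apply: (@polar_isP _ _ _ w)] => // x.
- exact: mem_addv_polar B vu vw vv.
- by rewrite (@mem_addv_polar u v w) // (frame_swap (frame_rot B)).
- exact: mem_addv_polar (frame_rot (frame_rot B)) wv wu ww.
Qed.

(** Here [u] and [w] are isotropic and paired with each other, and [v] is orthogonal to both. At
    either point of the curve [v] is the tangent direction and the other isotropic vector the
    transversal one, so both points are tame. The order does not divide q+1 because a^(q+1) = 1
    while b^(q+1) is not 1. *)
Lemma typeB2_of_two_cycle v u w a b c : frame v u w \in unitmx ->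
  shape_distinct U v u w a b c -> a ^+ q * a = 1 -> b ^+ q * c = 1 -> c ^+ q * b = 1 ->
  [/\ (ord %| q ^ 2 - 1)%N, ~ (ord %| q + 1)%N, typeB2 iota q p sigma, contribution iota q sigma 2
    & forall P : point K, fixes iota sigma P -> rational (q ^ 2) P].
Proof.
move=> B S aa bc1 cb1; have [v0 u0 w0 _ _] := frame_indep B.
have [vU uU wU [ab ac bc]] := S.
have [a0 b0 c0] : [/\ a != 0, b != 0 & c != 0].
  by split; [exact: (eigen_neq0 Uunit v0 vU) | exact: (eigen_neq0 Uunit u0 uU) | exact: (eigen_neq0 Uunit w0 wU)].
have bq : b ^+ (q ^ 2) = b.
  by apply: (mulIf (expf_neq0 q c0)); rewrite [RHS]mulrC cb1 -mulnn exprM -exprMn bc1 expr1n.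
have cq : c ^+ (q ^ 2) = c.
  by apply: (mulIf (expf_neq0 q b0)); rewrite [RHS]mulrC bc1 -mulnn exprM -exprMn cb1 expr1n.
have aq := norm1_rational aa.
have [ab1 ba1] := norm1_neq qP q1 aa ab; have [ac1 ca1] := norm1_neq qP q1 aa ac.
have bb1 : b ^+ q * b != 1.
  by rewrite -bc1; apply: contraNneq bc => /(mulfI (expf_neq0 q b0)) ->.
have cc1 : c ^+ q * c != 1.
  by rewrite -cb1; apply: contraNneq bc => /(mulfI (expf_neq0 q c0)) ->.
have vu := herm_eigen Uherm vU uU ab1; have uv := herm_eigen Uherm uU vU ba1.
have vw := herm_eigen Uherm vU wU ac1; have wv := herm_eigen Uherm wU vU ca1.
have uu := herm_eigen Uherm uU uU bb1; have ww := herm_eigen Uherm wU wU cc1.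
have vv : h v v != 0.
  by apply/eqP => vv; case/eqP: v0; apply: (herm_nondegl q1 B).
have uw : h u w != 0.
  by apply/eqP => uw; case/eqP: u0; apply: (herm_nondegl q1 B).
have wu : h w u != 0.
  by apply/eqP => wu; case/eqP: w0; apply: (herm_nondegl q1 B).
have q2P : [pchar K].-nat (q ^ 2)%N by rewrite pnatX qP.
have rat (P : point K) : fixes iota sigma P -> rational (q ^ 2) P.
  case/(distinct_fixed_points B S v0 u0 w0) => ->.
  - by apply: (distinct_rational B S q2P Uq _ vU aq).
  - by apply: (distinct_rational B S q2P Uq _ uU bq).
  - by apply: (distinct_rational B S q2P Uq _ wU cq).
have ordq : (ord %| q ^ 2 - 1)%N.
  have q21 : (0 < q ^ 2)%N by rewrite expn_gt0 q0.
  have E (z : K) : z != 0 -> z ^+ (q ^ 2) = z -> z ^+ (q ^ 2 - 1) = 1.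
    by move=> z0 zq; apply: (mulIf z0); rewrite -exprSr -addn1 subnK // mul1r.
  by apply/(order_distinct d_neq0 ME _ B S); rewrite !E.
have nordq : ~ (ord %| q + 1)%N.
  move/(order_distinct d_neq0 ME _ B S) => [+ _]; rewrite norm1_expS // addn1 exprSr.
  by move/esym/eqP; rewrite (negbTE bb1).
have TB := distinct_typeB B S v0 u0 w0 (coprime_dvd_p ordq p_ndvd_q2B1).
have [_ _ _ [f1 f2 f3]] := TB.
split => //.
  do 3!eexists; split; [exact: TB| split; exact: rat | | exact: ordq | exact: nordq].
  by split; [apply: off_curve | apply/on_curve_vline | apply/on_curve_vline].
have uw' : point_of u0 != point_of w0.
  apply/eqP => /(congr1 val) /= E; have /vlineP [t] : u \in <[w]>%VS by rewrite -E memv_line.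
  by have [_ _ _ + _] := frame_indep (frame_swap (frame_rot (frame_rot B))) => /(_ t).
apply: (@contribution_const [:: point_of u0; point_of w0] 1) => //=.
- by rewrite inE uw'.
- move=> P; rewrite !inE; split.
    by case/orP => /eqP ->; split; rewrite ?f2 ?f3 //; apply/on_curve_vline.
  move=> [Pc /(distinct_fixed_points B S v0 u0 w0) [E|->|->]]; rewrite ?eqxx ?orbT //.
  by case: (off_curve (v0 := v0) vv); rewrite -E.
move=> P; rewrite !inE => /orP [] /eqP ->.
- apply: (@local_tame u v w b a 0 0 0 c) => //; rewrite ?scale0r ?addr0 //.
  exact: (frame_swap (frame_rot B)).
- apply: (@local_tame w v u c a 0 0 0 b) => //; rewrite ?scale0r ?addr0 //.
  exact: (frame_rot (frame_rot B)).
Qed.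

(** Since b = a^(-q), the quotient a/b is a^(q+1); and (q+1)(q^2-q+1) = q^3+1, where a^(q^3+1) = 1
    by going once round the cycle. *)
Lemma three_cycle_pow a b c : a != 0 -> b != 0 -> c != 0 ->
  a ^+ q * b = 1 -> b ^+ q * c = 1 -> c ^+ q * a = 1 ->
  [/\ a ^+ (q ^ 2) = c, a ^+ (q ^ 6) = a & a ^+ (q ^ 2 - q + 1) = b ^+ (q ^ 2 - q + 1)].
Proof.
move=> a0 b0 c0 ab bc ca.
have aq : a ^+ (q ^ 2) = c.
  by apply: (mulIf (expf_neq0 q b0)); rewrite [RHS]mulrC bc -mulnn exprM -exprMn ab expr1n.
have aq3 : a ^+ (q ^ 3) * a = 1 by rewrite expnSr exprM aq.
split => //.
  apply: (mulIf (expf_neq0 (q ^ 3) a0)); rewrite [RHS]mulrC aq3.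
  by rewrite (expnD q 3 3) exprM -exprMn aq3 expr1n.
apply: (mulIf (expf_neq0 (q ^ 2 - q + 1) (expf_neq0 q a0))).
rewrite -!exprMn [b * _]mulrC ab expr1n -exprS -exprM.
have -> : (q.+1 * (q ^ 2 - q + 1) = (q ^ 3).+1)%N.
  have qq : (q <= q ^ 2)%N by rewrite -mulnn leq_pmulr.
  by rewrite !expnS expn0 !muln1 in qq *; nia.
by rewrite exprSr.
Qed.

(** Each eigenvector pairs only with the next one in the cycle, so all three are isotropic and tame.
    They are not rational over F_(q^2), as a^(q^2) = c differs from [a]. The last conclusion serves
    to exclude type (B1). *)
Lemma typeB3_of_three_cycle v u w a b c : frame v u w \in unitmx ->
  shape_distinct U v u w a b c -> a ^+ q * b = 1 -> b ^+ q * c = 1 -> c ^+ q * a = 1 ->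
  [/\ (ord %| q ^ 2 - q + 1)%N, typeB3 iota q p sigma, contribution iota q sigma 3
    & forall P : point K, fixes iota sigma P -> on_curve q P].
Proof.
move=> B S ab1 bc1 ca1; have [v0 u0 w0 vu' vw'] := frame_indep B.
have [vU uU wU [ab ac bc]] := S.
have [a0 b0 c0] : [/\ a != 0, b != 0 & c != 0].
  by split; [exact: (eigen_neq0 Uunit v0 vU) | exact: (eigen_neq0 Uunit u0 uU) | exact: (eigen_neq0 Uunit w0 wU)].
have [aq aq6 abm] := three_cycle_pow a0 b0 c0 ab1 bc1 ca1.
have [bq bq6 bcm] := three_cycle_pow b0 c0 a0 bc1 ca1 ab1.
have [cq cq6 _] := three_cycle_pow c0 a0 b0 ca1 ab1 bc1.
have neq (z z' z'' : K) : z != 0 -> z ^+ q * z' = 1 -> z' != z'' -> z ^+ q * z'' != 1.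
  by move=> z0 <- zz; apply: contraNneq zz => /(mulfI (expf_neq0 q z0)) ->.
have [ba [ca cb]] : b != a /\ (c != a /\ c != b) by rewrite !(eq_sym _ a) (eq_sym c).
have vv := herm_eigen Uherm vU vU (neq _ _ _ a0 ab1 ba).
have vw := herm_eigen Uherm vU wU (neq _ _ _ a0 ab1 bc).
have uu := herm_eigen Uherm uU uU (neq _ _ _ b0 bc1 cb).
have uv := herm_eigen Uherm uU vU (neq _ _ _ b0 bc1 ca).
have ww := herm_eigen Uherm wU wU (neq _ _ _ c0 ca1 ac).
have wu := herm_eigen Uherm wU uU (neq _ _ _ c0 ca1 ab).
have vu : h v u != 0.
  by apply/eqP => vu; case/eqP: v0; apply: (herm_nondegl q1 B).
have uw : h u w != 0.
  by apply/eqP => uw; case/eqP: u0; apply: (herm_nondegl q1 B).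
have wv : h w v != 0.
  by apply/eqP => wv; case/eqP: w0; apply: (herm_nondegl q1 B).
have q2P : [pchar K].-nat (q ^ 2)%N by rewrite pnatX qP.
have q6P : [pchar K].-nat (q ^ 6)%N by rewrite pnatX qP.
have Uq6 i j : U i j ^+ (q ^ 6) = U i j.
  by rewrite (expnD q 2 4) exprM Uq (expnD q 2 2) exprM !Uq.
have rat (P : point K) : fixes iota sigma P -> rational (q ^ 6) P.
  case/(distinct_fixed_points B S v0 u0 w0) => ->.
  - by apply: (distinct_rational B S q6P Uq6 _ vU aq6).
  - by apply: (distinct_rational B S q6P Uq6 _ uU bq6).
  - by apply: (distinct_rational B S q6P Uq6 _ wU cq6).
have ordq : (ord %| q ^ 2 - q + 1)%N by apply/(order_distinct d_neq0 ME _ B S).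
have TB := distinct_typeB B S v0 u0 w0 (coprime_dvd_p ordq p_ndvd_q2Bq1).
have [_ _ _ [f1 f2 f3]] := TB.
have on (P : point K) : fixes iota sigma P -> on_curve q P.
  by case/(distinct_fixed_points B S v0 u0 w0) => ->; apply/on_curve_vline.
have nrat x l (x0 : x != 0) : x *m U = l *: x -> l ^+ (q ^ 2) != l -> ~ rational (q ^ 2) (point_of x0).
  by move=> xU lq /(distinct_not_rational q2P Uq x0 xU) /eqP; rewrite (negbTE lq).
split => //.
  do 3!eexists; split; [exact: TB| split; exact: rat | | split; exact: on | exact: ordq].
  by split; [apply: (nrat _ a) | apply: (nrat _ b) | apply: (nrat _ c)] => //; rewrite ?aq ?bq ?cq // eq_sym.
have neqP x y (x0 : x != 0) (y0 : y != 0) z : frame x y z \in unitmx -> point_of x0 != point_of y0.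
  move=> Bxy; apply/eqP => /(congr1 val) /= E; have /vlineP [t] : y \in <[x]>%VS by rewrite E memv_line.
  by have [_ _ _ + _] := frame_indep Bxy => /(_ t).
apply: (@contribution_const [:: point_of v0; point_of u0; point_of w0] 1) => //=.
- rewrite !inE negb_or (neqP _ _ _ _ w) //= (neqP _ _ _ _ u (frame_swap B)) /=.
  by rewrite (neqP _ _ _ _ v (frame_rot B)).
- move=> P; rewrite !inE; split.
    by case/or3P => /eqP ->; split => //; apply/on_curve_vline.
  by move=> [_ /(distinct_fixed_points B S v0 u0 w0) [->|->|->]]; rewrite eqxx ?orbT.
move=> P; rewrite !inE => /or3P [] /eqP ->.
- apply: (@local_tame v w u a c 0 0 0 b) => //; rewrite ?scale0r ?addr0 //.
  exact: (frame_swap B).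
- apply: (@local_tame u v w b a 0 0 0 c) => //; rewrite ?scale0r ?addr0 //.
  exact: (frame_swap (frame_rot B)).
- apply: (@local_tame w u v c b 0 0 0 a) => //; rewrite ?scale0r ?addr0 //.
  exact: (frame_swap (frame_rot (frame_rot B))).
Qed.

Lemma frame_scale v u w r s t : r != 0 -> s != 0 -> t != 0 ->
  frame v u w \in unitmx -> frame (r *: v) (s *: u) (t *: w) \in unitmx.
Proof.
move=> r0 s0 t0 B; apply: frame_unit => a b c; rewrite !scalerA => /(frame_free0 B) [].
by move=> /eqP + /eqP + /eqP; rewrite !mulf_eq0 (negbTE r0) (negbTE s0) (negbTE t0) !orbF
  => /eqP -> /eqP -> /eqP ->.
Qed.

Lemma natr_p m : (m%:R = 0 :> K) <-> (p %| m)%N.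
Proof. by rewrite (dvdn_pcharf pK); split => [->|/eqP]. Qed.

Lemma q2_pchar : [pchar K].-nat (q ^ 2)%N.
Proof. by rewrite pnatX qP. Qed.

Lemma homology_rational v u w a b : frame v u w \in unitmx -> shape_homology U v u w a b ->
  exists w', [/\ frame v u w' \in unitmx, shape_homology U v u w' a b & rational_vector (q ^ 2) w'].
Proof.
move=> B S; have [vU uU wU ab] := S; have [_ _ w0 _ _] := frame_indep B.
have [aa bb _ _ _] := homology_form qP q1 Uherm B S.
have : rational (q ^ 2) <[w]>%VS.
  apply: (rational_eigen q2_pchar Uq w0 wU (norm1_rational bb)) => x xU.
  case: (eigen_homology B S xU) => [->|[E]|[_ //]]; first by exists 0; rewrite scale0r.
  by rewrite E eqxx in ab.
case/(rational_vlineP w0) => t t0 tw; exists (t *: w); split => //.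
  by have := frame_scale (oner_neq0 K) (oner_neq0 K) t0 B; rewrite !scale1r.
by split => //; rewrite -scalemxAl wU !scalerA mulrC.
Qed.

(** The fixed points on the curve are the q+1 points of the axis, the polar line of the center [w].
    At each of them the tangent passes through the center, where the eigenvalue [b] differs from
    [a], so each contributes 1. *)
Lemma typeA_of_homology v u w a b : frame v u w \in unitmx -> shape_homology U v u w a b ->
  [/\ (ord %| q + 1)%N, typeA iota q sigma & contribution iota q sigma (q + 1)].
Proof.
move=> B0 S0; have [{w B0 S0} w [B S wq]] := homology_rational B0 S0.
have [v0 u0 w0 _ _] := frame_indep B; have [vU uU wU ab] := S.
have [aa bb [wv wu] [vw uw] ww] := homology_form qP q1 Uherm B S.
have ordq : (ord %| q + 1)%N.
  by apply/(order_homology d_neq0 ME _ B S); rewrite !norm1_expS.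
have Bw : frame w v u \in unitmx := frame_rot (frame_rot B).
have axis y : y \in polar q w -> exists s t, y = s *: v + t *: u.
  have [x1 [x2 [x3 ->]]] := frame_coord y B.
  rewrite mem_polar !hermDr !hermZr wv wu !mulr0 !add0r mulf_eq0 (negbTE ww) orbF => /eqP ->.
  by exists x1, x2; rewrite scale0r addr0.
have axisU y : y \in polar q w -> y *m U = a *: y.
  by case/axis => s [t ->]; rewrite mulmxDl -!scalemxAl vU uU scalerDr !scalerA ![a * _]mulrC.
have [s [us ss sE]] := chord_points qP q1 Bw wv wu vw uw ww.
split => //.
  split => //; exists (point_of w0), (polar_line q1 w0); split.
  - split.
      apply: (perspectivityI d_neq0 ME Uunit (a := a) (v := w)) => // y.
      have [x1 [x2 [x3 ->]]] := frame_coord y B; exists (x3 * (b - a)).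
      rewrite !mulmxDl -!scalemxAl vU uU wU; apply/rowP => i; rewrite !mxE; ring.
    by rewrite -memvE mem_polar (negbTE ww).
  - exact: off_curve.
  - exact: (chord_polar qP q1 w0 Bw wq).
  - split; [exact: rational_vline | exact: rational_polar | ].
    by apply: (@polar_isP _ _ _ w) => // x; rewrite mem_polar.
apply: (@contribution_const s 1) => // [P|P|]; last by rewrite ss muln1 addn1.
  rewrite sE; split=> [[Pc Pl]|[Pc Pf]]; split=> //.
    have [x x0 Px] := pointP P; move: Pl; rewrite Px -memvE => /axisU xU.
    by apply/fixesP => //; exists a.
  have [x [l [x0 Px xU]]] := fixed_pointP Pf; rewrite Px -memvE mem_polar.
  case: (eigen_homology B S xU) => [/eqP|[_ [r [t ->]]]|[_ [t xE]]].
  - by rewrite (negbTE x0).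
  - by rewrite hermDr !hermZr wv wu !mulr0 addr0.
  case: (off_curve (v0 := w0) ww).
  by have <- // : P = point_of w0 by apply: point_of_eq xE.
rewrite sE => -[Pc Pl]; have [x x0 Px] := pointP P.
rewrite Px in Pc Pl; move/on_curve_vline: Pc => xx; rewrite -memvE in Pl.
have xU := axisU _ Pl; have [r [t xE]] := axis _ Pl.
have xw : h x w = 0 by rewrite xE (hermDl qP) !hermZl vw uw !mulr0 addr0.
(* Any second vector on the axis can be the transversal direction; [v] or [u] is taken, whichever is
   independent of [x]. *)
have [y [By yU]] : exists y, frame x w y \in unitmx /\ y *m U = a *: y.
  have [t0|t0] := eqVneq t 0.
    have r0 : r != 0 by apply: contraNneq x0 => r0; rewrite xE r0 t0 !scale0r addr0.
    exists u; split => //; rewrite xE t0 scale0r addr0.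
    by have := frame_scale r0 (oner_neq0 K) (oner_neq0 K) (frame_swap B); rewrite !scale1r.
  exists v; split => //; rewrite xE; apply: frame_unit => c1 c2 c3.
  have -> : c1 *: (r *: v + t *: u) + c2 *: w + c3 *: v
    = (c1 * r + c3) *: v + (c1 * t) *: u + c2 *: w by apply/rowP => i; rewrite !mxE; ring.
  case/(frame_free0 B) => E /eqP; rewrite mulf_eq0 (negbTE t0) orbF => /eqP c10 ->.
  by move: E; rewrite c10 mul0r add0r.
apply: (@local_tame x w y a b 0 0 0 a) => //; rewrite ?scale0r ?addr0 //; last by rewrite eq_sym.
by apply/eqP => xy; case/eqP: x0; apply: (herm_nondegl q1 By).
Qed.

(** The order is divisible by p and divides p(q+1), so p^2 does not divide it; it is not p, since
    a^p = b^p would give a = b. Only [v] is fixed on the curve, and it is tame: the tangent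
    direction there is [w], with eigenvalue [b]. *)
Lemma typeE_of_mixed v u w a b : frame v u w \in unitmx -> shape_mixed U v u w a b ->
  [/\ (p %| ord)%N, ~ (p ^ 2 %| ord)%N, ord <> p, typeE iota q p sigma
    & contribution iota q sigma 1].
Proof.
move=> B S; have [v0 u0 w0 _ _] := frame_indep B; have [vU uU wU ab] := S.
have [aa bb [vv vu] [vw wv] ww] := mixed_form qP q1 Uherm B S.
have ordP := order_mixed d_neq0 ME Uunit _ B S.
have p_ord : (p %| ord)%N.
  by have [_ /natr_p] := (ordP ord).1 (dvdnn _).
have p2_ord : ~ (p ^ 2 %| ord)%N.
  move=> p2; have : (ord %| p * (q + 1))%N.
    apply/ordP; split; last by apply/natr_p; rewrite dvdn_mulr.
    by rewrite mulnC !exprM !norm1_expS.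
  move/(dvdn_trans p2); rewrite -mulnn dvdn_pmul2l ?prime_gt0 //; exact/negP/p_ndvd_qS.
have ord_p : ord <> p.
  move=> E; have [+ _] := (ordP ord).1 (dvdnn _); rewrite E.
  have pP : [pchar K].-nat p by rewrite pnatE.
  move/(frob_inj pP (prime_gt1 p_prime)) => abE.
  by rewrite abE eqxx in ab.
have Pv : rational (q ^ 2) (point_of v0).
  apply: (rational_eigen q2_pchar Uq v0 vU (norm1_rational aa)) => x xU.
  case: (eigen_mixed B S xU) => [->|[_ //]|[E]]; first by exists 0; rewrite scale0r.
  by rewrite E eqxx in ab.
have Qw : rational (q ^ 2) (point_of w0).
  apply: (rational_eigen q2_pchar Uq w0 wU (norm1_rational bb)) => x xU.
  case: (eigen_mixed B S xU) => [->|[E]|[_ //]]; first by exists 0; rewrite scale0r.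
  by rewrite E eqxx in ab.
have fv : fixes iota sigma (point_of v0) by apply/fixesP => //; exists a.
have fw : fixes iota sigma (point_of w0) by apply/fixesP => //; exists b.
have cv : on_curve q (point_of v0) by apply/on_curve_vline.
split => //.
  split => //; exists (point_of v0), (point_of w0); split => //; split => //.
  exact: off_curve.
apply: (@contribution_const [:: point_of v0] 1) => // P; rewrite inE.
  split => [/eqP -> //|[Pc Pf]].
  have [x [l [x0 Px xU]]] := fixed_pointP Pf.
  case: (eigen_mixed B S xU) => [/eqP|[_ [t xE]]|[_ [t xE]]].
  - by rewrite (negbTE x0).
  - by apply/eqP; apply: point_of_eq xE.
  case: (off_curve (v0 := w0) ww).
  by have <- // : P = point_of w0 by apply: point_of_eq xE.
move=> /eqP ->; apply: (@local_tame v w u a b 0 0 1 a) => //; rewrite ?scale0r ?addr0 ?scale1r //.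
  exact: frame_swap.
by rewrite eq_sym.
Qed.

(** The eigenspace is a plane, so [rational_eigen] does not apply. Instead [v] spans the image of U
    - a, and a nonzero row of that matrix has entries in F_(q^2). *)
Lemma elation_rational v u w a : frame v u w \in unitmx -> shape_elation U v u w a ->
  exists v' w', [/\ frame v' u w' \in unitmx, shape_elation U v' u w' a & rational_vector (q ^ 2) v'].
Proof.
move=> B S; have [vU uU wU] := S; have [v0 _ _ _ _] := frame_indep B.
have [aa _ _ _ _] := elation_form qP q1 Uherm B S; have aq := norm1_rational aa.
have eA (i : 'I_3) : exists t, row i U - a *: delta_mx 0 i = t *: v.
  have [x1 [x2 [x3 E]]] := frame_coord (delta_mx 0 i) B; exists x3.
  rewrite rowE E !mulmxDl -!scalemxAl vU uU wU.
  by apply/rowP => j; rewrite !mxE; ring.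
have [i iA] : exists i, row i U - a *: delta_mx 0 i != 0.
  apply/existsP; rewrite -negb_forall; apply/negP => /forallP A0.
  case/eqP: v0; apply: (addrI (a *: w)); rewrite -wU addr0.
  have -> : U = a%:M.
    apply/row_matrixP => i; rewrite [RHS]rowE mul_mx_scalar; apply/eqP.
    by rewrite -subr_eq0; apply: A0.
  by rewrite mul_mx_scalar.
have [t tE] := eA i; have t0 : t != 0 by apply: contraNneq iA => t0; rewrite tE t0 scale0r.
exists (t *: v), (t *: w); split.
- by have := frame_scale t0 (oner_neq0 K) t0 B; rewrite scale1r.
- by split; rewrite // -scalemxAl ?vU ?wU ?scalerDr !scalerA mulrC.
move=> j; rewrite -tE !mxE (exprDn_pchar _ _ q2_pchar) (exprNn_pchar _ q2_pchar) exprMn aq Uq.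
by case: (_ && _); rewrite ?expr1n // expr0n expn_eq0 eqn0Ngt q0.
Qed.

Lemma polar_pole_polar v (v0 : v != 0) : rational_vector (q ^ 2) v ->
  pole_polar q (point_of v0) (polar_line q1 v0).
Proof.
move=> vq; split; [exact: rational_vline | exact: rational_polar | ].
by apply: (@polar_isP _ _ _ v) => // x; rewrite mem_polar.
Qed.

Lemma germ_gram : exists c, forall z : 'rV[{poly K}]_3,
  herm q (z *m map_mx (@polyC K) (mx_of iota sigma)) (z *m map_mx (@polyC K) (mx_of iota sigma))
    = c%:P * herm q z z.
Proof.
have [c _ cE] := PGU_gram p_prime n_ge1 q_def F_card sigma_PGU.
by exists c => z; exact: (herm_mulmx qP (@polyC K) z z cE).
Qed.

(** All points of the axis are fixed, but as [h u u] is nonzero only the center [v] is on the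
    curve. *)
Lemma typeC_of_elation v u w a : frame v u w \in unitmx -> shape_elation U v u w a ->
  [/\ ord = p, typeC iota q p sigma & contribution iota q sigma (q + 2)].
Proof.
move=> B0 S0; have [{v B0 S0} v [{}w [B S vq]]] := elation_rational B0 S0.
have [v0 u0 w0 _ _] := frame_indep B; have [vU uU wU] := S.
have [aa vv [vu uv] vw uu] := elation_form qP q1 Uherm B S.
have ordP m : (ord %| m)%N <-> (p %| m)%N.
  by rewrite -natr_p; apply: (order_elation d_neq0 ME Uunit _ B S).
have ord1 : ord != 1%N.
  apply/eqP => E; have := (ordP 1%N).1; rewrite E dvdnn => /(_ isT).
  by rewrite dvdn1; case: (p) p_prime => [|[]].
have ordp : ord = p by apply/(prime_nt_dvdP p_prime ord1)/ordP.
have a0 := eigen_neq0 Uunit v0 vU.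
have cv : on_curve q (point_of v0) by apply/on_curve_vline.
have elU y : exists s, y *m U = a *: y + s *: v.
  have [x1 [x2 [x3 ->]]] := frame_coord y B; exists x3.
  by rewrite !mulmxDl -!scalemxAl vU uU wU; apply/rowP => i; rewrite !mxE; ring.
have axisU y : y \in polar q v -> y *m U = a *: y.
  have [x1 [x2 [x3 ->]]] := frame_coord y B.
  rewrite mem_polar !hermDr !hermZr vv vu !mulr0 !add0r mulf_eq0 (negbTE vw) orbF => /eqP ->.
  by rewrite scale0r addr0 mulmxDl -!scalemxAl vU uU; apply/rowP => i; rewrite !mxE; ring.
split => //.
  split => //; exists (point_of v0), (polar_line q1 v0); split => //.
  - split; first exact: (perspectivityI d_neq0 ME Uunit (a := a) (v := v)).
    by rewrite -memvE mem_polar vv.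
  - exact: tangent_polar.
  - exact: polar_pole_polar.
apply: (@contribution_const [:: point_of v0] (q + 2)) => [//|P|P|]; last by rewrite mul1n.
  rewrite inE; split => [/eqP ->|[Pc Pf]]; first by split => //; apply/fixesP => //; exists a.
  have [x [l [x0 Px xU]]] := fixed_pointP Pf.
  case: (eigen_elation B S xU) => [/eqP|[_ [s [t xE]]]]; first by rewrite (negbTE x0).
  move: Pc; rewrite Px => /on_curve_vline; rewrite xE !hermDr !hermZr !(hermDl qP) !hermZl.
  rewrite vv vu uv !(mulr0, addr0, add0r) => /eqP.
  rewrite !mulf_eq0 (negbTE uu) orbF expf_eq0 q0 orbb => /eqP t0.
  by apply/eqP; apply: (@point_of_eq _ _ _ s _ x0 Px); rewrite xE t0 scale0r addr0.
rewrite inE => /eqP ->; have [c hM] := germ_gram.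
apply: (@local_contribution_elation _ _ _ _ _ qP q1 _ hM v u w (d * a) (d * a) 0 (d * a) 0 d) => //.
- by rewrite ME -scalemxAr vU scalerA.
- by rewrite ME -scalemxAr uU scalerA scale0r addr0.
- by rewrite ME -scalemxAr wU scalerDr scalerA scale0r addr0.
- by rewrite mulf_neq0.
Qed.

Lemma regular_rational v u w a : frame v u w \in unitmx -> shape_regular U v u w a ->
  exists v' u' w', [/\ frame v' u' w' \in unitmx, shape_regular U v' u' w' a & rational_vector (q ^ 2) v'].
Proof.
move=> B S; have [vU uU wU] := S; have [v0 _ _ _ _] := frame_indep B.
have [aa _ _ _] := regular_form qP q1 Uherm B S.
have : rational (q ^ 2) <[v]>%VS.
  apply: (rational_eigen q2_pchar Uq v0 vU (norm1_rational aa)) => x xU.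
  by case: (eigen_regular B S xU) => [->|[_ //]]; exists 0; rewrite scale0r.
case/(rational_vlineP v0) => t t0 tv; exists (t *: v), (t *: u), (t *: w); split => //.
  exact: frame_scale.
by split; rewrite -scalemxAl ?vU ?uU ?wU ?scalerDr !scalerA [t * a]mulrC.
Qed.

(** An odd p divides C(p, 2). For p = 2 the coefficient C(2, 2) = 1 rules out order 2, while C(4, 2)
    = 6 is even. *)
Lemma regular_order v u w a : frame v u w \in unitmx -> shape_regular U v u w a ->
  (ord = p /\ p <> 2%N) \/ (ord = 4%N /\ p = 2%N).
Proof.
move=> B S.
have ordP m : (ord %| m)%N <-> (p %| m)%N /\ (p %| 'C(m, 2))%N.
  by rewrite -!natr_p; apply: (order_regular d_neq0 ME Uunit _ B S).
have [p2|p2] := eqVneq p 2%N.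
  right; split => //; have o4 : (ord %| 4)%N by apply/ordP; rewrite p2.
  have o2 : ~ (ord %| 2)%N by move/ordP; rewrite p2 => -[].
  have o44 := @dvdn_leq ord 4 isT o4.
  by move: o2 o44 o4; case: (ord) => [|[|[|[|[|]]]]].
left; split; last exact/eqP.
have ord1 : ord != 1%N.
  apply/eqP => E; have := (ordP 1%N).1; rewrite E dvdnn => /(_ isT) [].
  by rewrite dvdn1; case: (p) p_prime => [|[]].
apply/(prime_nt_dvdP p_prime ord1)/ordP; split => //.
apply: prime_dvd_bin => //=; rewrite ltn_neqAle eq_sym p2 /=; exact: prime_gt1.
Qed.

Lemma typeD_of_regular v u w a : frame v u w \in unitmx -> shape_regular U v u w a ->
  typeD iota q p sigma /\ contribution iota q sigma 2.
Proof.
move=> B0 S0; have oE := regular_order B0 S0.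
have [{v B0 S0} v [{}u [{}w [B S vq]]]] := regular_rational B0 S0.
have [v0 u0 w0 _ _] := frame_indep B; have [vU uU wU] := S.
have [aa vv [vu uv] vw] := regular_form qP q1 Uherm B S.
have a0 := eigen_neq0 Uunit v0 vU.
have cv : on_curve q (point_of v0) by apply/on_curve_vline.
have fv : fixes iota sigma (point_of v0) by apply/fixesP => //; exists a.
split.
  split => //; first by case=> P [l [/(no_perspectivity_regular d_neq0 ME Uunit B S)]].
  exists (point_of v0), (polar_line q1 v0); split => //.
  - by split => //; apply: rational_vline.
  - exact: tangent_polar.
  - exact: polar_pole_polar.
  apply: (fixes_stable d_neq0 ME Uunit) => y; rewrite !mem_polar => vy.
  by have := Uherm v y; rewrite vU hermZl (eqP vy) => /eqP; rewrite mulf_eq0 expf_eq0 (negbTE a0) andbF.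
apply: (@contribution_const [:: point_of v0] 2) => [//|P|P|//].
  rewrite inE; split => [/eqP -> //|[Pc Pf]].
  have [x [l [x0 Px xU]]] := fixed_pointP Pf.
  case: (eigen_regular B S xU) => [/eqP|[_ [t xE]]]; first by rewrite (negbTE x0).
  by apply/eqP; apply: point_of_eq xE.
rewrite inE => /eqP ->; have [c hM] := germ_gram.
apply: (@local_contribution_regular_unipotent _ _ _ _ _ qP q1 _ hM v u w (d * a) (d * a) d (d * a) d 0) => //.
- by rewrite ME -scalemxAr vU scalerA.
- by rewrite ME -scalemxAr uU scalerDr scalerA.
- by rewrite ME -scalemxAr wU scalerDr scalerA scale0r addr0.
- by rewrite mulf_neq0.
Qed.

End ShapeSummaries.

Local Close Scope ring_scope.

(** * Arithmetic of the orders *)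

Section Arithmetic.

Variables (q m : nat).
Hypothesis q_gt1 : 1 < q.

(** The difference of the two numbers is q - 2, and q^2-q+1 = (q+1)(q-2) + 3. *)
Lemma dvd3_of_dvd_both : m %| q ^ 2 - 1 -> m %| q ^ 2 - q + 1 -> m %| 3.
Proof.
move=> m1 m2; have qq : q <= q ^ 2 by rewrite -mulnn leq_pmulr // ltnW.
have mq2 : m %| q - 2.
  have -> : q - 2 = q ^ 2 - 1 - (q ^ 2 - q + 1) by lia.
  exact: dvdn_sub.
have qE : q ^ 2 - q + 1 = (q + 1) * (q - 2) + 3 by rewrite -mulnn in qq *; nia.
by move: m2; rewrite qE dvdn_addr // dvdn_mull.
Qed.

Lemma dvd_qS_q2B1 : m %| q + 1 -> m %| q ^ 2 - 1.
Proof. by move=> mq; rewrite -[1](exp1n 2) subn_sqr dvdn_mull. Qed.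

(** Modulo 3, q^2-q+1 is the square of q+1. *)
Lemma dvd3_trace : 3 %| q ^ 2 - q + 1 -> 3 %| q + 1.
Proof.
move=> d3; have qq : q <= q ^ 2 by rewrite -mulnn leq_pmulr // ltnW.
have : 3 %| (q + 1) ^ 2.
  have -> : (q + 1) ^ 2 = q ^ 2 - q + 1 + 3 * q by rewrite -!mulnn in qq *; nia.
  by rewrite dvdn_add // dvdn_mulr.
by rewrite Euclid_dvdX // => /andP [].
Qed.

End Arithmetic.

Theorem theorem2p7
  (p n : nat) (p_prime : prime p) (n_ge1 : 1 <= n)
  (q : nat) (q_def : q = p ^ n)
  (F : finFieldType) (F_card : #|F| = q ^ 2)
  (K : closedFieldType) (iota : {rmorphism F -> K})
  (K_algebraic : integralRange iota)
  (sigma : PGL3 F) (sigma_PGU : in_PGU iota q sigma) (sigma_neq1 : sigma <> 1%g) :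
  let ord := #[sigma]%g in
  let i_eq := contribution iota q sigma in
  let A := typeA iota q sigma in
  let B1 := typeB1 iota q p sigma in
  let B2 := typeB2 iota q p sigma in
  let B3 := typeB3 iota q p sigma in
  let C := typeC iota q p sigma in
  let D := typeD iota q p sigma in
  let E := typeE iota q p sigma in
  (ord = 2 /\ 2 %| q + 1 -> A /\ i_eq (q + 1)) /\
  (ord = 3 /\ 3 %| q + 1 /\ B3 -> i_eq 3) /\
  (ord <> 2 /\ ord %| q + 1 /\ A -> i_eq (q + 1)) /\
  (ord <> 2 /\ ord %| q + 1 /\ B1 -> i_eq 0) /\
  (ord %| q ^ 2 - 1 /\ ~ (ord %| q + 1) -> B2 /\ i_eq 2) /\
  (ord <> 3 /\ ord %| q ^ 2 - q + 1 -> B3 /\ i_eq 3) /\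
  (p = 2 /\ ord = 4 -> D /\ i_eq 2) /\
  (ord = p /\ p <> 2 /\ D -> i_eq 2) /\
  (ord = p /\ C -> i_eq (q + 2)) /\
  (ord <> p /\ p %| ord /\ ord <> 4 -> E /\ i_eq 1) /\
  [\/ ord = 2 /\ 2 %| q + 1
    , ord = 3 /\ 3 %| q + 1 /\ B3
    , ord <> 2 /\ ord %| q + 1 /\ A
    | [\/ ord <> 2 /\ ord %| q + 1 /\ B1
        , ord %| q ^ 2 - 1 /\ ~ (ord %| q + 1)
        , ord <> 3 /\ ord %| q ^ 2 - q + 1
        | [\/ p = 2 /\ ord = 4
            , ord = p /\ p <> 2 /\ D
            , ord = p /\ C
            | ord <> p /\ p %| ord /\ ord <> 4]]].
Proof.
move=> ord i_eq A B1 B2 B3 C D E.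
have q1 := prime_power_gt1 p_prime n_ge1 q_def.
have [d [U [d0 ME Uu Uherm Uq]]] := PGU_unitary p_prime n_ge1 q_def F_card sigma_PGU.
have ord1 : ord <> 1 by move/eqP; rewrite order_eq1 => /eqP.
have ord3 : ord %| 3 -> ord = 3.
  by move=> o3; apply/(prime_nt_dvdP (isT : prime 3)) => //; apply/eqP.
have pS := p_ndvd_qS p_prime n_ge1 q_def.
have pB1 := p_ndvd_q2B1 p_prime n_ge1 q_def.
have pBq := p_ndvd_q2Bq1 p_prime n_ge1 q_def.
have B_hom P1 P2 P3 P l : typeB iota p sigma P1 P2 P3 -> ~ homology iota sigma P l.
  by case=> _ nh _ _ hom; apply: nh; exists P, l.
have not_p m : ord %| m -> ~~ (p %| m) -> ~ (p %| ord).
  by move=> om /negP pm po; apply: pm; apply: dvdn_trans om.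
have not_p4 m : ord %| m -> ~~ (p %| m) -> ~ (p = 2 /\ ord = 4).
  by move=> om pm [p2 o4]; apply: (not_p _ om pm); rewrite o4 p2.
have not_pE m : ord %| m -> ~~ (p %| m) -> ord <> p.
  by move=> om pm oE; apply: (not_p _ om pm); rewrite oE.
(* When the order is prime to p, the last four implications hold vacuously; [wild] below refutes the
   divisibility hypotheses of the first six when p divides the order. *)
have tame m : ord %| m -> ~~ (p %| m) ->
  [/\ p = 2 /\ ord = 4 -> D /\ i_eq 2, ord = p /\ p <> 2 /\ D -> i_eq 2,
    ord = p /\ C -> i_eq (q + 2) & ord <> p /\ p %| ord /\ ord <> 4 -> E /\ i_eq 1].
  move=> om pm; split.
  - by move/(not_p4 _ om pm).
  - by case=> /(not_pE _ om pm).
  - by case=> /(not_pE _ om pm).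
  - by case=> _ [/(not_p _ om pm)].
have wild : p %| ord ->
  [/\ forall m, ord = m /\ m %| q + 1 -> False, ~ ord %| q + 1, ~ ord %| q ^ 2 - 1
    & ~ ord %| q ^ 2 - q + 1].
  move=> po; split=> [m [oE mq]|om|om|om].
  - by apply: (not_p (q + 1)) po => //; rewrite oE.
  - exact: (not_p _ om pS).
  - exact: (not_p _ om pB1).
  - exact: (not_p _ om pBq).
have [[a Ua]|[v [u [w [B S]]]]] := jordan_shape U.
  case: ord1; apply/eqP; rewrite -dvdn1; apply/(order_dvdU d0 ME).
  by exists a; rewrite expr1.
case: S => [[a [b [c S]]]|[a [b S]]|[a [b S]]|[a [S|S]]].
- have [{S B v u w a b c} v [u [w [a [b [c [B S norms]]]]]]] :=
    distinct_form (pchar_prime_power p_prime q_def F_card iota) q1 Uherm B S.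
  have nP := no_perspectivity_distinct d0 ME Uu B S.
  have n2 : ord <> 2.
    by move=> o2; apply: (distinct_order_ndvd2 d0 ME B S); rewrite -/ord o2.
  have nA : ~ A by case=> _ [P [l [[/nP]]]].
  case: norms => [[aa bb cc]|[aa bc cb]|[ab bc ca]].
  + have [oq TB1 C0 rat] := typeB1_of_orthogonal_eigenvectors p_prime n_ge1 q_def F_card d0 ME Uu Uherm Uq B S aa bb cc.
    have [t7 t8 t9 t10] := tame _ oq pS.
    split; first by case=> /n2.
    (* A vertex of a triangle of type (B3) is a fixed point not rational over F_(q^2), whereas all
       fixed points are rational here. *)
    split; first by case=> _ [_ [P1 [P2 [P3 [[_ _ _ [/rat f1 _ _]] _ [nr _ _] _ _]]]]].
    split; first by case=> _ [_ /nA].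
    split; first by [].
    split; first by case.
    split; first by case=> n3 /(dvd3_of_dvd_both q1 (dvd_qS_q2B1 oq))/ord3.
    by do 4!(split; first by []); apply: Or44; apply: Or41.
  + have [oq noq TB2 C2 rat] := typeB2_of_two_cycle p_prime n_ge1 q_def F_card sigma_PGU d0 ME Uu Uherm Uq B S aa bc cb.
    have [t7 t8 t9 t10] := tame _ oq pB1.
    split; first by case=> /n2.
    split; first by case=> _ [_ [P1 [P2 [P3 [[_ _ _ [/rat f1 _ _]] _ [nr _ _] _ _]]]]].
    split; first by case=> _ [/noq].
    split; first by case=> _ [/noq].
    split; first by [].
    split; first by case=> n3 /(dvd3_of_dvd_both q1 oq)/ord3.
    by do 4!(split; first by []); apply: Or44; apply: Or42.
  + have [oq TB3 C3 onC] := typeB3_of_three_cycle p_prime n_ge1 q_def F_card sigma_PGU d0 ME Uu Uherm Uq B S ab bc ca.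
    have [t7 t8 t9 t10] := tame _ oq pBq.
    (* An element of order 3 in this shape falls under the second case, whose condition on q+1 is
       automatic. *)
    have o3 : ord = 3 -> 3 %| q + 1 by move=> o3; apply: dvd3_trace q1 _; rewrite -o3.
    split; first by case=> /n2.
    split; first by [].
    split; first by case=> _ [_ /nA].
    split; first by case=> _ [_ [P1 [P2 [P3 [[_ _ _ [/onC f1 _ _]] _ [nr _ _] _ _]]]]].
    split; first by case=> /(dvd3_of_dvd_both q1)/(_ oq)/ord3 oE []; rewrite oE; apply: o3.
    split; first by [].
    do 4!(split; first by []).
    have [oE|/eqP n3] := eqVneq ord 3; first by apply: Or42; split => //; split => //; apply: o3.
    by apply: Or44; apply: Or43.
- have [oq TA CA] := typeA_of_homology p_prime n_ge1 q_def F_card sigma_PGU d0 ME Uu Uherm Uq B S.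
  have [t7 t8 t9 t10] := tame _ oq pS.
  have [_ [P [l [hom _ _ _]]]] := TA.
  split; first by [].
  split; first by case=> _ [_ [P1 [P2 [P3 [/B_hom/(_ hom)]]]]].
  split; first by [].
  split; first by case=> _ [_ [P1 [P2 [P3 [/B_hom/(_ hom)]]]]].
  split; first by case.
  split; first by case=> n3 /(dvd3_of_dvd_both q1 (dvd_qS_q2B1 oq))/ord3.
  do 4!(split; first by []).
  have [oE|/eqP n2] := eqVneq ord 2; first by apply: Or41; split => //; rewrite -oE.
  by apply: Or43.
- have [po p2o op TE C1] := typeE_of_mixed p_prime n_ge1 q_def F_card sigma_PGU d0 ME Uu Uherm Uq B S.
  have [w1 w2 w3 w4] := wild po.
  (* Order 4 together with p dividing it would mean p = 2, and then p^2 would divide the order. *)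
  have n4 : ord <> 4.
    move=> o4; apply: p2o; rewrite -/ord o4.
    by move: po; rewrite -/ord o4 (Euclid_dvdX 2 2) // andbT dvdn_prime2 // => /eqP ->.
  split; first by move/w1.
  split; first by case=> o3 [/(conj o3)/w1].
  split; first by case=> _ [/w2].
  split; first by case=> _ [/w2].
  split; first by case=> /w3.
  split; first by case=> _ /w4.
  split; first by case=> _ /n4.
  split; first by case=> /op.
  split; first by case=> /op.
  by split => //; apply: Or44; apply: Or44; apply: Or44.
- have [op TC Cq] := typeC_of_elation p_prime n_ge1 q_def F_card sigma_PGU d0 ME Uu Uherm Uq B S.
  have [w1 w2 w3 w4] : [/\ forall m, ord = m /\ m %| q + 1 -> False, ~ ord %| q + 1,
      ~ ord %| q ^ 2 - 1 & ~ ord %| q ^ 2 - q + 1] by apply: wild; rewrite /ord op.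
  split; first by move/w1.
  split; first by case=> o3 [/(conj o3)/w1].
  split; first by case=> _ [/w2].
  split; first by case=> _ [/w2].
  split; first by case=> /w3.
  split; first by case=> _ /w4.
  split; first by rewrite /ord op => -[->].
  split; first by case=> _ [_ [_ nel _]]; case: nel; have [_ [P [l [el _ _ _]]]] := TC; exists P, l.
  split; first by [].
  split; first by case=> /(_ op).
  by apply: Or44; apply: Or44; apply: Or43.
- have [TD C2] := typeD_of_regular p_prime n_ge1 q_def F_card sigma_PGU d0 ME Uu Uherm Uq B S.
  have oE := regular_order p_prime q_def F_card d0 ME Uu B S.
  have [w1 w2 w3 w4] : [/\ forall m, ord = m /\ m %| q + 1 -> False, ~ ord %| q + 1,
      ~ ord %| q ^ 2 - 1 & ~ ord %| q ^ 2 - q + 1].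
    by apply: wild; rewrite /ord; case: oE => [[-> _]|[-> ->]].
  split; first by move/w1.
  split; first by case=> o3 [/(conj o3)/w1].
  split; first by case=> _ [/w2].
  split; first by case=> _ [/w2].
  split; first by case=> /w3.
  split; first by case=> _ /w4.
  split; first by [].
  split; first by [].
  split; first by case=> _ [_ [P [l [[/(no_perspectivity_regular d0 ME Uu B S)]]]]].
  split; first by case=> nop [_ n4]; case: oE => [[/nop]|[/n4]].
  apply: Or44; apply: Or44; case: oE => [[op p2]|[o4 p2]]; [exact: Or42 | exact: Or41].
Qed.
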